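(* For each $n\geq1$ let $\mathcal{P}_n$ be the finite set of plane partitions of size $n$ with the uniform probability measure, and let $X_n^+(\pi)=w_+(\pi)/n^{2/3}$ and $X_n^-(\pi)=w_-(\pi)/n^{2/3}$. Let $c=1/(2\zeta(3))^{1/3}$. Then as $n\to\infty$, the random variable $X_n^+-X_n^-$ has as limit law the normal distribution $\mathcal{N}(0,c)$ with mean $0$ and variance $c$.
   Context: A plane partition $\pi$ is an array $(\pi_{i,j})_{i,j\geq 0}$ of nonnegative integers, only finitely many nonzero, weakly decreasing in each index. Its size is $|\pi|=\sum_{i,j}\pi_{i,j}$. Here $w_+(\pi)=\sum_{i<j}\pi_{i,j}$ and $w_-(\pi)=\sum_{i>j}\pi_{i,j}$. $\zeta$ is the Riemann zeta function. *)

(* Defs.v *)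
From HB Require Import structures.
From mathcomp Require Import all_boot all_order all_algebra.
From mathcomp Require Import all_classical all_reals all_analysis.
Set Implicit Arguments. Unset Strict Implicit. Unset Printing Implicit Defensive.
Import Order.TTheory GRing.Theory Num.Theory.
Import numFieldNormedType.Exports.
Local Open Scope classical_set_scope.
Local Open Scope ring_scope.

Definition plane_partition (p : nat -> nat -> nat) : Prop :=
  [/\ (forall i j, (p i.+1 j <= p i j)%N),
      (forall i j, (p i j.+1 <= p i j)%N) &
      finite_set [set ij : nat * nat | p ij.1 ij.2 != 0%N]].

Definition pp_size (p : nat -> nat -> nat) : nat :=
  (\sum_(ij \in [set: nat * nat]) p ij.1 ij.2)%N.

Definition w_plus (p : nat -> nat -> nat) : nat :=
  (\sum_(ij \in [set ij : nat * nat | (ij.1 < ij.2)%N]) p ij.1 ij.2)%N.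
Definition w_minus (p : nat -> nat -> nat) : nat :=
  (\sum_(ij \in [set ij : nat * nat | (ij.2 < ij.1)%N]) p ij.1 ij.2)%N.

(* Finite encoding of arrays supported in the n x n box with entries <= n,
   extended by 0 outside the box.  Every plane partition of size n >= 1 is
   of this form (a nonzero entry at (i,j) forces size >= (i+1)(j+1)), so
   [PP n] below is in bijection with the plane partitions of size n. *)
Definition ext (n : nat) (f : {ffun 'I_n * 'I_n -> 'I_n.+1}) : nat -> nat -> nat :=
  fun i j => match @insub nat (fun k => k < n)%N 'I_n i,
                   @insub nat (fun k => k < n)%N 'I_n j with
             | Some a, Some b => nat_of_ord (f (a, b))
             | _, _ => 0%N
             end.

Definition PP (n : nat) : {set {ffun 'I_n * 'I_n -> 'I_n.+1}} :=
  [set f | `[< plane_partition (ext f) /\ pp_size (ext f) = n >] ].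

Definition Xdiff {R : realType} (n : nat) (f : {ffun 'I_n * 'I_n -> 'I_n.+1}) : R :=
  ((w_plus (ext f))%:R - (w_minus (ext f))%:R) / (n%:R `^ (2 / 3 : R)).

Definition cdf_Xdiff {R : realType} (n : nat) (x : R) : R :=
  #|[set f in PP n | Xdiff f <= x]|%:R / #|PP n|%:R.

(* Convergence in law of a sequence of distribution functions F_n to a
   probability measure mu on R: F_n(x) -> mu(]-oo,x]) at every continuity
   point x of the limit distribution function (i.e. mu {x} = 0). *)
Definition cvg_in_law {R : realType} (F : nat -> R -> R)
    (mu : set R -> \bar R) : Prop :=
  forall x : R, mu [set x] = 0%E ->
    (fun n => F n x) @ \oo --> fine (mu [set` `]-oo, x]]).

Definition zeta3 {R : realType} : R := limn (fun n => \sum_(1 <= k < n) (k%:R ^- 3 : R)).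

(* Main.v *)
Require Import Defs.
From HB Require Import structures.
From mathcomp Require Import all_boot all_order all_algebra.
From mathcomp Require Import all_classical all_reals all_analysis.
From mathcomp Require Import zify ring lra.
Import Order.TTheory GRing.Theory Num.Theory.
Import numFieldNormedType.Exports.
Local Open Scope classical_set_scope.
Local Open Scope ring_scope.

(* Cutting a plane partition into its diagonals and applying the local rules of RSK turns it
   into an array m of natural numbers with |pi| = sum (i+j+1) m(i,j), w_+ = sum i m(i,j) and
   w_- = sum j m(i,j).  The uniform measure on arrays of weight n is invariant under each
   exchange m(i,j) <-> m(j,i), so given the |m(i,j) - m(j,i)| the difference w_+ - w_- is a
   sum of independent signs times (i-j) |m(i,j) - m(j,i)|, and a Lindeberg argument reduces
   the limit law to the concentration of V = sum (i-j)^2 (m(i,j) - m(j,i))^2 at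
   n^{4/3} / (2 zeta(3))^{1/3}.

   The moments of V are explicit sums of ratios r_n(k) = p(n-k)/p(n), where p(n) is the number
   of plane partitions of n.  From n p(n) = sum_{a,k} a^2 p(n-ka) one gets
   log p(n) = (3/2) kap n^{2/3} + o(n^{2/3}) with kap^3 = 2 zeta(3), by induction in both
   directions.  Weighting each array by exp(s Y), with Y the number of cells of a set S at which
   m is nonzero, turns this weak estimate into an upper bound for the sum of the r_n over the
   levels of S, and since r_n is nonincreasing it follows that r_n(k) <= exp(-kap k/n^{1/3}) + o(1)
   uniformly in k; the recursion, which is an exact identity for the r_n, then gives the matching
   lower bound in mean.  No saddle point analysis is needed. *)

Set Implicit Arguments.
Unset Strict Implicit.

(** * Growth diagrams *)

Section GrowthDiagrams.
Local Open Scope nat_scope.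

(** All estimates are one-sided, because only upper bounds for the ratios are proved pointwise. This
    suffices: the mean square deviation of V needs an upper bound for its second moment and a lower
    bound for its first. The former follows from the pointwise bound at a sum of two weights, where
    the exponential factors; the latter holds because an exact recursion leaves little room for the
    ratios to lie below the exponential.

    The tilt extracts pointwise information from a logarithmic estimate by a coincidence of scales:
    the levels up to order n^{1/3} contain of order n^{2/3} cells, which is also the order of log
    p(n). An excess of the ratios on a positive proportion of these cells would change the count by
    a factor exp(const n^{2/3}).

    The limit variance is consistent with this: V has mean about (1/3) sum k (a^3 - a) exp(-kap k a
    / n^{1/3}), hence about 2 zeta(3) n^{4/3} / kap^4 = n^{4/3} / kap.

    In the Lindeberg argument the indicator of a half line is first replaced by a normal
    distribution function of small positive variance, so that each sign change has a third-order
    error with a fixed constant. *)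

Definition interlaced (la mu : nat -> nat) := forall k, mu k.+1 <= la k <= mu k.

(* The local rule of RSK: [nu], [la], [mu] sit at three corners of a unit square with entry
   [a], and the result sits at the fourth. *)
Definition up_rule (nu la mu : nat -> nat) (a : nat) : nat -> nat := fun k =>
  if k is k'.+1 then maxn (la k) (mu k) + minn (la k') (mu k') - nu k'
  else maxn (la 0) (mu 0) + a.

(** The inverse rule: it recovers the inner corner from the outer one [rho]. The entry is recovered
    separately, as the excess of [rho 0] over its larger neighbour. *)
Definition down_rule (rho la mu : nat -> nat) : nat -> nat := fun k =>
  maxn (la k.+1) (mu k.+1) + minn (la k) (mu k) - rho k.+1.

(** Interlacing gives max(la (k+1), mu (k+1)) <= nu k <= min(la k, mu k), so the natural-number
    subtraction in the rule never truncates. *)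
Lemma up_rule_interlaced nu la mu a : interlaced nu la -> interlaced nu mu ->
  interlaced la (up_rule nu la mu a) /\ interlaced mu (up_rule nu la mu a).
Proof.
move=> h1 h2; split=> k; have := h1 k; have := h2 k; rewrite /up_rule;
  case: k => [|k]; have := h1 0; have := h2 0; try (have := h1 k; have := h2 k); lia.
Qed.

Lemma down_rule_interlaced rho la mu : interlaced la rho -> interlaced mu rho ->
  interlaced (down_rule rho la mu) la /\ interlaced (down_rule rho la mu) mu.
Proof.
move=> h1 h2; split=> k; rewrite /down_rule; have := h1 k; have := h2 k;
  have := h1 k.+1; have := h2 k.+1; lia.
Qed.

Lemma down_ruleK rho la mu : interlaced la rho -> interlaced mu rho ->
  up_rule (down_rule rho la mu) la mu (rho 0 - maxn (la 0) (mu 0)) =1 rho.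
Proof.
move=> h1 h2 [|k]; rewrite /up_rule /down_rule.
  by have := h1 0; have := h2 0; lia.
by have := h1 k; have := h2 k; have := h1 k.+1; have := h2 k.+1; lia.
Qed.

Lemma up_ruleK nu la mu a : interlaced nu la -> interlaced nu mu ->
  down_rule (up_rule nu la mu a) la mu =1 nu.
Proof. by move=> h1 h2 k; rewrite /up_rule /down_rule; have := h1 k; have := h2 k; lia. Qed.

(** Because max + min = la + mu in each row. This is the inclusion-exclusion recursion of the
    rectangle sums of the array. *)
Lemma up_rule_sum nu la mu a K : interlaced nu la -> interlaced nu mu ->
  la K = 0 -> mu K = 0 -> nu K = 0 ->
  \sum_(k < K.+1) up_rule nu la mu a k + \sum_(k < K.+1) nu k =
  a + \sum_(k < K.+1) la k + \sum_(k < K.+1) mu k.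
Proof.
move=> h1 h2 l0 m0 n0.
rewrite big_ord_recl /= [X in _ + X = _]big_ord_recr /= n0 addn0 -addnA.
have -> : \sum_(i < K) (maxn (la (bump 0 i)) (mu (bump 0 i)) + minn (la i) (mu i) - nu i)
  + \sum_(i < K) nu i = \sum_(i < K) maxn (la (bump 0 i)) (mu (bump 0 i)) +
    \sum_(i < K) minn (la i) (mu i) :> nat.
  rewrite -!big_split /=; apply: eq_bigr => i _; have := h1 i; have := h2 i; lia.
have -> : \sum_(i < K) minn (la i) (mu i) = \sum_(i < K.+1) minn (la i) (mu i).
  by rewrite [RHS]big_ord_recr /= l0 m0 minnn addn0.
rewrite (addnC (maxn _ _)) -!addnA; congr (a + _).
have -> : maxn (la 0) (mu 0) + (\sum_(i < K) maxn (la (bump 0 i)) (mu (bump 0 i)) +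
    \sum_(i < K.+1) minn (la i) (mu i)) =
   \sum_(i < K.+1) maxn (la i) (mu i) + \sum_(i < K.+1) minn (la i) (mu i).
  by rewrite [X in _ = X + _]big_ord_recl /= addnA.
by rewrite -!big_split /=; apply: eq_bigr => i _; lia.
Qed.

(** Recursion on a grid with prescribed boundaries: [b0] on the axis i = 0 and [b1] on j = 0. The
    growth diagram starts from zero boundaries, its inverse from the diagonals of a plane
    partition. *)
Fixpoint fill (T : Type) (f : nat -> nat -> T -> T -> T -> T) (b0 b1 : nat -> T)
    (i : nat) : nat -> T :=
  if i is i'.+1 then
    fix row j := if j is j'.+1
      then f i' j' (@fill T f b0 b1 i' j') (@fill T f b0 b1 i' j) (row j') else b1 i
  else b0.

(* [growth m i j] is the partition attached to the vertex (i,j) of the growth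
   diagram of the array m. *)
Definition growth (m : nat -> nat -> nat) : nat -> nat -> nat -> nat :=
  @fill _ (fun i j nu la mu => up_rule nu la mu (m i j)) (fun _ _ => 0) (fun _ _ => 0).

Lemma growthS m i j : growth m i.+1 j.+1 =
  up_rule (growth m i j) (growth m i j.+1) (growth m i.+1 j) (m i j).
Proof. by []. Qed.

Lemma growth0l m j k : growth m 0 j k = 0. Proof. by []. Qed.
Lemma growth0r m i k : growth m i 0 k = 0. Proof. by case: i. Qed.

Lemma growth_interlaced m i j : interlaced (growth m i j) (growth m i.+1 j) /\
  interlaced (growth m i j) (growth m i j.+1).
Proof.
elim: i j => [|i IHi] j.
  elim: j => [|j [IHj1 IHj2]].
    by split=> k; rewrite ?growth0l ?growth0r.
  split; last by move=> k.
  have [] := @up_rule_interlaced (growth m 0 j) (growth m 0 j.+1)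
    (growth m 1 j) (m 0 j) _ _ => //.
elim: j => [|j [IHj1 IHj2]].
  split=> k; rewrite ?growth0r // growthS.
  have [_ h] := @up_rule_interlaced (growth m i 0) (growth m i 1)
    (growth m i.+1 0) (m i 0) (proj2 (IHi 0)) (proj1 (IHi 0)).
  by have := h k; rewrite growth0r.
have [A B] := @up_rule_interlaced (growth m i.+1 j) (growth m i.+1 j.+1)
    (growth m i.+2 j) (m i.+1 j) IHj2 IHj1.
have [C D] := @up_rule_interlaced (growth m i j.+1) (growth m i j.+2)
    (growth m i.+1 j.+1) (m i j.+1) (proj2 (IHi j.+1)) (proj1 (IHi j.+1)).
by split; rewrite growthS.
Qed.

Lemma growth_vanish m i j k : minn i j <= k -> growth m i j k = 0.
Proof.
elim: i j k => [|i IHi] j k; first by [].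
elim: j k => [|j IHj] k; first by rewrite growth0r.
case: k => [|k]; first by lia.
move=> h; rewrite growthS /up_rule.
case: (leqP i.+1 j.+1) => hij.
  by rewrite (IHi j.+1 k.+1) ?(IHi j.+1 k) ?(IHj k.+1); lia.
by rewrite (IHi j.+1 k.+1) ?(IHj k) ?(IHj k.+1); lia.
Qed.

Lemma growth_sum m K i j : i <= K -> j <= K ->
  \sum_(k < K.+1) growth m i j k = \sum_(i' < i) \sum_(j' < j) m i' j'.
Proof.
elim: i j => [|i IHi] j iK jK.
  by rewrite big_ord0 big1.
elim: j jK => [|j IHj] jK.
  by rewrite [RHS]big1 ?big1 // => ? _; rewrite big_ord0.
have v a b : a <= K -> b <= K -> growth m a b K = 0.
  by move=> aK bK; apply: growth_vanish; lia.
have := @up_rule_sum (growth m i j) (growth m i j.+1) (growth m i.+1 j) (m i j) K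
  (proj2 (growth_interlaced m i j)) (proj1 (growth_interlaced m i j))
  (v _ _ (ltnW iK) jK) (v _ _ iK (ltnW jK)) (v _ _ (ltnW iK) (ltnW jK)).
rewrite -growthS (IHi j (ltnW iK) (ltnW jK)) (IHi j.+1 (ltnW iK) jK) (IHj (ltnW jK)).
rewrite !(big_ord_recr i) /= (big_ord_recr j) /=; lia.
Qed.

End GrowthDiagrams.

(** * Plane partitions as boundaries of growth diagrams *)

Section Bijection.
Local Open Scope nat_scope.

Lemma growth_tr m i j : growth (fun a b => m b a) i j = growth m j i.
Proof.
elim: i j => [|i IHi] j; first by apply/funext => k; rewrite growth0r.
elim: j => [|j IHj]; first by apply/funext => k; rewrite growth0r.
rewrite !growthS IHj !IHi; apply/funext => -[|k]; rewrite /up_rule.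
  by rewrite maxnC.
by rewrite maxnC minnC.
Qed.

(* The array whose diagonals are the partitions on the boundary of the growth diagram of m. *)
Definition slices n (m : nat -> nat -> nat) (i j : nat) : nat :=
  if i <= j then growth m (n - (j - i)) n i else growth m n (n - (i - j)) j.

Lemma slices_tr n m i j : slices n (fun a b => m b a) i j = slices n m j i.
Proof.
rewrite /slices; by case: ltngtP => [ij|ji|->]; rewrite (growth_tr m) ?subnn ?subn0.
Qed.

(** Consecutive diagonals are neighbours on the boundary of the diagram, hence interlaced; each half
    of the interlacing condition is the inequality on one side of the main diagonal. Far from it,
    the truncated index [n - (j - i)] is 0 and the entries vanish. *)
Lemma slices_col n m i j : slices n m i j.+1 <= slices n m i j.
Proof.
rewrite /slices; case: (leqP i j) => ij.
  rewrite leqW //; case: (leqP n (j - i)) => h.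
    by have -> : n - (j.+1 - i) = 0 by lia.
  have -> : n - (j - i) = (n - (j.+1 - i)).+1 by lia.
  by have /andP[] := proj1 (growth_interlaced m (n - (j.+1 - i)) n) i.
case: (ltngtP i j.+1) => [|ij'|eij]; first by lia.
  case: (leqP n (i - j.+1)) => h.
    have -> : n - (i - j.+1) = 0 by lia.
    by rewrite growth0r.
  have -> : n - (i - j.+1) = (n - (i - j)).+1 by lia.
  by have /andP[] := proj2 (growth_interlaced m n (n - (i - j))) j.
subst i; rewrite subnn subn0 subSnn; case: n => [//|n].
by rewrite subn1 /=; have /andP[] := proj2 (growth_interlaced m n.+1 n) j.
Qed.

Lemma slices_row n m i j : slices n m i.+1 j <= slices n m i j.
Proof. by rewrite -(slices_tr n m j i.+1) -(slices_tr n m j i) slices_col. Qed.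

Lemma slices_box n m i j : ~~ ((i < n) && (j < n)) -> slices n m i j = 0.
Proof.
by move=> h; rewrite /slices; case: leqP => ij; rewrite growth_vanish //; lia.
Qed.

Lemma fsbig_box n (P : nat -> nat -> bool) (g : nat -> nat -> nat) :
  (forall i j, ~~ ((i < n) && (j < n)) -> g i j = 0) ->
  \sum_(ij \in [set ij : nat * nat | P ij.1 ij.2]) g ij.1 ij.2 =
  \sum_(i < n) \sum_(j < n | P i j) g i j.
Proof.
move=> g0; pose r := [seq (i, j) | i <- iota 0 n, j <- iota 0 n].
rewrite -(bigfs _ (r := r) (P := fun ij => P ij.1 ij.2)).
- rewrite big_mkcond /r big_allpairs_dep /=.
  have io (G : nat -> nat) : \sum_(i <- iota 0 n) G i = \sum_(i < n) G i.
    by rewrite -(big_mkord xpredT) /index_iota subn0.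
  by rewrite io; apply: eq_bigr => i _; rewrite io -big_mkcond.
- by apply: allpairs_uniq; rewrite ?iota_uniq // => -[a b] [c d].
move=> [i j] /= _ h; apply: g0; apply: contra h => ij.
by apply/allpairsP; exists (i, j); rewrite !mem_iota /= !add0n; case/andP: ij.
Qed.

Lemma sum_triangle n (f : nat -> nat) :
  \sum_(1 <= d < n) \sum_(i < n - d) f i = \sum_(i < n) (n.-1 - i) * f i.
Proof.
elim: n => [|n IH]; first by rewrite big_geq // big_ord0.
rewrite big_ord_recr /= subnn mul0n addn0.
case: n IH => [|n] IH; first by rewrite big_geq // big_ord0.
rewrite big_nat_recl // subn1 /=.
rewrite (eq_bigr (fun d => \sum_(i < n.+1 - d) f i)) ?IH => [|d _]; last by [].
by rewrite -big_split /=; apply: eq_bigr => i _; rewrite -mulSn; congr (_ * _); have := ltn_ord i; lia.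
Qed.

Lemma growth_slice_sum n m a b : a <= n -> b <= n ->
  \sum_(k < n) growth m a b k = \sum_(i < a) \sum_(j < b) m i j.
Proof.
move=> an bn; rewrite -(@growth_sum m n) // [RHS]big_ord_recr /= (@growth_vanish m a b n) ?addn0 //.
lia.
Qed.

(** The d-th diagonal above the main one sums to the entries of [m] in its first n - d rows, so row
    i is counted once for each d between 1 and n - 1 - i. *)
Lemma w_plus_slices n m :
  w_plus (slices n m) = \sum_(i < n) \sum_(j < n) (n.-1 - i) * m i j.
Proof.
rewrite /w_plus (fsbig_box (fun i j => i < j) (@slices_box n m)).
under [RHS]eq_bigr do rewrite -big_distrr /=.
rewrite -(@sum_triangle n (fun i => \sum_(j < n) m i j)).
rewrite (eq_bigr (fun i : 'I_n => \sum_(1 <= d < n) growth m (n - d) n i)); last first.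
  move=> i _; have iN := ltn_ord i; rewrite -(big_mkord (fun j => i < j) (fun j => slices n m i j)).
  rewrite (@big_cat_nat _ _ _ i.+1) //=.
  rewrite big_nat_cond big1 ?add0n; last by move=> j; lia.
  rewrite -{1}(add0n i.+1) big_addn [RHS](@big_cat_nat _ _ _ (n - i)) /=; [|lia|lia].
  rewrite [X in _ = _ + X]big_nat_cond [X in _ = _ + X]big1 ?addn0; last first.
    by move=> d hd; rewrite growth_vanish //; lia.
  rewrite [RHS]big_add1 -subnS big_nat_cond [RHS]big_nat_cond.
  apply: eq_big => [j|j hj]; first by lia.
  rewrite /slices; have -> : i <= j + i.+1 by lia.
  by congr growth; lia.
rewrite exchange_big /= big_nat_cond [RHS]big_nat_cond; apply: eq_bigr => d hd.
by rewrite growth_slice_sum //; lia.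
Qed.

Lemma w_minus_tr p : (exists n, forall i j, ~~ ((i < n) && (j < n)) -> p i j = 0) ->
  w_minus p = w_plus (fun i j => p j i).
Proof.
move=> [n h]; rewrite /w_minus /w_plus (@fsbig_box n (fun i j => j < i) p) //.
rewrite (@fsbig_box n (fun i j => i < j) (fun i j => p j i)); last first.
  by move=> i j; rewrite andbC; apply: h.
by rewrite (exchange_big_dep xpredT).
Qed.

Lemma w_minus_slices n m :
  w_minus (slices n m) = \sum_(i < n) \sum_(j < n) (n.-1 - j) * m i j.
Proof.
rewrite w_minus_tr; last by exists n; apply: slices_box.
rewrite (_ : (fun i j => _) = slices n (fun a b => m b a)); last first.
  by apply/funext => i; apply/funext => j; rewrite slices_tr.
by rewrite w_plus_slices exchange_big.
Qed.

(** The main diagonal sums to all of [m], which adds 1 to the two weights from the sides. *)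
Lemma pp_size_slices n m :
  pp_size (slices n m) =
  \sum_(i < n) \sum_(j < n) ((n.-1 - i) + (n.-1 - j)).+1 * m i j.
Proof.
have box := @slices_box n m.
have -> : pp_size (slices n m) = w_plus (slices n m) + w_minus (slices n m) +
    \sum_(i < n) slices n m i i.
  rewrite /pp_size /w_plus /w_minus (@fsbig_box n (fun i j => i < j)) //.
  rewrite (@fsbig_box n (fun i j => j < i)) //.
  rewrite (_ : [set: nat * nat] = [set ij | (fun _ _ => true) ij.1 ij.2]%classic); last first.
    by apply/seteqP; split.
  rewrite (@fsbig_box n (fun i j => true)) // -!big_split /=; apply: eq_bigr => i _.
  rewrite (bigID (fun j : 'I_n => i < j)) /= -addnA; congr (_ + _).
  rewrite (bigID (fun j : 'I_n => j < i)) /=; congr (_ + _).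
    by apply: eq_bigl => j; lia.
  rewrite (big_pred1 i) // => j /=; rewrite -(inj_eq val_inj) /=; lia.
rewrite w_plus_slices w_minus_slices.
have -> : \sum_(i < n) slices n m i i = \sum_(i < n) \sum_(j < n) m i j.
  rewrite -(@growth_slice_sum n) //; apply: eq_bigr => i _.
  by rewrite /slices leqnn subnn subn0.
rewrite -!big_split /=; apply: eq_bigr => i _; rewrite -!big_split /=; apply: eq_bigr => j _.
lia.
Qed.

(** The inverse growth diagram, indexed from the opposite corner: its vertex (i, j) is the vertex (n
    - i, n - j) of the diagram of the array. Its two axes carry the diagonals of [p] on either side
    of the main one. *)
Definition unslices_growth (p : nat -> nat -> nat) : nat -> nat -> nat -> nat :=
  @fill _ (fun _ _ => down_rule) (fun j k => p (k + j) k) (fun i k => p k (k + i)).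

Definition unslices n p i j : nat :=
  unslices_growth p (n.-1 - i) (n.-1 - j) 0 -
  maxn (unslices_growth p (n.-1 - i) (n - j) 0) (unslices_growth p (n - i) (n.-1 - j) 0).

Lemma unslices_growth0 p i : unslices_growth p i 0 = fun k => p k (k + i).
Proof.
case: i => [|i]; last by [].
rewrite /unslices_growth /=; apply/funext => k; by rewrite !addn0.
Qed.

Section Inverse.
Variables (p : nat -> nat -> nat) (n : nat).
Hypotheses (prow : forall i j, p i.+1 j <= p i j) (pcol : forall i j, p i j.+1 <= p i j).
Hypothesis pbox : forall i j, ~~ ((i < n) && (j < n)) -> p i j = 0.
Let B := unslices_growth p.

Lemma unslices_interlaced i j :
  interlaced (B i.+1 j) (B i j) /\ interlaced (B i j.+1) (B i j).
Proof.
have c i' : interlaced (B i'.+1 0) (B i' 0).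
  move=> k; rewrite /B !unslices_growth0 /= ?addSn ?addnS; apply/andP; split.
    by rewrite prow.
  by rewrite pcol.
have r j' : interlaced (B 0 j'.+1) (B 0 j').
  move=> k; rewrite /B /unslices_growth /= ?addSn ?addnS; apply/andP; split.
    by rewrite pcol.
  by rewrite prow.
elim: i j => [|i IHi] j.
  split; last exact: r.
  elim: j => [|j IHj]; first exact: c.
  exact: (proj1 (down_rule_interlaced (r j) IHj)).
elim: j => [|j [IHj1 IHj2]].
  split; first exact: c.
  exact: (proj2 (down_rule_interlaced (proj2 (IHi 0)) (c i))).
have [IHi1 IHi2] := IHi j.+1.
have [_ b] := down_rule_interlaced IHi2 IHi1.
have [a _] := down_rule_interlaced IHj2 IHj1.
by split.
Qed.

Lemma unslices_growth_out i j k : (n <= i) || (n <= j) -> B i j k = 0.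
Proof.
have row i' k' : n <= i' -> B i' 0 k' = 0.
  by move=> h; rewrite /B unslices_growth0 pbox //; lia.
have col j' k' : n <= j' -> B 0 j' k' = 0.
  by move=> h; rewrite /B /unslices_growth /= pbox //; lia.
case/orP => h.
  elim: j k => [|j IH] k; first exact: row.
  by have /andP[_] := proj2 (unslices_interlaced i j) k; rewrite IH leqn0 => /eqP.
elim: i k => [|i IH] k; first exact: col.
by have /andP[_] := proj1 (unslices_interlaced i j) k; rewrite IH leqn0 => /eqP.
Qed.

(** On the axes both sides vanish, since [B] is zero at distance n; then each cell is settled by
    [down_ruleK]. *)
Lemma growth_unslices i j : i <= n -> j <= n ->
  growth (unslices n p) i j = B (n - i) (n - j).
Proof.
elim: i j => [|i IHi] j iN jN.
  by apply/funext => k; rewrite unslices_growth_out // subn0 leqnn.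
elim: j jN => [|j IHj] jN.
  by apply/funext => k; rewrite growth0r unslices_growth_out // subn0 leqnn orbT.
rewrite growthS (IHi j (ltnW iN) (ltnW jN)) (IHi j.+1 (ltnW iN) jN) (IHj (ltnW jN)).
rewrite /unslices -/B.
have -> : n - i = (n.-1 - i).+1 by lia.
have -> : n - j = (n.-1 - j).+1 by lia.
have -> : n - i.+1 = n.-1 - i by lia.
have -> : n - j.+1 = n.-1 - j by lia.
have [h1 _] := unslices_interlaced (n.-1 - i) (n.-1 - j).
have [_ h2] := unslices_interlaced (n.-1 - i) (n.-1 - j).
have Bdown : B (n.-1 - i).+1 (n.-1 - j).+1 =
  down_rule (B (n.-1 - i) (n.-1 - j)) (B (n.-1 - i).+1 (n.-1 - j))
   (B (n.-1 - i) (n.-1 - j).+1).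
  by apply/funext => k; rewrite /B /unslices_growth /= /down_rule maxnC minnC.
by rewrite Bdown maxnC; apply/funext => k; exact: down_ruleK.
Qed.

Lemma slices_unslices i j : slices n (unslices n p) i j = p i j.
Proof.
rewrite /slices; case: leqP => ij; rewrite growth_unslices ?leq_subr //.
  rewrite subnn; case: (leqP (j - i) n) => h.
    by rewrite subKn // /B unslices_growth0 subnKC.
  by rewrite (_ : n - (n - (j - i)) = n) ?unslices_growth_out ?leqnn ?pbox //; lia.
rewrite subnn; case: (leqP (i - j) n) => h.
  by rewrite subKn // /B /unslices_growth /= subnKC // ltnW.
by rewrite (_ : n - (n - (i - j)) = n) ?unslices_growth_out ?leqnn ?orbT ?pbox //; lia.
Qed.

End Inverse.

Lemma unslices_growth_slices n m i j : i <= n -> j <= n ->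
  unslices_growth (slices n m) i j = growth m (n - i) (n - j).
Proof.
elim: i j => [|i IHi] j iN jN.
  apply/funext => k; rewrite /unslices_growth /= /slices; case: leqP => h.
    have -> : j = 0 by lia.
    by rewrite !addn0 subnn !subn0.
  by rewrite addKn subn0.
elim: j jN => [|j IHj] jN.
  apply/funext => k; rewrite unslices_growth0 /slices leq_addr addKn.
  by rewrite subn0.
rewrite (_ : unslices_growth _ i.+1 j.+1 = down_rule (unslices_growth (slices n m) i j)
  (unslices_growth (slices n m) i j.+1) (unslices_growth (slices n m) i.+1 j)); last by [].
rewrite (IHi j (ltnW iN) (ltnW jN)) (IHi j.+1 (ltnW iN) jN) (IHj (ltnW jN)).
have -> : n - i = (n - i.+1).+1 by lia.
have -> : n - j = (n - j.+1).+1 by lia.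
have [_ h2] := growth_interlaced m (n - i.+1) (n - j.+1).
have [h1 _] := growth_interlaced m (n - i.+1) (n - j.+1).
rewrite growthS; apply/funext => k.
rewrite -[RHS](up_ruleK (m (n - i.+1) (n - j.+1)) h2 h1).
by rewrite /down_rule maxnC minnC.
Qed.

Lemma unslices_slices n m i j : i < n -> j < n -> unslices n (slices n m) i j = m i j.
Proof.
move=> iN jN; rewrite /unslices !unslices_growth_slices; try lia.
have -> : n - (n.-1 - i) = i.+1 by lia.
have -> : n - (n.-1 - j) = j.+1 by lia.
rewrite !subKn 1?ltnW // growthS /up_rule maxnC addKn //.
Qed.

End Bijection.

(** * Arrays of given weight and the bijection with plane partitions *)

Section Configurations.
Local Open Scope nat_scope.

Definition lev N (x : 'I_N * 'I_N) : nat := (x.1 + x.2).+1.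

(** The bound on the entries only makes the type finite: levels are positive, so an array of weight
    at most N has no entry above N. *)
Definition config N := {ffun 'I_N * 'I_N -> 'I_N.+1}.

Definition weight N (m : config N) : nat := \sum_x lev x * m x.

Definition configs N k : {set config N} := [set m | weight m == k].

Definition arr_config n (g : nat -> nat -> nat) : config n := 
  [ffun x : 'I_n * 'I_n => inord (g x.1 x.2)].

Lemma ext_ord n (f : config n) (i j : 'I_n) : ext f i j = f (i, j).
Proof. by rewrite /ext !valK. Qed.

Lemma ext_box n (f : config n) i j : ~~ ((i < n) && (j < n)) -> ext f i j = 0.
Proof.
rewrite negb_and /ext => /orP[] h; first by rewrite (@insubN _ _ _ i h).
by rewrite (@insubN _ _ _ j h); case: insub.
Qed.

Lemma arr_config_ext n (f : config n) : arr_config n (ext f) = f.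
Proof. by apply/ffunP => -[i j]; rewrite ffunE ext_ord; apply: val_inj; rewrite /= inordK. Qed.

Lemma ext_arr_config n g : (forall i j, g i j <= n) ->
  (forall i j, ~~ ((i < n) && (j < n)) -> g i j = 0) -> ext (arr_config n g) = g.
Proof.
move=> gn g0; apply/funext => i; apply/funext => j.
case: (boolP ((i < n) && (j < n))) => [/andP[iN jN]|h].
  by rewrite (ext_ord _ (Ordinal iN) (Ordinal jN)) ffunE /= inordK // ltnS.
by rewrite ext_box // g0.
Qed.

Lemma leq_sum_term (I : finType) (F : I -> nat) i : F i <= \sum_j F j.
Proof. by rewrite (bigD1 i) //= leq_addr. Qed.

(** Slicing gives cell (i, j) the weights n - 1 - i and n - 1 - j; reversing both indices turns them
    into i and j. *)
Definition rev_arr n (g : nat -> nat -> nat) i j := g (n.-1 - i) (n.-1 - j).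

Lemma sum_rev_arr n (m : config n) (c : nat -> nat -> nat) :
  \sum_(i < n) \sum_(j < n) c (n.-1 - i) (n.-1 - j) * rev_arr n (ext m) i j =
  \sum_(x : 'I_n * 'I_n) c x.1 x.2 * m x.
Proof.
rewrite pair_big /= (reindex (fun x : 'I_n * 'I_n => (rev_ord x.1, rev_ord x.2))) /=; last first.
  by exists (fun x : 'I_n * 'I_n => (rev_ord x.1, rev_ord x.2)) => -[a b] _ /=; rewrite !rev_ordK.
apply: eq_bigr => -[i j] _ /=; rewrite /rev_arr.
have e (k : 'I_n) : n.-1 - (n - k.+1) = k by have := ltn_ord k; lia.
by rewrite !e ext_ord.
Qed.

Lemma entry_le_pp_size n p i j : (forall i j, ~~ ((i < n) && (j < n)) -> p i j = 0) ->
  p i j <= pp_size p.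
Proof.
move=> p0; case: (boolP ((i < n) && (j < n))) => [/andP[iN jN]|/p0 -> //].
rewrite /pp_size (_ : [set: nat * nat] = [set ij | (fun _ _ => true) ij.1 ij.2]%classic); last first.
  by apply/seteqP; split.
rewrite (@fsbig_box n (fun i j => true)) //.
apply: leq_trans (leq_sum_term _ (Ordinal iN)).
exact: (leq_sum_term (fun j : 'I_n => p i j) (Ordinal jN)).
Qed.

Definition pp_of_config n (m : config n) : config n :=
  arr_config n (slices n (rev_arr n (ext m))).

Definition config_of_pp n (f : config n) : config n :=
  arr_config n (rev_arr n (unslices n (ext f))).

Lemma ext_pp_of_config n (m : config n) : weight m = n ->
  ext (pp_of_config m) = slices n (rev_arr n (ext m)).
Proof.
move=> mn; have box := @slices_box n (rev_arr n (ext m)).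
apply: ext_arr_config => // i j.
by rewrite (leq_trans (entry_le_pp_size i j box)) // pp_size_slices
  (sum_rev_arr m (fun i j => (i + j).+1)) -[X in _ <= X]mn.
Qed.

Lemma pp_of_configP n (m : config n) : weight m = n ->
  [/\ pp_of_config m \in PP n,
      w_plus (ext (pp_of_config m)) = \sum_(x : 'I_n * 'I_n) x.1 * m x &
      w_minus (ext (pp_of_config m)) = \sum_(x : 'I_n * 'I_n) x.2 * m x].
Proof.
move=> mn; have e := ext_pp_of_config mn; split.
- rewrite inE; apply/asboolP; rewrite e; split.
    split=> [i j|i j|]; [exact: slices_row|exact: slices_col|].
    apply: (@sub_finite_set _ _ (`I_n `*` `I_n)%classic).
      move=> -[i j] /= h; case: (boolP ((i < n) && (j < n))) => [/andP[]//|h'].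
      by rewrite slices_box // in h.
    exact: finite_setX.
  by rewrite pp_size_slices (sum_rev_arr m (fun i j => (i + j).+1)).
- by rewrite e w_plus_slices (sum_rev_arr m (fun i j => i)).
- by rewrite e w_minus_slices (sum_rev_arr m (fun i j => j)).
Qed.

Lemma pp_of_config_inj n : {in configs n n &, injective (@pp_of_config n)}.
Proof.
move=> m m'; rewrite !inE => /eqP mn /eqP mn' /(congr1 (@ext n)).
rewrite !ext_pp_of_config // => e.
apply/ffunP => -[i j]; apply: val_inj => /=.
have := congr1 (fun p => unslices n p (n.-1 - i) (n.-1 - j)) e.
have [iN jN] := (ltn_ord i, ltn_ord j).
rewrite !unslices_slices; [|lia..].
rewrite /rev_arr !subKn; [|lia..].
by rewrite !ext_ord.
Qed.

Lemma config_of_ppP n (f : config n) : f \in PP n ->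
  config_of_pp f \in configs n n /\ pp_of_config (config_of_pp f) = f.
Proof.
rewrite inE => /asboolP[[prow pcol _] psize].
have box := @ext_box n f.
have sl : slices n (unslices n (ext f)) = ext f.
  by apply/funext => i; apply/funext => j; exact: slices_unslices.
(* Each entry is at most the weighted sum of all entries, which is the size [n]; hence [inord] loses
   nothing in [config_of_pp]. *)
have le i j : i < n -> j < n -> unslices n (ext f) i j <= n.
  move=> iN jN; have := psize; rewrite -{1}sl pp_size_slices => sz.
  rewrite -[X in _ <= X]sz.
  apply: leq_trans (leq_sum_term (fun i : 'I_n => \sum_(j < n)
    ((n.-1 - i) + (n.-1 - j)).+1 * unslices n (ext f) i j) (Ordinal iN)).
  apply: leq_trans (leq_sum_term (fun j : 'I_n =>
    ((n.-1 - i) + (n.-1 - j)).+1 * unslices n (ext f) i j) (Ordinal jN)).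
  exact: leq_pmull.
have ev i j : i < n -> j < n -> rev_arr n (ext (config_of_pp f)) i j = unslices n (ext f) i j.
  move=> iN jN; rewrite /rev_arr.
  have iN' : n.-1 - i < n by lia.
  have jN' : n.-1 - j < n by lia.
  rewrite (ext_ord _ (Ordinal iN') (Ordinal jN')) ffunE /= inordK.
    by rewrite /rev_arr !subKn //; lia.
  by rewrite ltnS le //; lia.
have slE : slices n (rev_arr n (ext (config_of_pp f))) = ext f.
  apply/funext => i; apply/funext => j; rewrite -[in RHS]sl /slices.
  have gE a b : a <= n -> b <= n -> growth (rev_arr n (ext (config_of_pp f))) a b =
      growth (unslices n (ext f)) a b.
    elim: a b => [//|a IHa] b aN bN.
    elim: b bN => [|b IHb] bN; first by apply/funext => k; rewrite !growth0r.
    by rewrite !growthS (IHa b (ltnW aN) (ltnW bN)) (IHa b.+1 (ltnW aN) bN) (IHb (ltnW bN)) ev.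
  by rewrite !gE // leq_subr.
have wt : weight (config_of_pp f) = n.
  rewrite /weight -(sum_rev_arr _ (fun i j => (i + j).+1)) -[RHS]psize -sl pp_size_slices.
  by apply: eq_bigr => i _; apply: eq_bigr => j _; rewrite ev.
split; first by rewrite inE wt.
by rewrite /pp_of_config slE arr_config_ext.
Qed.

(** The bijection transports the joint law of w_+ and w_-, hence also the law of their
    difference. *)
Lemma card_PP_configs n (Q : nat -> nat -> bool) :
  #|[set f in PP n | Q (w_plus (ext f)) (w_minus (ext f))]| =
  #|[set m in configs n n | Q (\sum_(x : 'I_n * 'I_n) x.1 * m x) (\sum_(x : 'I_n * 'I_n) x.2 * m x)]|.
Proof.
have inj : {in [set m in configs n n | Q (\sum_(x : 'I_n * 'I_n) x.1 * m x) (\sum_(x : 'I_n * 'I_n) x.2 * m x)] &,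
    injective (@pp_of_config n)}.
  move=> m m'; rewrite !finset.in_set => /andP[h _] /andP[h' _].
  by apply: pp_of_config_inj; rewrite inE.
rewrite -(card_in_imset inj); congr #|pred_of_set _|.
apply/setP => f; rewrite finset.in_set; apply/andP/imsetP => [[fP Qf]|[m]].
  have [gP ge] := config_of_ppP fP; exists (config_of_pp f) => //.
  have := gP; rewrite !finset.in_set => /eqP wt; rewrite wt eqxx /=.
  by have [_ <- <-] := pp_of_configP wt; rewrite ge.
rewrite !finset.in_set => /andP[/eqP wt Qm] ->.
have [h -> ->] := pp_of_configP wt; split=> //; by rewrite finset.in_set in h.
Qed.

End Configurations.

(** * Counting configurations *)

Section Shifts.
Variable R : realType.
Variable N : nat.
Implicit Types (m : config N) (x y : 'I_N * 'I_N) (F G : config N -> R).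

Definition upd m x (v : 'I_N.+1) : config N := [ffun y => if y == x then v else m y].

Lemma upd_same m x v : upd m x v x = v.
Proof. by rewrite ffunE eqxx. Qed.

Lemma upd_other m x v y : y != x -> upd m x v y = m y.
Proof. by rewrite ffunE => /negbTE ->. Qed.

Lemma upd_upd m x v w : upd (upd m x v) x w = upd m x w.
Proof. by apply/ffunP => y; rewrite !ffunE; case: eqP. Qed.

Lemma upd_id m x : upd m x (m x) = m.
Proof. by apply/ffunP => y; rewrite !ffunE; case: eqP => [->|]. Qed.

Lemma weight_upd m x v : (weight (upd m x v) + lev x * m x = weight m + lev x * v)%N.
Proof.
rewrite /weight (bigD1 x) //= (bigD1 x (P := xpredT) (F := fun y => (lev y * m y)%N)) //=.
rewrite upd_same (eq_bigr (fun y => (lev y * m y)%N)); last first.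
  by move=> y yx; rewrite upd_other.
lia.
Qed.

Lemma weight_ge m x : (lev x * m x <= weight m)%N.
Proof. by rewrite /weight (bigD1 x) //= leq_addr. Qed.

Definition add_at x k m := upd m x (inord (m x + k)).
Definition sub_at x k m := upd m x (inord (m x - k)).

(** Removing [k] from the entry at [x] is a bijection onto the arrays lighter by [k * lev x]. The
    inverse never overflows, because the weights stay below N. *)
Lemma sum_shift n j k x F : (n <= N)%N ->
  \sum_(m | (weight m + j == n)%N && (k <= m x)%N) F m =
  \sum_(m | (weight m + (j + k * lev x)%N == n)%N) F (add_at x k m).
Proof.
move=> nN; rewrite (reindex_onto (add_at x k) (sub_at x k)) /=; last first.
  move=> m /andP[_ kx]; rewrite /add_at /sub_at upd_upd upd_same.
  have mN := ltn_ord (m x).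
  by rewrite inordK ?subnK ?inord_val ?upd_id //; lia.
apply: eq_bigl => m.
have [mk|mk] := leqP (m x + k) N.
  have -> : sub_at x k (add_at x k m) == m.
    rewrite /add_at /sub_at upd_upd upd_same inordK ?ltnS // addnK inord_val upd_id.
    exact: eqxx.
  rewrite andbT.
  have := weight_upd m x (inord (m x + k)).
  rewrite /add_at upd_same inordK ?ltnS // => w.
  rewrite leq_addl andbT; apply/eqP/eqP; nia.
(* Here m x + k exceeds N: [inord] falls back to 0, and the conditions on both sides are false. *)
apply/idP/idP => [/andP[/andP[_]]|/eqP h].
  rewrite /add_at upd_same.
  have -> : (inord (m x + k) : 'I_N.+1) = ord0.
    by rewrite /inord /insubd insubN // -leqNgt.
  rewrite /= leqn0 => /eqP k0; subst k; have := ltn_ord (m x); lia.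
have := weight_ge m x; have : (0 < lev x)%N by [].
nia.
Qed.

(** The missing weight [j] is kept as an argument instead of using n - j, so that the sum is empty,
    not truncated, when j > n. *)
Definition csum n j F := \sum_(m | (weight m + j == n)%N) F m.

Definition count n j : R := csum n j (fun => 1).

Lemma csum_ge n j k x F : (n <= N)%N ->
  csum n j (fun m => (k <= m x)%N%:R * F m) = csum n (j + k * lev x)%N (F \o add_at x k).
Proof.
move=> nN; rewrite /csum /= -(@sum_shift n j k x F nN) [RHS]big_mkcondr /=.
by apply: eq_bigr => m _; case: leqP; rewrite ?mul1r ?mul0r.
Qed.

Lemma csum_out n j F : (n < j)%N -> csum n j F = 0.
Proof. by move=> nj; rewrite /csum big_pred0 // => m; apply/negP => /eqP; lia. Qed.

Lemma csumE n j F : (j <= n)%N -> csum n j F = csum (n - j)%N 0 F.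
Proof. by move=> jn; apply: eq_bigl => m; apply/eqP/eqP; lia. Qed.

Lemma csum_sum n j (I : Type) (s : seq I) (Q : pred I) (F : I -> config N -> R) :
  csum n j (fun m => \sum_(i <- s | Q i) F i m) = \sum_(i <- s | Q i) csum n j (F i).
Proof. by rewrite /csum exchange_big. Qed.

Lemma csumZ n j c F : csum n j (fun m => c * F m) = c * csum n j F.
Proof. by rewrite /csum big_distrr. Qed.

Lemma csumD n j F G : csum n j (fun m => F m + G m) = csum n j F + csum n j G.
Proof. by rewrite /csum big_split. Qed.

Lemma eq_csum n j F G : (forall m, (weight m + j)%N = n -> F m = G m) ->
  csum n j F = csum n j G.
Proof. by move=> h; apply: eq_bigr => m /eqP; exact: h. Qed.

Lemma le_csum n j F G : (forall m, (weight m + j)%N = n -> F m <= G m) ->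
  csum n j F <= csum n j G.
Proof. by move=> h; apply: ler_sum => m /eqP; exact: h. Qed.

Lemma sum_tail_indic (phi : nat -> R) (v : nat) : phi 0%N = 0 -> (v <= N)%N ->
  phi v = \sum_(1 <= k < N.+1) (phi k - phi k.-1) * (k <= v)%N%:R.
Proof.
move=> phi0 vN; rewrite (@big_cat_nat _ _ _ v.+1) //=.
rewrite [X in _ = _ + X]big_nat_cond [X in _ = _ + X]big1 ?addr0; last first.
  by move=> k /andP[/andP[h _] _]; rewrite leqNgt h mulr0.
rewrite big_nat_cond (eq_bigr (fun k => phi k - phi k.-1)) -?big_nat_cond; last first.
  by move=> k /andP[/andP[_ h] _]; rewrite -ltnS h mulr1.
by rewrite big_add1 /= telescope_sumr // phi0 subr0.
Qed.

Lemma csum_cell n j x (phi : nat -> R) : (n <= N)%N -> phi 0%N = 0 ->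
  csum n j (fun m => phi (m x)) =
  \sum_(1 <= k < N.+1) (phi k - phi k.-1) * count n (j + k * lev x)%N.
Proof.
move=> nN phi0.
transitivity (csum n j (fun m => \sum_(1 <= k < N.+1) (phi k - phi k.-1) * (k <= m x)%N%:R)).
  by apply: eq_csum => m _; apply: sum_tail_indic => //; have := ltn_ord (m x); rewrite ltnS.
rewrite csum_sum; apply: eq_bigr => k _; rewrite csumZ; congr (_ * _).
transitivity (csum n j (fun m => (k <= m x)%N%:R * 1)).
  by apply: eq_csum => m _; rewrite mulr1.
by rewrite (@csum_ge n j k x (fun => 1)).
Qed.

(** Sum the identity n = sum of [lev x * m x] over all arrays of weight n, and read [m x] as the
    number of k >= 1 with k <= m x. *)
Lemma count_rec n : (n <= N)%N ->
  n%:R * count n 0 = \sum_(x : 'I_N * 'I_N) \sum_(1 <= k < N.+1) (lev x)%:R * count n (k * lev x)%N.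
Proof.
move=> nN; rewrite -csumZ.
transitivity (csum n 0 (fun m => \sum_(x : 'I_N * 'I_N) (lev x)%:R * (m x)%:R)).
  apply: eq_csum => m; rewrite addn0 => <-; rewrite mulr1 /weight natr_sum.
  by apply: eq_bigr => x _; rewrite natrM.
rewrite csum_sum; apply: eq_bigr => x _.
rewrite csumZ (@csum_cell n 0 x (fun v => v%:R)) // big_distrr /=.
rewrite big_nat_cond [RHS]big_nat_cond; apply: eq_bigr => k /andP[/andP[k0 _] _].
by rewrite add0n -natrB ?leq_pred // (_ : (k - k.-1 = 1)%N) ?mul1r //; lia.
Qed.

(** The corner cell has level 1, so the left side counts the arrays with a positive corner entry. *)
Lemma count_nondecr n j : (0 < n <= N)%N -> count n j.+1 <= count n j.
Proof.
move=> /andP[n0 nN]; have N0 : (0 < N)%N by lia.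
pose x : 'I_N * 'I_N := (Ordinal N0, Ordinal N0).
have := @csum_ge n j 1 x (fun => 1) nN; rewrite /= mul1n (_ : lev x = 1%N) // addn1.
rewrite /count => <-; apply: le_csum => m _; rewrite mulr1.
by case: (_ <= _)%N; rewrite ?ler01.
Qed.

Lemma count_ge0 n j : 0 <= count n j.
Proof. by apply: sumr_ge0 => m _; apply: ler01. Qed.

(** Expanding the factor of one cell gives the same sum plus z times a copy with [lev x] more
    missing weight. An exponential bound only picks up a constant under such a shift, so it is
    reproduced by the induction. *)
Lemma tilted_count n (B t z : R) (S : seq ('I_N * 'I_N)) j : (n <= N)%N -> 0 <= z ->
  (forall j, count n j <= B * expR (- (j%:R * t))) -> uniq S ->
  csum n j (fun m => \prod_(x <- S) (1 + z * (0 < m x)%N%:R)) <=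
  B * expR (- (j%:R * t)) * \prod_(x <- S) (1 + z * expR (- ((lev x)%:R * t))).
Proof.
move=> nN z0 hB; elim: S j => [|x S IH] j.
  rewrite big_nil mulr1 => _; apply: le_trans (hB j).
  by apply: le_csum => m _; rewrite big_nil.
move=> /= /andP[xS uS].
pose F m : R := \prod_(y <- S) (1 + z * (0 < m y)%N%:R).
have -> : csum n j (fun m => \prod_(y <- x :: S) (1 + z * (0 < m y)%N%:R)) =
   csum n j F + z * csum n (j + lev x)%N F.
  transitivity (csum n j (fun m => F m + z * ((1 <= m x)%N%:R * F m))).
    by apply: eq_csum => m _; rewrite big_cons mulrDl mul1r mulrA.
  rewrite csumD csumZ csum_ge // mul1n; congr (_ + _ * _).
  apply: eq_csum => m _; rewrite /F /= big_seq [RHS]big_seq; apply: eq_bigr => y yS.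
  by rewrite /add_at upd_other //; apply: contraNneq xS => <-.
rewrite big_cons mulrA.
have E0 k : 0 <= B * expR (- (k%:R * t)) * \prod_(x <- S) (1 + z * expR (- ((lev x)%:R * t))).
  apply: mulr_ge0; first by apply: le_trans (hB k); exact: count_ge0.
  by apply: prodr_ge0 => y _; rewrite addr_ge0 // mulr_ge0 // expR_ge0.
have h1 := IH j uS; have h2 := IH (j + lev x)%N uS.
apply: (le_trans (lerD h1 (ler_wpM2l z0 h2))).
rewrite natrD mulrDl opprD expRD le_eqVlt; apply/orP; left; apply/eqP.
ring.
Qed.

(** * Exchanging two cells of the same level *)

Section Pair.
Variables (x y : 'I_N * 'I_N).
Hypotheses (xy : x != y) (levxy : lev x = lev y).

Definition swap m : config N := upd (upd m x (m y)) y (m x).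

Lemma swapx m : swap m x = m y.
Proof. by rewrite /swap upd_other // upd_same. Qed.

Lemma swapy m : swap m y = m x.
Proof. by rewrite /swap upd_same. Qed.

Lemma swap_other m z : z != x -> z != y -> swap m z = m z.
Proof. by move=> zx zy; rewrite /swap !upd_other. Qed.

Lemma swapK : involutive swap.
Proof.
move=> m; apply/ffunP => z; case: (eqVneq z x) => [->|zx]; first by rewrite swapx swapy.
case: (eqVneq z y) => [->|zy]; first by rewrite swapy swapx.
by rewrite !swap_other.
Qed.

Lemma weight_swap m : weight (swap m) = weight m.
Proof.
have yx : y != x by rewrite eq_sym.
have := weight_upd (upd m x (m y)) y (m x); have := weight_upd m x (m y).
rewrite -/(swap m) upd_other // levxy; lia.
Qed.

Lemma csum_swap n j F : csum n j F = csum n j (F \o swap).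
Proof.
rewrite /csum (reindex_inj (inv_inj swapK)) /=.
by apply: eq_bigl => m; rewrite weight_swap.
Qed.

Variable G : config N -> R.
Hypothesis Gx : forall m v, G (upd m x v) = G m.
Hypothesis Gy : forall m v, G (upd m y v) = G m.

Let P0 n j := csum n j (fun m => (m y <= m x)%N%:R * G m).

Lemma csum_diff_ge n j k : (n <= N)%N ->
  csum n j (fun m => (m y + k <= m x)%N%:R * G m) = P0 n (j + k * lev x)%N.
Proof.
move=> nN; transitivity (csum n j (fun m => (k <= m x)%N%:R * ((m y + k <= m x)%N%:R * G m))).
  apply: eq_csum => m _; rewrite mulrA -natrM mulnb; congr ((nat_of_bool _)%:R * _).
  by apply/idP/andP => [h|[]//]; split => //; apply: leq_trans h; rewrite leq_addl.
rewrite csum_ge // /P0; apply: eq_csum => m w /=; rewrite /add_at Gx upd_same upd_other 1?eq_sym //.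
congr ((nat_of_bool _)%:R * _).
have h : (m x + k <= N)%N by have := weight_ge m x; have : (0 < lev x)%N by []; nia.
by rewrite inordK ?ltnS // leq_add2r.
Qed.

(** The exchange turns m x < m y into m y + 1 <= m x, which is the half sum [P0] shifted by one
    level. *)
Lemma csum_split n j : (n <= N)%N -> csum n j G = P0 n j + P0 n (j + lev x)%N.
Proof.
move=> nN; transitivity (csum n j (fun m => (m y <= m x)%N%:R * G m) +
    csum n j (fun m => (m x < m y)%N%:R * G m)).
  by rewrite -csumD; apply: eq_csum => m _; case: leqP; rewrite ?mul1r ?mul0r ?add0r ?addr0.
congr (_ + _); rewrite csum_swap -(mul1n (lev x)) -csum_diff_ge //.
apply: eq_csum => m _ /=; rewrite swapx swapy addn1; congr (_ * _).
by rewrite /swap Gy Gx.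
Qed.

Lemma sum_abel_pair (f : nat -> R) : f N.+1 = 0 ->
  \sum_(1 <= k < N.+1) k%:R * (f k + f k.+1) = \sum_(1 <= k < N.+1) (k%:R ^+ 2 - k.-1%:R ^+ 2) * f k.
Proof.
move=> fN; have key K : \sum_(1 <= k < K.+1) k%:R * (f k + f k.+1) =
   \sum_(1 <= k < K.+1) (k%:R ^+ 2 - k.-1%:R ^+ 2) * f k + K%:R * f K.+1.
  elim: K => [|K IH]; first by rewrite !big_geq // mul0r addr0.
  rewrite big_nat_recr //= IH [in RHS]big_nat_recr //= -natr1; ring.
by rewrite key fN mulr0 addr0.
Qed.

(** The analogue of the variance 2 q / (1 - q)^2 = sum 2 k q^k of the difference of two independent
    geometric variables, with q^k replaced by k [lev x] more missing weight. As [G] ignores both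
    cells, it may itself be the squared difference of another pair, which gives mixed moments. *)
Lemma csum_sqdiff n j : (n <= N)%N ->
  csum n j (fun m => ((m x)%:R - (m y)%:R) ^+ 2 * G m) =
  \sum_(1 <= k < N.+1) 2 * k%:R * csum n (j + k * lev x)%N G.
Proof.
move=> nN.
have half : csum n j (fun m => (m y <= m x)%N%:R * (((m x)%:R - (m y)%:R) ^+ 2 * G m)) =
   \sum_(1 <= k < N.+1) k%:R * csum n (j + k * lev x)%N G.
  rewrite (eq_bigr (fun k => k%:R * (P0 n (j + k * lev x)%N + P0 n (j + k.+1 * lev x)%N))).
    rewrite (@sum_abel_pair (fun k => P0 n (j + k * lev x)%N)); last first.
      by apply: csum_out; have : (0 < lev x)%N by []; nia.
    transitivity (csum n j (fun m => \sum_(1 <= k < N.+1) (k%:R ^+ 2 - k.-1%:R ^+ 2) *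
        ((m y + k <= m x)%N%:R * G m))).
      apply: eq_csum => m _; case: leqP => h.
        rewrite mul1r -natrB // (@sum_tail_indic (fun k => k%:R ^+ 2)) ?expr0n //; last first.
          by have := ltn_ord (m x); lia.
        rewrite big_distrl /=; apply: eq_bigr => k _; rewrite -mulrA.
        by congr (_ * ((nat_of_bool _)%:R * _)); lia.
      rewrite mul0r big_nat_cond big1 // => k hk.
      by rewrite (_ : (_ <= _)%N = false) ?mul0r ?mulr0 //; lia.
    by rewrite csum_sum; apply: eq_bigr => k _; rewrite csumZ csum_diff_ge.
  by move=> k _; rewrite csum_split // mulSnr addnA.
transitivity (csum n j (fun m => (m y <= m x)%N%:R * (((m x)%:R - (m y)%:R) ^+ 2 * G m)) +
    csum n j (fun m => (m x <= m y)%N%:R * (((m x)%:R - (m y)%:R) ^+ 2 * G m))).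
  rewrite -csumD; apply: eq_csum => m _.
  by case: (ltngtP (m x) (m y)) => [||->]; rewrite ?mul1r ?mul0r ?add0r ?addr0 // subrr expr0n /= !mul0r addr0.
rewrite [X in _ + X]csum_swap.
have -> : csum n j ((fun m => (m x <= m y)%N%:R * (((m x)%:R - (m y)%:R) ^+ 2 * G m)) \o swap) =
   csum n j (fun m => (m y <= m x)%N%:R * (((m x)%:R - (m y)%:R) ^+ 2 * G m)).
  apply: eq_csum => m _ /=; rewrite swapx swapy /swap Gy Gx; ring.
rewrite half -big_split /=; apply: eq_bigr => k _; ring.
Qed.

End Pair.
End Shifts.

(** * Sums over levels, the recursion and the ratios *)

Section Counting.
Variable R : realType.
Implicit Types (f : nat -> R).

(** Level a consists of a cells as long as the antidiagonal fits in the box; the vanishing of [f]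
    beyond N removes the antidiagonals cut by the border. *)
Lemma sum_lev N f : (forall a, (N < a)%N -> f a = 0) ->
  \sum_(x : 'I_N * 'I_N) f (lev x) = \sum_(1 <= a < N.+1) a%:R * f a.
Proof.
move=> f0.
rewrite -(pair_big xpredT xpredT (fun i j : 'I_N => f (i + j).+1)) /=.
have col (i : 'I_N) : \sum_(j < N) f (i + j).+1 =
    \sum_(1 <= a < N.+1) (i < a)%N%:R * f a.
  rewrite (@big_cat_nat _ _ _ i.+1) //=; last by rewrite ltnS ltnW.
  rewrite [X in _ = X + _]big_nat_cond [X in _ = X + _]big1 ?add0r; last first.
    by move=> a ha; rewrite (_ : (_ < _)%N = false) ?mul0r //; lia.
  rewrite -{1}(add0n i.+1) big_addn subSS -(big_mkord xpredT (fun j => f (i + j).+1)).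
  have iN := ltn_ord i.
  rewrite (@big_cat_nat _ _ _ (N - i)) ?leq_subr //= [X in _ + X = _]big_nat_cond
    [X in _ + X = _]big1 ?addr0; last by move=> j hj; apply: f0; lia.
  by apply: eq_bigr => j _; rewrite addnS addnC ltnS leq_addl mul1r.
rewrite (eq_bigr _ (fun i _ => col i)) exchange_big /= big_nat_cond [RHS]big_nat_cond.
apply: eq_bigr => a ha; rewrite -big_distrl /=; congr (_ * _).
rewrite -natr_sum; congr (_%:R).
rewrite -(big_mkord xpredT (fun i => nat_of_bool (i < a)%N)).
rewrite (@big_cat_nat _ _ _ a) //=; last by lia.
rewrite [X in (_ + X)%N]big_nat_cond [X in (_ + X)%N]big1 ?addn0; last by move=> i hi; lia.
rewrite big_nat_cond (eq_bigr (fun _ => 1%N)); last by move=> i; lia.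
by rewrite -big_nat_cond sum_nat_const_nat muln1 subn0.
Qed.

Definition pcount n : R := count R n n 0.

Definition pcountz n j : R := if (j <= n)%N then pcount (n - j)%N else 0.

Lemma count00 N : count R N 0 0 = 1.
Proof.
rewrite /count /csum (big_pred1 [ffun => ord0]) // => m; rewrite addn0.
apply/eqP/eqP => [w|->]; last first.
  by rewrite /weight big1 // => x _; rewrite ffunE muln0.
apply/ffunP => x; rewrite ffunE; apply: val_inj => /=.
by have := weight_ge m x; rewrite w leqn0 muln_eq0 => /orP[|/eqP].
Qed.

Lemma double_sum_widen n B f : (n <= B)%N ->
  (forall j, (n < j)%N -> f j = 0) ->
  \sum_(1 <= a < B.+1) \sum_(1 <= k < B.+1) a%:R ^+ 2 * f (k * a)%N =
  \sum_(1 <= a < n.+1) \sum_(1 <= k < n.+1) a%:R ^+ 2 * f (k * a)%N.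
Proof.
move=> nB f0; rewrite (@big_cat_nat _ _ _ n.+1) //=.
rewrite [X in _ + X = _]big_nat_cond [X in _ + X = _]big1 ?addr0; last first.
  move=> a ha; rewrite big_nat_cond big1 // => k hk; rewrite f0 ?mulr0 //; nia.
rewrite big_nat_cond [RHS]big_nat_cond; apply: eq_bigr => a ha.
rewrite (@big_cat_nat _ _ _ n.+1) //=.
rewrite [X in _ + X = _]big_nat_cond [X in _ + X = _]big1 ?addr0 //.
by move=> k hk; rewrite f0 ?mulr0 //; nia.
Qed.

Lemma count_rec_lev N n : (n <= N)%N ->
  n%:R * count R N n 0 =
  \sum_(1 <= a < n.+1) \sum_(1 <= k < n.+1) a%:R ^+ 2 * count R N n (k * a)%N.
Proof.
move=> nN; rewrite count_rec //.
have out j : (n < j)%N -> count R N n j = 0 by move=> h; apply: csum_out.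
rewrite (sum_lev (f := fun a => \sum_(1 <= k < N.+1) a%:R * count R N n (k * a)%N)).
  rewrite -(double_sum_widen nN out); apply: eq_bigr => a _.
  by rewrite big_distrr; apply: eq_bigr => k _ /=; rewrite mulrA.
by move=> a Na; rewrite big_nat_cond big1 // => k hk; rewrite out ?mulr0 //; nia.
Qed.

(** The count is independent of the box because both sides obey the same recursion; arrays in
    different boxes are never compared. *)
Lemma count_pcount N n : (n <= N)%N -> count R N n 0 = pcount n.
Proof.
elim/ltn_ind: n N => n IH N nN; have [->|n0] := posnP n; first by rewrite /pcount !count00.
have nR : n%:R != 0 :> R by rewrite pnatr_eq0 -lt0n.
apply: (mulfI nR); rewrite /pcount !count_rec_lev // big_nat_cond [RHS]big_nat_cond.
apply: eq_bigr => a ha; rewrite big_nat_cond [RHS]big_nat_cond; apply: eq_bigr => k hk.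
congr (_ * _); have [h|h] := leqP (k * a)%N n; last by rewrite /count !csum_out.
rewrite /count (@csumE R N n (k * a)%N) // (@csumE R n n (k * a)%N) //.
transitivity (pcount (n - k * a)%N); first by apply: IH; nia.
by symmetry; apply: IH; nia.
Qed.

Lemma countE N n j : (n <= N)%N -> count R N n j = pcountz n j.
Proof.
move=> nN; rewrite /pcountz; case: leqP => h; last exact: csum_out.
rewrite /count csumE // -/(count R N (n - j)%N 0) count_pcount //.
by rewrite (leq_trans (leq_subr _ _)).
Qed.

Lemma pcount_rec n B : (n <= B)%N -> n%:R * pcount n =
  \sum_(1 <= a < B.+1) \sum_(1 <= k < B.+1) a%:R ^+ 2 * pcountz n (k * a)%N.
Proof.
move=> nB; rewrite (@double_sum_widen n B (pcountz n)) //; last first.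
  by move=> j h; rewrite /pcountz leqNgt h.
rewrite {1}/pcount count_rec_lev //; apply: eq_bigr => a _; apply: eq_bigr => k _.
by rewrite countE.
Qed.

Lemma pcount0 : pcount 0 = 1. Proof. exact: count00. Qed.

Lemma pcount_homo : {homo pcount : n m / (n <= m)%N >-> n <= m}.
Proof.
apply: homo_leq => [//|x y z|n]; first exact: le_trans.
have := @count_nondecr R n.+1 n.+1 0; rewrite !countE // /pcountz /= subn0 subn1 /=.
by apply; rewrite ltnSn.
Qed.

Lemma pcount_ge1 n : 1 <= pcount n.
Proof. by rewrite -pcount0; apply: pcount_homo. Qed.

Lemma pcount_gt0 n : 0 < pcount n.
Proof. exact: lt_le_trans (pcount_ge1 n). Qed.

Lemma pcountz_ge0 n j : 0 <= pcountz n j.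
Proof. by rewrite /pcountz; case: ifP => // _; apply/ltW/pcount_gt0. Qed.

Lemma pcountz_noninc n i j : (i <= j)%N -> pcountz n j <= pcountz n i.
Proof.
move=> ij; rewrite /pcountz; case: leqP => jn; last by case: ifP => // _; apply/ltW/pcount_gt0.
by rewrite (leq_trans ij jn); apply: pcount_homo; lia.
Qed.

Definition ratio n j : R := pcountz n j / pcount n.

Lemma ratio0 n : ratio n 0 = 1.
Proof. by rewrite /ratio /pcountz /= subn0 divff // gt_eqF // pcount_gt0. Qed.

Lemma ratio_ge0 n j : 0 <= ratio n j.
Proof. by rewrite divr_ge0 ?pcountz_ge0 // ltW // pcount_gt0. Qed.

Lemma ratio_noninc n i j : (i <= j)%N -> ratio n j <= ratio n i.
Proof.
by move=> ij; rewrite ler_wpM2r ?pcountz_noninc // invr_ge0 ltW // pcount_gt0.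
Qed.

Lemma ratio_le1 n j : ratio n j <= 1.
Proof. by rewrite -(ratio0 n) ratio_noninc. Qed.

Lemma ratio_out n j : (n < j)%N -> ratio n j = 0.
Proof. by move=> h; rewrite /ratio /pcountz leqNgt h mul0r. Qed.

Lemma ratioD n i j : (i <= n)%N -> ratio n (i + j)%N = ratio n i * ratio (n - i)%N j.
Proof.
move=> ilen; rewrite /ratio /pcountz ilen; have := pcount_gt0 (n - i)%N => h.
have -> : (i + j <= n)%N = (j <= n - i)%N by lia.
case: ifP => jn; last by rewrite !mul0r mulr0.
by rewrite subnDA; field; rewrite !gt_eqF // pcount_gt0.
Qed.

Lemma ratio_rec n B : (n <= B)%N -> n%:R =
  \sum_(1 <= a < B.+1) \sum_(1 <= k < B.+1) a%:R ^+ 2 * ratio n (k * a)%N.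
Proof.
move=> nB; apply: (mulIf (negbT (gt_eqF (pcount_gt0 n)))).
rewrite (pcount_rec nB) big_distrl; apply: eq_bigr => a _; rewrite big_distrl.
by apply: eq_bigr => k _ /=; rewrite /ratio; field; rewrite gt_eqF // pcount_gt0.
Qed.

End Counting.

(** * Exponential sums *)

Section ExponentialSums.
Variable R : realType.
Implicit Types (s x y e c : R).

Lemma mean_value (f df : R -> R) (a b : R) : a <= b ->
  (forall c, is_derive c 1 f (df c)) ->
  exists2 c, a <= c <= b & f b - f a = df c * (b - a).
Proof.
move=> ab fdf; have [c cab ->] := @MVT_segment R f df a b ab (fun c _ => fdf c)
  (derivable_within_continuous (fun c _ => @ex_derive _ _ _ _ _ _ _ (fdf c))).
by exists c; rewrite // in_itv /= in cab.
Qed.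

Lemma mean_value_bound (f df : R -> R) (M b : R) : 0 <= b ->
  (forall c, is_derive c 1 f (df c)) ->
  (forall c, 0 <= c <= b -> `|df c| <= M) -> `|f b - f 0| <= M * b.
Proof.
move=> b0 fdf dM; have [c cb ->] := mean_value b0 fdf.
by rewrite subr0 normrM (ger0_norm b0) ler_wpM2r // dM.
Qed.

Lemma sinh_ge y : 0 <= y -> 2 * y <= expR y - expR (- y).
Proof.
move=> y0.
have [c /andP[c0 _] h] := @mean_value (fun y => expR y - expR (- y)) (fun y => expR y + expR (- y)) 0 y y0
  (fun c => ltac:(apply: is_derive_eq; rewrite /GRing.scale /=; ring)).
move: h; rewrite oppr0 expR0 subrr ?oppr0 ?subr0 ?addr0 => ->; rewrite ler_wpM2r //.
have := expR_gt0 c; have := expRxMexpNx_1 c; have := sqr_ge0 (expR c - expR (- c)).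
by have := expR_gt0 (- c); nra.
Qed.

Lemma one_sub_expN_ge s : 0 <= s -> s * expR (- (s / 2)) <= 1 - expR (- s).
Proof.
move=> s0; have h : 2 * (s / 2) <= _ := @sinh_ge (s / 2) ltac:(lra).
have e1 : expR (- s) = expR (- (s / 2)) * expR (- (s / 2)) by rewrite -expRD; congr expR; field.
have e2 := expRxMexpNx_1 (s / 2).
have := expR_gt0 (- (s / 2)); rewrite e1; nra.
Qed.

Lemma one_sub_expN_le s : 1 - expR (- s) <= s.
Proof. by have := expR_ge1Dx (- s); lra. Qed.

(** A truncation of the series of x^p / (1 - x)^(p+1). Binomial coefficients are used instead of
    powers of a because this family has a two-term recursion in p. *)
Definition binsum p A x := \sum_(0 <= a < A) 'C(a, p)%:R * x ^+ a.

Lemma binsum0 A x : (1 - x) * binsum 0 A x = 1 - x ^+ A.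
Proof.
rewrite /binsum big_mkord (eq_bigr (fun i : 'I_A => x ^+ i)); last first.
  by move=> i _; rewrite bin0 mul1r.
by rewrite -[1 - x]opprB mulNr -subrX1 opprB.
Qed.

Lemma binsumS p A x :
  (1 - x) * binsum p.+1 A x = x * binsum p A x - 'C(A, p.+1)%:R * x ^+ A.
Proof.
rewrite /binsum; elim: A => [|A IH]; first by rewrite !big_geq // bin0n mul0r !mulr0 subr0.
rewrite !big_nat_recr //= !mulrDr IH binS natrD exprS; ring.
Qed.

Lemma binsum_ge0 p A x : 0 <= x -> 0 <= binsum p A x.
Proof. by move=> x0; apply: sumr_ge0 => a _; rewrite mulr_ge0 ?exprn_ge0. Qed.

Lemma binsum_le p A x : 0 <= x < 1 -> binsum p A x <= x ^+ p / (1 - x) ^+ p.+1.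
Proof.
move=> /andP[x0 x1]; have d0 : 0 < 1 - x by lra.
elim: p => [|p IH].
  rewrite expr0 expr1 ler_pdivlMr // mulrC binsum0.
  by have := exprn_ge0 A x0; lra.
have -> : x ^+ p.+1 / (1 - x) ^+ p.+2 = x * (x ^+ p / (1 - x) ^+ p.+1) / (1 - x).
  by rewrite !exprS; field; rewrite gt_eqF //= expf_neq0 // gt_eqF.
rewrite ler_pdivlMr // mulrC binsumS lerBlDr.
apply: (le_trans (ler_wpM2l x0 IH)); rewrite lerDl.
by rewrite mulr_ge0 ?exprn_ge0.
Qed.

Lemma binsum_cvg p x : 0 <= x < 1 ->
  (fun A => binsum p A x) @ \oo --> x ^+ p / (1 - x) ^+ p.+1.
Proof.
move=> /[dup] x01 /andP[x0 x1]; have d0 : 1 - x != 0 by rewrite gt_eqF // subr_gt0.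
elim: p => [|p IH].
  rewrite (_ : (fun A => binsum 0 A x) = (fun A => (1 - x ^+ A) / (1 - x))); last first.
    by apply/funext => A; rewrite -binsum0 mulrC mulKf.
  rewrite expr0 expr1; apply: cvgMl; rewrite -[X in _ --> X]subr0.
  by apply: cvgB; [exact: cvg_cst|apply: cvg_expr; rewrite ger0_norm].
have cs : cvgn (fun A => binsum p.+1 A x).
  apply: nondecreasing_is_cvgn.
    apply/nondecreasing_seqP => n; rewrite /binsum big_nat_recr //= lerDl.
    by rewrite mulr_ge0 ?exprn_ge0.
  by exists (x ^+ p.+1 / (1 - x) ^+ p.+2) => _ [n _ <-]; exact: binsum_le.
have t0 : (fun A => 'C(A, p.+1)%:R * x ^+ A) @ \oo --> (0 : R).
  by apply: (@cvg_series_cvg_0 _ _ (fun A => 'C(A, p.+1)%:R * x ^+ A)).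
rewrite (_ : (fun A => binsum p.+1 A x) =
   (fun A => (x * binsum p A x - 'C(A, p.+1)%:R * x ^+ A) / (1 - x))); last first.
  by apply/funext => A; rewrite -binsumS mulrC mulKf.
have -> : x ^+ p.+1 / (1 - x) ^+ p.+2 = (x * (x ^+ p / (1 - x) ^+ p.+1) - 0) / (1 - x).
  by rewrite subr0 !exprS; field; rewrite d0 /= expf_neq0.
apply: cvgMl; apply: cvgB => //.
exact: cvgMr.
Qed.

(* [exp (- a s) <= exp (- A s / 2) exp (- a s / 2)] for [a >= A]. *)
Lemma binsum_tail p A B s : 0 <= s ->
  binsum p B (expR (- s)) <= binsum p A (expR (- s)) +
    expR (- (A%:R * s / 2)) * binsum p B (expR (- (s / 2))).
Proof.
move=> s0; have [BA|AB] := leqP B A.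
  rewrite {2}/binsum (big_cat_nat (leq0n B) BA) /= -addrA lerDl addr_ge0 //.
    by apply: sumr_ge0 => a _; rewrite mulr_ge0 ?exprn_ge0 // expR_ge0.
  by rewrite mulr_ge0 ?expR_ge0 // binsum_ge0 // expR_ge0.
rewrite {1}/binsum (big_cat_nat (leq0n A) (ltnW AB)) /= -/(binsum p A _) lerD2l.
rewrite /binsum [in X in _ <= X](big_cat_nat (leq0n A) (ltnW AB)) /= mulrDr.
rewrite -[X in X <= _]add0r lerD //.
  by rewrite mulr_ge0 ?expR_ge0 //; apply: sumr_ge0 => a _; rewrite mulr_ge0 ?exprn_ge0 // expR_ge0.
rewrite big_distrr /= !big_nat; apply: ler_sum => a /andP[Aa _].
rewrite mulrCA ler_wpM2l // -!expRM_natl -expRD ler_expR.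
have : (A%:R : R) <= a%:R by rewrite ler_nat.
nra.
Qed.

(** By [one_sub_expN_ge], each of the p + 2 factors 1 - exp(-s) costs exp(-s/2), and the numerator
    pays for all of them since p + 1 >= (p + 2)/2. Hence there is no error term. *)
Lemma geom_ratio_le p s : 0 < s ->
  expR (- s) ^+ p.+1 / (1 - expR (- s)) ^+ p.+2 <= s ^- p.+2.
Proof.
move=> s0; have x1 : 0 < 1 - expR (- s) by rewrite subr_gt0 expR_lt1 oppr_lt0.
have sp : 0 < s ^+ p.+2 by rewrite exprn_gt0.
rewrite ler_pdivrMr ?exprn_gt0 // mulrC ler_pdivlMr //.
apply: (@le_trans _ _ (expR (- (s / 2)) ^+ p.+2 * s ^+ p.+2)).
  rewrite (ler_wpM2r (ltW sp)) // -!expRM_natl ler_expR.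
  have := mulr_ge0 (ler0n R p) (ltW s0).
  rewrite -(natr1 p.+1) -(natr1 p); lra.
rewrite -exprMn ler_pXn2r ?nnegrE ?mulr_ge0 ?expR_ge0 ?(ltW s0) ?(ltW x1) //.
by rewrite mulrC; apply: one_sub_expN_ge; apply: ltW.
Qed.

Lemma binsum_upper p A s : 0 < s -> binsum p.+1 A (expR (- s)) <= s ^- p.+2.
Proof.
move=> s0; apply: le_trans (geom_ratio_le p s0); apply: binsum_le.
by rewrite expR_ge0 expR_lt1 oppr_lt0.
Qed.

(** The full series minus its tail. The tail is bounded by the series at s/2, whence the factor
    2^(p+2). *)
Lemma binsum_lower p A s : 0 < s ->
  s ^- p.+2 * (expR (- (p.+1%:R * s)) - 2 ^+ p.+2 * expR (- (A%:R * s / 2))) <=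
  binsum p.+1 A (expR (- s)).
Proof.
move=> s0.
have x01 : 0 <= expR (- s) < 1 by rewrite expR_ge0 expR_lt1 oppr_lt0.
have x1 : 0 < 1 - expR (- s) by case/andP: x01; lra.
have s20 : 0 < s / 2 by rewrite divr_gt0.
have lim_le : expR (- s) ^+ p.+1 / (1 - expR (- s)) ^+ p.+2 <=
    binsum p.+1 A (expR (- s)) + expR (- (A%:R * s / 2)) * (s / 2) ^- p.+2.
  rewrite -(cvg_lim (@Rhausdorff R) (@binsum_cvg p.+1 _ x01)); apply: limr_le.
    by apply: cvgP; exact: binsum_cvg.
  near=> B; apply: le_trans (binsum_tail _ A _ (ltW s0)) _; rewrite lerD2l.
  by rewrite ler_wpM2l ?expR_ge0 // binsum_upper.
have : s ^- p.+2 * expR (- (p.+1%:R * s)) <= expR (- s) ^+ p.+1 / (1 - expR (- s)) ^+ p.+2.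
  rewrite -mulrN expRM_natl mulrC ler_wpM2l ?exprn_ge0 ?expR_ge0 //.
  rewrite lef_pV2 ?posrE ?exprn_gt0 // ler_pXn2r ?nnegrE ?(ltW s0) ?(ltW x1) //.
  exact: one_sub_expN_le.
have e : (s / 2) ^- p.+2 = s ^- p.+2 * 2 ^+ p.+2 by rewrite exprMn invfM exprVn invrK.
by move: lim_le; rewrite e mulrBr; lra.
Unshelve. all: by end_near.
Qed.

End ExponentialSums.

(** * Double sums over levels and multiples, and zeta(3) *)

Section ZetaSums.
Variable R : realType.
Implicit Types (s e : R).

Definition zsum K : R := \sum_(1 <= k < K) (k%:R ^- 3 : R).

Lemma zsum_nondecr : nondecreasing_seq zsum.
Proof.
apply/nondecreasing_seqP => -[|n]; first by rewrite /zsum !big_geq.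
by rewrite {2}/zsum big_nat_recr //= lerDl invr_ge0 exprn_ge0.
Qed.

Lemma inv_square_sum K : \sum_(1 <= k < K) (k%:R ^- 2 : R) <= 2.
Proof.
case: K => [|[|K]]; [by rewrite big_geq|by rewrite big_geq|].
suff : \sum_(1 <= k < K.+2) (k%:R ^- 2 : R) <= 2 - (K.+1%:R)^-1.
  by move=> h; apply: le_trans h _; rewrite gerBl invr_ge0.
elim: K => [|K IH]; first by rewrite big_nat1 expr1n invr1; lra.
rewrite big_nat_recr //=; apply: le_trans (lerD IH (lexx _)) _.
have k0 : 0 < K.+1%:R :> R by rewrite ltr0n.
rewrite -(natr1 K.+1); set k : R := K.+1%:R in k0 *.
rewrite -subr_ge0.
have -> : 2 - (k + 1)^-1 - (2 - k^-1 + (k + 1) ^- 2) = (k * (k + 1) ^+ 2)^-1.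
  by field; rewrite !gt_eqF //; lra.
by rewrite invr_ge0 mulr_ge0 ?exprn_ge0 //; lra.
Qed.

Lemma zsum_ub K : zsum K <= 2.
Proof.
apply: le_trans (inv_square_sum K); rewrite /zsum !big_nat; apply: ler_sum => k /andP[k0 _].
have k1 : 1 <= k%:R :> R by rewrite ler1n.
by rewrite lef_pV2 ?posrE ?exprn_gt0 ?(lt_le_trans ltr01 k1) // ler_weXn2l.
Qed.

Lemma zsum_cvg : cvgn zsum.
Proof.
apply: nondecreasing_is_cvgn; first exact: zsum_nondecr.
by exists 2 => _ [n _ <-]; exact: zsum_ub.
Qed.

Lemma zsum_le K : zsum K <= zeta3.
Proof. exact: nondecreasing_cvgn_le zsum_nondecr zsum_cvg K. Qed.

Lemma zsum_approx e : 0 < e -> exists K, zeta3 - e <= zsum K.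
Proof.
move=> e0; have /cvgrPdist_le/(_ e e0) [K _ h] : zsum @ \oo --> (zeta3 : R) by exact: zsum_cvg.
exists K; have := h K (leqnn K); rewrite ger0_norm ?subr_ge0 ?zsum_le //; lra.
Qed.

Lemma zeta3_ge1 : 1 <= zeta3 :> R.
Proof. by apply: le_trans (zsum_le 2); rewrite /zsum big_nat1 expr1n invr1. Qed.

Lemma sqr_bin a : a%:R ^+ 2 = 2 * 'C(a, 2)%:R + 'C(a, 1)%:R :> R.
Proof.
elim: a => [|a IH]; first by rewrite expr0n /= !bin0n mulr0 addr0.
rewrite binS !bin1 in IH *; rewrite natrD -natr1 mulrDr.
have -> : (a%:R + 1) ^+ 2 = a%:R ^+ 2 + 2 * a%:R + 1 :> R by ring.
by rewrite IH; ring.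
Qed.

(** The combination a^3 - a, which arises from the squared widths of the cells of level a, is a
    single binomial coefficient; its exponential sum is therefore bounded without lower-order
    terms. *)
Lemma cube_bin a : a%:R ^+ 3 - a%:R = 6 * 'C(a.+1, 3)%:R :> R.
Proof.
elim: a => [|a IH]; first by rewrite expr0n /= subr0 bin_small // mulr0.
rewrite binS natrD mulrDr -IH binS natrD bin1 -natr1.
have := sqr_bin a; rewrite bin1 => h.
have -> : 6 * ('C(a, 2)%:R + a%:R) = 3 * (a%:R ^+ 2 - a%:R) + 6 * a%:R :> R.
  by rewrite h; ring.
ring.
Qed.

Lemma expN_natM a s : expR (- (a%:R * s)) = expR (- s) ^+ a.
Proof. by rewrite -mulrN expRM_natl. Qed.

Lemma sqsum_upper A s : 0 < s ->
  \sum_(1 <= a < A.+1) a%:R ^+ 2 * expR (- (a%:R * s)) <= 2 * s ^- 3 + s ^- 2.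
Proof.
move=> s0; apply: (@le_trans _ _ (2 * binsum 2 A.+1 (expR (- s)) + binsum 1 A.+1 (expR (- s)))).
  rewrite /binsum big_distrr -big_split /= [X in _ <= X]big_ltn //.
  rewrite !bin0n !mul0r mulr0 !add0r; apply: ler_sum => a _.
  by rewrite expN_natM sqr_bin mulrDl mulrA.
by rewrite lerD ?ler_wpM2l ?binsum_upper.
Qed.

Lemma sqsum_lower A s : 0 < s ->
  2 * s ^- 3 * (expR (- (2 * s)) - 8 * expR (- (A%:R * s / 2))) <=
  \sum_(1 <= a < A.+1) a%:R ^+ 2 * expR (- (a%:R * s)).
Proof.
move=> s0; apply: (@le_trans _ _ (2 * binsum 2 A.+1 (expR (- s)))).
  rewrite -mulrA ler_wpM2l //; apply: le_trans (binsum_lower 1 A.+1 s0).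
  rewrite ler_wpM2l ?invr_ge0 ?exprn_ge0 ?(ltW s0) // lerB //.
  rewrite (_ : 2 ^+ 3 = 8); last by ring.
  by rewrite ler_wpM2l // ler_expR -natr1; nra.
rewrite /binsum big_distrr /= [X in X <= _]big_ltn // bin0n mul0r mulr0 add0r.
apply: ler_sum => a _; rewrite expN_natM sqr_bin [X in _ <= X]mulrDl mulrA lerDl.
by rewrite mulr_ge0 ?exprn_ge0 ?expR_ge0.
Qed.

Lemma cubesum_upper A s : 0 < s ->
  \sum_(1 <= a < A.+1) (a%:R ^+ 3 - a%:R) * expR (- (a%:R * s)) <= 6 * s ^- 4.
Proof.
move=> s0; set x := expR (- s).
have x0 : 0 < x by exact: expR_gt0.
have x1 : 0 < 1 - x by rewrite subr_gt0 expR_lt1 oppr_lt0.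
have h : \sum_(1 <= a < A.+1) (a%:R ^+ 3 - a%:R) * expR (- (a%:R * s)) * x <= 6 * (x ^+ 3 / (1 - x) ^+ 4).
  apply: le_trans (ler_wpM2l (ler0n _ 6) (@binsum_le _ 3 A.+2 x _)); last by lra.
  rewrite /binsum big_distrr /= [X in _ <= X]big_ltn // [X in _ <= _ + X]big_add1 /=.
  rewrite bin0n mul0r mulr0 add0r [X in _ <= X]big_ltn // bin_small // mul0r mulr0 add0r.
  by apply: ler_sum => a _; rewrite expN_natM cube_bin exprSr !mulrA.
rewrite -big_distrl /= in h; rewrite -(ler_pM2r x0); apply: (le_trans h).
rewrite -[X in _ <= X]mulrA (mulrC _ x) ler_wpM2l //.
rewrite ler_pdivrMr ?exprn_gt0 // mulrAC ler_pdivlMr ?exprn_gt0 //.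
rewrite exprS -mulrA ler_wpM2l ?(ltW x0) //.
have -> : x ^+ 2 * s ^+ 4 = (s * expR (- (s / 2))) ^+ 4.
  by rewrite exprMn mulrC; congr (_ * _); rewrite /x -!expRM_natl; congr expR; field.
rewrite ler_pXn2r ?nnegrE ?(ltW x1) ?mulr_ge0 ?expR_ge0 ?(ltW s0) //.
exact: one_sub_expN_ge (ltW s0).
Qed.

Lemma cubesum_lower A s : 0 < s ->
  6 * s ^- 4 * (expR (- (3 * s)) - 16 * expR (- (A%:R * s / 2))) <=
  \sum_(1 <= a < A.+1) (a%:R ^+ 3 - a%:R) * expR (- (a%:R * s)).
Proof.
move=> s0; apply: (@le_trans _ _ (6 * binsum 3 A.+2 (expR (- s)))).
  rewrite -mulrA ler_wpM2l //; apply: le_trans (binsum_lower 2 A.+2 s0).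
  rewrite ler_wpM2l ?invr_ge0 ?exprn_ge0 ?(ltW s0) // lerB //.
  rewrite (_ : 2 ^+ 4 = 16); last by ring.
  by rewrite ler_wpM2l // ler_expR -natr1 -natr1; nra.
rewrite /binsum big_distrr /= [X in X <= _]big_ltn // bin0n mul0r mulr0 add0r.
rewrite big_add1 /= [X in X <= _]big_ltn // bin_small // mul0r mulr0 add0r.
apply: ler_sum => a _; rewrite expN_natM cube_bin mulrA ler_wpM2l ?mulr_ge0 //.
rewrite exprS ger_pMl ?exprn_gt0 ?expR_gt0 // expR_le1; lra.
Qed.

(** Half of the exponent absorbs the power through y^p / p! <= exp y with y = a s / 2; the other
    half is summed as a geometric series. *)
Lemma powsum_upper p A s : 0 < s ->
  \sum_(1 <= a < A.+1) a%:R ^+ p * expR (- (a%:R * s)) <= p`!%:R * 2 ^+ p.+1 * s ^- p.+1.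
Proof.
move=> s0; have s20 : 0 < s / 2 by rewrite divr_gt0.
have geo : \sum_(1 <= a < A.+1) expR (- (a%:R * (s / 2))) <= (s / 2)^-1.
  have x1 : 0 < 1 - expR (- (s / 2)) by rewrite subr_gt0 expR_lt1 oppr_lt0.
  have -> : \sum_(1 <= a < A.+1) expR (- (a%:R * (s / 2))) =
      expR (- (s / 2)) * binsum 0 A (expR (- (s / 2))).
    rewrite big_add1 /= /binsum big_distrr /=; apply: eq_bigr => a _.
    by rewrite bin0 mul1r -exprS expN_natM.
  apply: (@le_trans _ _ (expR (- (s / 2)) * (1 / (1 - expR (- (s / 2)))))).
    rewrite ler_wpM2l ?expR_ge0 //.
    have := @binsum_le _ 0 A (expR (- (s / 2))); rewrite expr0 expr1; apply.
    by rewrite expR_ge0 expR_lt1 oppr_lt0.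
  rewrite mul1r ler_pdivrMr // ler_pdivlMl //.
  have := expR_ge1Dx (s / 2); have := expRxMexpNx_1 (s / 2); have := expR_gt0 (- (s / 2)).
  nra.
have f0 : 0 < p`!%:R :> R by rewrite ltr0n fact_gt0.
apply: (@le_trans _ _ (\sum_(1 <= a < A.+1) p`!%:R * (s / 2) ^- p * expR (- (a%:R * (s / 2))))).
  apply: ler_sum => a _.
  have -> : expR (- (a%:R * s)) = expR (- (a%:R * (s / 2))) * expR (- (a%:R * (s / 2))).
    by rewrite -expRD; congr expR; field.
  rewrite mulrA ler_wpM2r ?expR_ge0 // expRN ler_pdivrMr ?expR_gt0 //.
  rewrite mulrAC ler_pdivlMr ?exprn_gt0 // -exprMn.
  set y := a%:R * (s / 2); have y0 : 0 <= y by rewrite mulr_ge0 ?(ltW s20).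
  rewrite mulrC -ler_pdivrMr //; case: p f0 => [|p] f0.
    by rewrite expr0 fact0 divr1; apply: le_trans (expR_ge1Dx y); lra.
  by apply: le_trans (expR_ge1Dxn p y0); rewrite lerDr.
rewrite -big_distrr /=; apply: le_trans (ler_wpM2l _ geo) _.
  by rewrite mulr_ge0 ?ler0n ?invr_ge0 ?exprn_ge0 ?(ltW s20).
rewrite -mulrA -mulrA ler_wpM2l ?ler0n // le_eqVlt; apply/orP; left; apply/eqP.
by rewrite -invfM -exprSr expr_div_n invf_div.
Qed.

Lemma expN_natM2 k a s : expR (- ((k * a)%N%:R * s)) = expR (- (a%:R * (k%:R * s))).
Proof. by rewrite natrM mulrAC mulrC. Qed.

Lemma exprVn_mul k n s : (k%:R * s) ^- n = k%:R ^- n * s ^- n :> R.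
Proof. by rewrite exprMn invfM. Qed.

(** For fixed k the sum over a is at most 2 (k s)^(-3) plus a lower-order term; summing over k
    produces zeta(3). *)
Lemma double_sqsum_upper A s : 0 < s ->
  \sum_(1 <= a < A.+1) \sum_(1 <= k < A.+1) a%:R ^+ 2 * expR (- ((k * a)%N%:R * s)) <=
  2 * zeta3 * s ^- 3 + 2 * s ^- 2.
Proof.
move=> s0; rewrite exchange_big /=.
apply: (@le_trans _ _ (\sum_(1 <= k < A.+1) (2 * s ^- 3 * k%:R ^- 3 + s ^- 2 * k%:R ^- 2))).
  rewrite !big_nat; apply: ler_sum => k /andP[k0 _].
  under eq_bigr do rewrite expN_natM2.
  have ks : 0 < k%:R * s by rewrite mulr_gt0 // ltr0n.
  apply: (le_trans (sqsum_upper A ks)); rewrite !exprVn_mul.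
  by rewrite [k%:R ^- 3 * _]mulrC [k%:R ^- 2 * _]mulrC mulrA.
rewrite big_split /= -!big_distrr /= lerD //.
  rewrite mulrAC ler_wpM2r ?invr_ge0 ?exprn_ge0 ?(ltW s0) //.
  by rewrite ler_wpM2l // zsum_le.
by rewrite mulrC ler_wpM2r ?inv_square_sum // invr_ge0 exprn_ge0 ?(ltW s0).
Qed.

(** Keeping only k < K makes the factors exp(-2 k s) of [sqsum_lower] bounded below uniformly. *)
Lemma double_sqsum_lower A K s : 0 < s ->
  2 * s ^- 3 * (expR (- (2 * (K%:R * s))) - 8 * expR (- (A%:R * s / 2))) * zsum K <=
  \sum_(1 <= a < A.+1) \sum_(1 <= k < K) a%:R ^+ 2 * expR (- ((k * a)%N%:R * s)).
Proof.
move=> s0; rewrite exchange_big /= /zsum big_distrr /= !big_nat.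
apply: ler_sum => k /andP[k0 kK].
under [X in _ <= X]eq_bigr do rewrite expN_natM2.
have k1 : 1 <= k%:R :> R by rewrite ler1n.
have kK' : k%:R <= K%:R :> R by rewrite ler_nat ltnW.
have ks : 0 < k%:R * s by rewrite mulr_gt0 // ltr0n.
apply: le_trans (sqsum_lower A ks); rewrite exprVn_mul.
have -> : 2 * s ^- 3 * (expR (- (2 * (K%:R * s))) - 8 * expR (- (A%:R * s / 2))) * k%:R ^- 3 =
  2 * (k%:R ^- 3 * s ^- 3) * (expR (- (2 * (K%:R * s))) - 8 * expR (- (A%:R * s / 2))) by ring.
rewrite ler_wpM2l ?mulr_ge0 ?invr_ge0 ?exprn_ge0 ?(ltW s0) // lerB //.
  by rewrite ler_expR; nra.
rewrite ler_wpM2l // ler_expR lerN2.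
by have := mulr_ge0 (ler0n R A) (ltW s0); nra.
Qed.

Lemma double_cubesum_upper A s : 0 < s ->
  \sum_(1 <= a < A.+1) \sum_(1 <= k < A.+1)
    k%:R * (a%:R ^+ 3 - a%:R) * expR (- ((k * a)%N%:R * s)) <= 6 * zeta3 * s ^- 4.
Proof.
move=> s0; rewrite exchange_big /=.
apply: (@le_trans _ _ (\sum_(1 <= k < A.+1) 6 * s ^- 4 * k%:R ^- 3)).
  rewrite !big_nat; apply: ler_sum => k /andP[k0 _].
  under eq_bigr do rewrite expN_natM2 -mulrA.
  have k1 : 0 < k%:R :> R by rewrite ltr0n.
  have ks : 0 < k%:R * s by rewrite mulr_gt0.
  rewrite -big_distrr /=; apply: (le_trans (ler_wpM2l (ltW k1) (cubesum_upper A ks))).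
  rewrite exprVn_mul le_eqVlt; apply/orP; left; apply/eqP; field.
  by rewrite !gt_eqF.
rewrite -big_distrr /= mulrAC ler_wpM2r ?invr_ge0 ?exprn_ge0 ?(ltW s0) //.
by rewrite ler_wpM2l // zsum_le.
Qed.

Lemma double_cubesum_lower A K s : 0 < s ->
  6 * s ^- 4 * (expR (- (3 * (K%:R * s))) - 16 * expR (- (A%:R * s / 2))) * zsum K <=
  \sum_(1 <= a < A.+1) \sum_(1 <= k < K)
    k%:R * (a%:R ^+ 3 - a%:R) * expR (- ((k * a)%N%:R * s)).
Proof.
move=> s0; rewrite exchange_big /= /zsum big_distrr /= !big_nat.
apply: ler_sum => k /andP[k0 kK].
under [X in _ <= X]eq_bigr do rewrite expN_natM2 -mulrA.
have k1 : 1 <= k%:R :> R by rewrite ler1n.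
have kK' : k%:R <= K%:R :> R by rewrite ler_nat ltnW.
have k2 : 0 < k%:R :> R by rewrite ltr0n.
have ks : 0 < k%:R * s by rewrite mulr_gt0.
rewrite -big_distrr /=; apply: le_trans (ler_wpM2l (ltW k2) (cubesum_lower A ks)).
rewrite exprVn_mul.
have -> : k%:R * (6 * (k%:R ^- 4 * s ^- 4) * (expR (- (3 * (k%:R * s))) - 16 * expR (- (A%:R * (k%:R * s) / 2)))) = 6 * s ^- 4 * (expR (- (3 * (k%:R * s))) - 16 * expR (- (A%:R * (k%:R * s) / 2))) * k%:R ^- 3.
  by field; rewrite !gt_eqF.
rewrite ler_wpM2r ?invr_ge0 ?exprn_ge0 ?(ltW k2) //.
rewrite ler_wpM2l ?mulr_ge0 ?invr_ge0 ?exprn_ge0 ?(ltW s0) // lerB //.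
  by rewrite ler_expR; nra.
rewrite ler_wpM2l // ler_expR lerN2.
by have := mulr_ge0 (ler0n R A) (ltW s0); nra.
Qed.

Lemma double_powsum_upper q A s : 0 < s ->
  \sum_(1 <= a < A.+1) \sum_(1 <= k < A.+1)
    k%:R ^+ q * a%:R ^+ q.+2 * expR (- ((k * a)%N%:R * s)) <=
  (q.+2)`!%:R * 2 ^+ q.+3 * zeta3 * s ^- q.+3.
Proof.
move=> s0; rewrite exchange_big /=.
apply: (@le_trans _ _ (\sum_(1 <= k < A.+1) (q.+2)`!%:R * 2 ^+ q.+3 * s ^- q.+3 * k%:R ^- 3)).
  rewrite !big_nat; apply: ler_sum => k /andP[k0 _].
  under eq_bigr do rewrite expN_natM2 -mulrA.
  have k1 : 0 < k%:R :> R by rewrite ltr0n.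
  have ks : 0 < k%:R * s by rewrite mulr_gt0.
  rewrite -big_distrr /=; apply: (le_trans (ler_wpM2l (exprn_ge0 q (ltW k1)) (powsum_upper q.+2 A ks))).
  rewrite exprVn_mul le_eqVlt; apply/orP; left; apply/eqP.
  rewrite (_ : k%:R ^- q.+3 = k%:R ^- q * k%:R ^- 3); last by rewrite -invfM -exprD addn3.
  by field; rewrite !gt_eqF //= ?expf_neq0 ?gt_eqF // exprn_gt0.
rewrite -big_distrr /= mulrAC ler_wpM2r ?invr_ge0 ?exprn_ge0 ?(ltW s0) //.
by rewrite ler_wpM2l ?zsum_le // mulr_ge0 ?exprn_ge0.
Qed.

End ZetaSums.

(** * Growth of the number of plane partitions *)

Section Growth.
Variable R : realType.

Definition cbrt (n : nat) : R := n%:R `^ (3^-1).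

(** The decay rate of the ratios: with ratio exp(-kap k / u) and u^3 = n, the recursion reads n = 2
    zeta(3) (u / kap)^3 to leading order, which forces kap^3 = 2 zeta(3). *)
Definition kap : R := (2 * zeta3) `^ (3^-1).

Lemma cube_powR (x : R) : 0 <= x -> (x `^ (3^-1)) ^+ 3 = x.
Proof.
move=> x0; rewrite -powR_mulrn ?powR_ge0 // -powRrM mulVf ?powRr1 //.
Qed.

Lemma cbrt_cube n : cbrt n ^+ 3 = n%:R.
Proof. exact: cube_powR. Qed.

Lemma cbrt_ge0 n : 0 <= cbrt n. Proof. exact: powR_ge0. Qed.

Lemma cbrt_gt0 n : (0 < n)%N -> 0 < cbrt n.
Proof. by move=> n0; rewrite powR_gt0 // ltr0n. Qed.

Lemma cbrt_le m n : (m <= n)%N -> cbrt m <= cbrt n.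
Proof. by move=> mn; apply: ge0_ler_powR; rewrite ?nnegrE ?ler_nat. Qed.

Lemma cbrt_near (X : R) : \forall n \near \oo, X <= cbrt n.
Proof.
pose Y := Num.max 0 X; have Y0 : 0 <= Y by rewrite le_max lexx.
near=> n; apply: (@le_trans _ _ Y); first by rewrite le_max lexx orbT.
rewrite -(@ler_pXn2r _ 3) ?nnegrE ?cbrt_ge0 // cbrt_cube.
near: n; exact: nbhs_infty_ger.
Unshelve. all: by end_near. Qed.

Lemma one_le_expR (x : R) : 0 <= x -> 1 <= expR x.
Proof. by move=> x0; apply: le_trans (expR_ge1Dx x); rewrite lerDl. Qed.

Lemma kap_cube : kap ^+ 3 = 2 * zeta3.
Proof. by apply: cube_powR; have := zeta3_ge1 R; lra. Qed.

Lemma kap_gt0 : 0 < kap.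
Proof. by apply: powR_gt0; have := zeta3_ge1 R; lra. Qed.

(** Concavity of t^(2/3) at t = u^3, written in terms of cube roots: the tangent has slope 2 / (3
    u). *)
Lemma sqr_le_tangent (u v : R) : 0 < u -> 0 <= v -> v ^+ 2 <= u ^+ 2 - 2 / 3 * ((u ^+ 3 - v ^+ 3) / u).
Proof.
move=> u0 v0; rewrite -subr_ge0.
have -> : u ^+ 2 - 2 / 3 * ((u ^+ 3 - v ^+ 3) / u) - v ^+ 2 =
   (u - v) ^+ 2 * (u + 2 * v) / (3 * u) by field; rewrite gt_eqF.
by apply: divr_ge0; [apply: mulr_ge0; [exact: sqr_ge0|lra]|lra].
Qed.

(** The tangent exceeds the function by at most (u - v)^2, and u - v <= (u^3 - v^3) / u^2 expresses
    this through the difference of cubes. *)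
Lemma sqr_ge_tangent (u v : R) : 0 < u -> 0 <= v -> v <= u ->
  u ^+ 2 - 2 / 3 * ((u ^+ 3 - v ^+ 3) / u) - ((u ^+ 3 - v ^+ 3) / u ^+ 2) ^+ 2 <= v ^+ 2.
Proof.
move=> u0 v0 vu; set d := (u ^+ 3 - v ^+ 3) / u ^+ 2.
have hd : u - v <= d.
  rewrite /d ler_pdivlMr ?exprn_gt0 //.
  have : 0 <= v * (u - v) * (u + v) by rewrite !mulr_ge0 //; lra.
  lra.
have hd2 : (u - v) ^+ 2 <= d ^+ 2 by rewrite ler_pXn2r ?nnegrE //; lra.
have -> : 2 / 3 * ((u ^+ 3 - v ^+ 3) / u) = u ^+ 2 - v ^+ 2 - (u - v) ^+ 2 * (u + 2 * v) / (3 * u).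
  by field; rewrite gt_eqF.
have : (u - v) ^+ 2 * (u + 2 * v) / (3 * u) <= (u - v) ^+ 2.
  rewrite ler_pdivrMr; last by lra.
  by rewrite ler_wpM2l ?sqr_ge0 //; lra.
lra.
Qed.

Lemma cbrt_sub n j : (j <= n)%N -> (cbrt n ^+ 3 - cbrt (n - j) ^+ 3) = j%:R.
Proof. by move=> jn; rewrite !cbrt_cube natrB // opprB addrC subrK. Qed.

Lemma expR_cbrt_le (c : R) n j : 0 <= c -> (0 < n)%N -> (j <= n)%N ->
  expR (3 / 2 * c * cbrt (n - j) ^+ 2) <=
  expR (3 / 2 * c * cbrt n ^+ 2) * expR (- (j%:R * (c / cbrt n))).
Proof.
move=> c0 n0 jn; rewrite -expRD ler_expR.
have := @sqr_le_tangent (cbrt n) (cbrt (n - j)) (cbrt_gt0 n0) (cbrt_ge0 _).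
rewrite cbrt_sub // => h; have := ler_wpM2l c0 h.
have -> : j%:R * (c / cbrt n) = c * (j%:R / cbrt n) by rewrite mulrCA.
lra.
Qed.

Lemma expR_cbrt_ge (c : R) n j (M : R) : 0 <= c -> (0 < n)%N -> (j <= n)%N -> j%:R <= M ->
  expR (3 / 2 * c * cbrt n ^+ 2) * expR (- (j%:R * (c / cbrt n))) *
    expR (- (3 / 2 * c * (M / cbrt n ^+ 2) ^+ 2)) <=
  expR (3 / 2 * c * cbrt (n - j) ^+ 2).
Proof.
move=> c0 n0 jn jM; rewrite -!expRD ler_expR.
have u0 := cbrt_gt0 n0.
have := @sqr_ge_tangent (cbrt n) (cbrt (n - j)) u0 (cbrt_ge0 _) (cbrt_le (leq_subr _ _)).
rewrite cbrt_sub // => h; have := ler_wpM2l c0 h.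
have -> : j%:R * (c / cbrt n) = c * (j%:R / cbrt n) by rewrite mulrCA.
have : (j%:R / cbrt n ^+ 2) ^+ 2 <= (M / cbrt n ^+ 2) ^+ 2.
  rewrite ler_pXn2r ?nnegrE ?divr_ge0 ?exprn_ge0 ?(ltW u0) //; last by apply: le_trans jM.
  by rewrite ler_wpM2r ?invr_ge0 ?exprn_ge0 ?(ltW u0).
move=> h2; have := ler_wpM2l c0 h2; lra.
Qed.

(** Induction through the recursion: by concavity the bound at n - k a is the one at n times exp(-k
    a c / u), and the double sum is at most 2 zeta(3) u^3 / c^3 + 2 u^2 / c^2. The strict inequality
    on c leaves room for the second term once n >= N0; the constant covers smaller n. *)
Lemma pcount_upper (c : R) : 0 < c -> 2 * zeta3 < c ^+ 3 ->
  exists2 K, 0 < K & forall n, pcount R n <= K * expR (3 / 2 * c * cbrt n ^+ 2).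
Proof.
move=> c0 hc.
have d0 : 0 < 1 - 2 * zeta3 / c ^+ 3 by rewrite subr_gt0 ltr_pdivrMr ?exprn_gt0 // mul1r.
have [N0 _ hN] := cbrt_near (2 / c ^+ 2 / (1 - 2 * zeta3 / c ^+ 3)).
exists (pcount R N0); first exact: pcount_gt0.
elim/ltn_ind => n IH; have [nN|Nn] := leqP n N0.
  apply: (le_trans (pcount_homo R nN)); rewrite ler_peMr ?(ltW (pcount_gt0 _ _)) //.
  by rewrite one_le_expR ?mulr_ge0 ?exprn_ge0 ?cbrt_ge0 ?(ltW c0).
have n0 : (0 < n)%N by lia.
have u0 := cbrt_gt0 n0; have cn0 : 0 < c / cbrt n by rewrite divr_gt0.
have nR : 0 < n%:R :> R by rewrite ltr0n.
rewrite -(ler_pM2l nR) (pcount_rec R (leqnn n)).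
set E := expR _.
apply: (@le_trans _ _ (\sum_(1 <= a < n.+1) \sum_(1 <= k < n.+1) pcount R N0 * E *
    (a%:R ^+ 2 * expR (- ((k * a)%N%:R * (c / cbrt n)))))).
  rewrite !big_nat; apply: ler_sum => a /andP[a0 _]; rewrite !big_nat.
  apply: ler_sum => k /andP[k0 _]; rewrite mulrCA ler_wpM2l ?exprn_ge0 //.
  rewrite /pcountz; case: ifP => kn; last first.
    by rewrite !mulr_ge0 ?expR_ge0 // ltW // pcount_gt0.
  apply: (le_trans (IH (n - k * a)%N _)); first by rewrite ltn_subrL muln_gt0 k0 a0 n0.
  rewrite -[X in _ <= X]mulrA ler_wpM2l ?(ltW (pcount_gt0 _ _)) //.
  by apply: expR_cbrt_le => //; apply: ltW.
under eq_bigr do rewrite -big_distrr /=.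
rewrite -big_distrr /= mulrC ler_wpM2r ?mulr_ge0 ?expR_ge0 ?(ltW (pcount_gt0 _ _)) //.
apply: (le_trans (double_sqsum_upper n cn0)).
rewrite -(cbrt_cube n); have := hN n (ltnW Nn); set u := cbrt n in u0 *.
rewrite /= ler_pdivrMr // => hu.
have -> : 2 * zeta3 * (c / u) ^- 3 + 2 * (c / u) ^- 2 =
   u ^+ 2 * (u * (2 * zeta3 / c ^+ 3) + 2 / c ^+ 2) :> R.
  by field; rewrite !gt_eqF.
rewrite [X in _ <= X]exprSr ler_wpM2l ?exprn_ge0 ?(ltW u0) //; lra.
Qed.

Lemma double_sum_restrict (f : nat -> nat -> R) A K B :
  (forall a k, 0 <= f a k) -> (A <= B)%N -> (K <= B.+1)%N ->
  \sum_(1 <= a < A.+1) \sum_(1 <= k < K) f a k <=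
  \sum_(1 <= a < B.+1) \sum_(1 <= k < B.+1) f a k.
Proof.
move=> f0 AB KB; have inner a : \sum_(1 <= k < K) f a k <= \sum_(1 <= k < B.+1) f a k.
  have [K0|K0] := leqP K 1; first by rewrite [X in X <= _]big_geq // sumr_ge0.
  by rewrite [X in _ <= X](big_cat_nat (ltnW K0) KB) /= lerDl sumr_ge0.
rewrite [X in _ <= X](@big_cat_nat _ _ _ A.+1) //= -[X in X <= _]addr0 lerD //.
  by apply: ler_sum.
by apply: sumr_ge0 => a _; apply: sumr_ge0.
Qed.

(** The same induction from below, restricted to k < K1 and a of order u. On this range k a is of
    order u, so the second-order error of the tangent is of order 1 / u^2 relative to u^2, that is,
    O(1 / u^2) in the exponent. *)
Lemma pcount_lower (c : R) : 0 < c -> c ^+ 3 < 2 * zeta3 ->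
  exists2 K, 0 < K & forall n, expR (3 / 2 * c * cbrt n ^+ 2) <= K * pcount R n.
Proof.
move=> c0 hc; have c30 : 0 < c ^+ 3 by rewrite exprn_gt0.
have e0 : 0 < (2 * zeta3 - c ^+ 3) / 4 by rewrite divr_gt0 // subr_gt0.
have [K1 hK1] := zsum_approx e0; set Z := zsum R K1 in hK1.
have Z0 : c ^+ 3 < 2 * Z by lra.
have K11 : (1 < K1)%N.
  by case: K1 @Z hK1 Z0 => [|[|//]] Z hK1; rewrite /Z /zsum big_geq //; lra.
(* The gap is split as 1 - rho = 3 eta. The tangent error [F], the factor exp(-2 K1 s) and the
   truncation of a at L u cost at most eta each; L = 16 / (c eta) makes the exponent of the
   truncation term at least 8 / eta. *)
set rho := c ^+ 3 / (2 * Z).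
have rho1 : rho < 1 by rewrite ltr_pdivrMr ?mul1r //; lra.
set eta := (1 - rho) / 3; have eta0 : 0 < eta by rewrite divr_gt0 // subr_gt0.
set L := 16 / (c * eta); have L0 : 0 < L by rewrite divr_gt0 // mulr_gt0.
set M1 := K1%:R * (L + 1); have M10 : 0 < M1.
  by rewrite mulr_gt0 ?ltr0n ?(ltnW K11) //; lra.
have [N0 _ hN] : \forall n \near \oo, [/\ 1 <= cbrt n, 2 * K1%:R * c / eta <= cbrt n,
   M1 <= cbrt n & 3 / 2 * c * M1 ^+ 2 / eta <= cbrt n].
  by near=> n; split; near: n; exact: cbrt_near.
exists (expR (3 / 2 * c * cbrt N0 ^+ 2)); first exact: expR_gt0.
elim/ltn_ind => n IH; have [nN|Nn] := leqP n N0.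
  apply: (@le_trans _ _ (expR (3 / 2 * c * cbrt N0 ^+ 2))).
    rewrite ler_expR ler_wpM2l ?mulr_ge0 ?(ltW c0) //.
    by rewrite ler_pXn2r ?nnegrE ?cbrt_ge0 // cbrt_le.
  by rewrite ler_peMr ?expR_ge0 // pcount_ge1.
have n0 : (0 < n)%N := leq_ltn_trans (leq0n _) Nn.
have nR : 0 < n%:R :> R by rewrite ltr0n.
have [] := hN n (ltnW Nn); set KK := expR (3 / 2 * c * cbrt N0 ^+ 2).
have u0 := cbrt_gt0 n0; set u := cbrt n in u0 * => u1 u2 u3 u4.
set s := c / u; have s0 : 0 < s by rewrite divr_gt0.
set A := (Num.truncn (L * u)).+1.
have Lu0 : 0 <= L * u by rewrite mulr_ge0 ?ltW.
have AL : L * u <= A%:R by apply: ltW; rewrite truncnS_gt.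
have AU : A%:R <= (L + 1) * u.
  rewrite /A -natr1; have : (Num.truncn (L * u))%:R <= L * u by rewrite truncn_le.
  lra.
have MU : (K1 * A)%N%:R <= M1 * u.
  by rewrite natrM /M1 -mulrA ler_wpM2l.
have Mn : (K1 * A <= n)%N.
  rewrite -(ler_nat R); apply: (le_trans MU); rewrite -(cbrt_cube n) -/u exprSr.
  by rewrite ler_wpM2r ?(ltW u0) //; nra.
have A1 : (0 < A)%N by [].
set E := expR (3 / 2 * c * u ^+ 2).
set F := expR (- (3 / 2 * c * (M1 * u / u ^+ 2) ^+ 2)).
rewrite -(ler_pM2l nR) mulrCA (pcount_rec R (leqnn n)) big_distrr /=.
under [X in _ <= X]eq_bigr do rewrite big_distrr /=.
apply: (@le_trans _ _ (\sum_(1 <= a < A.+1) \sum_(1 <= k < K1)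
   KK * (a%:R ^+ 2 * pcountz R n (k * a)%N))); last first.
  apply: (double_sum_restrict (f := fun a k => KK * (a%:R ^+ 2 * pcountz R n (k * a)%N))).
  - by move=> a k; rewrite !mulr_ge0 ?expR_ge0 ?exprn_ge0 ?pcountz_ge0.
  - by apply: leq_trans Mn; rewrite leq_pmull // ltnW.
  - by apply: leqW; apply: leq_trans Mn; rewrite leq_pmulr.
apply: (@le_trans _ _ (\sum_(1 <= a < A.+1) \sum_(1 <= k < K1)
   E * F * (a%:R ^+ 2 * expR (- ((k * a)%N%:R * s))))); last first.
  rewrite !big_nat; apply: ler_sum => a /andP[a0 aA]; rewrite !big_nat.
  apply: ler_sum => k /andP[k0 kK].
  rewrite mulrCA [X in _ <= X]mulrCA ler_wpM2l ?exprn_ge0 //.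
  have kan : (k * a <= K1 * A)%N by apply: leq_mul; [exact: ltnW|rewrite -ltnS].
  have kan' := leq_trans kan Mn.
  rewrite /pcountz kan'; apply: le_trans (IH (n - k * a)%N _); last by rewrite ltn_subrL muln_gt0 k0 a0 n0.
  rewrite mulrAC; apply: expR_cbrt_ge => //; first exact: ltW.
  by apply: le_trans MU; rewrite ler_nat.
under [X in _ <= X]eq_bigr do rewrite -big_distrr /=.
rewrite -big_distrr /= mulrC -mulrA ler_wpM2l ?expR_ge0 //.
have F1 : 1 - eta <= F.
  apply: le_trans (expR_ge1Dx _); rewrite lerD2l lerN2.
  have -> : M1 * u / u ^+ 2 = M1 / u by field; rewrite gt_eqF.
  rewrite expr_div_n mulrA ler_pdivrMr ?exprn_gt0 //.
  rewrite -ler_pdivrMl // mulrC; apply: (le_trans u4); nra.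
have e1 : 1 - eta <= expR (- (2 * (K1%:R * s))).
  apply: le_trans (expR_ge1Dx _); rewrite lerD2l lerN2.
  by move: u2; rewrite /s !mulrA !ler_pdivrMr // (mulrC eta).
have e2 : 8 * expR (- (A%:R * s / 2)) <= eta.
  have As : L * c <= A%:R * s.
    by rewrite /s mulrA ler_pdivlMr // mulrAC ler_wpM2r ?(ltW c0).
  have Lc : L * c = 16 / eta by rewrite /L; field; rewrite !gt_eqF.
  set x := A%:R * s / 2; have hx : 8 / eta <= x by rewrite /x; lra.
  have w0 := expR_gt0 (- x).
  have w1 : expR (- x) * (1 + x) <= 1.
    by have := expR_ge1Dx x; have := expRxMexpNx_1 x; nra.
  have : expR (- x) * (8 / eta) <= 1 by nra.
  by rewrite mulrA ler_pdivrMr // mul1r mulrC.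
have S := double_sqsum_lower A K1 s0.
apply: le_trans (ler_wpM2l (expR_ge0 _) S); rewrite -/Z.
have -> : n%:R = 2 * s ^- 3 * Z * rho :> R.
  by rewrite -(cbrt_cube n) -/u /s /rho; field; rewrite !gt_eqF //; lra.
set T := expR (- (2 * (K1%:R * s))) in e1 *.
set T' := 8 * expR _ in e2 *.
have -> : F * (2 * s ^- 3 * (T - T') * Z) = 2 * s ^- 3 * Z * (F * (T - T')) by ring.
rewrite ler_wpM2l //.
  by rewrite !mulr_ge0 ?invr_ge0 ?exprn_ge0 ?(ltW s0) //; lra.
have rhoE : rho = 1 - 3 * eta by rewrite /eta; field.
have rho0 : 0 < rho by rewrite divr_gt0 //; lra.
apply: (@le_trans _ _ ((1 - eta) * (1 - 2 * eta))); first by nra.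
by apply: ler_pM => //; lra.
Unshelve. all: by end_near. Qed.

End Growth.

(** * Ratios of consecutive counts *)

Section RatioBound.
Variable R : realType.
Local Notation kap := (kap R).
Local Notation u n := (cbrt R n).
Local Notation ratio := (ratio R).

(** Two bounds for the sum of exp(s Y), where Y counts the cells of [Q] with nonzero entry. The
    tangent of exp at the mean of Y, which is the sum of the ratios, gives the left side;
    [tilted_count] and 1 + t <= exp t give the right side. *)
Lemma tilted_ratio n (B t s : R) (Q : pred ('I_n * 'I_n)) : 0 <= s ->
  (forall j, pcountz R n j <= B * expR (- (j%:R * t))) ->
  expR (s * \sum_(x | Q x) ratio n (lev x)) * pcount R n <=
  B * expR ((expR s - 1) * \sum_(x | Q x) expR (- ((lev x)%:R * t))).
Proof.
move=> s0 hB; have z0 : 0 <= expR s - 1 by rewrite subr_ge0 one_le_expR.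
have hB' j : count R n n j <= B * expR (- (j%:R * t)) by rewrite countE.
have := @tilted_count R n n B t (expR s - 1) (enum Q) 0 (leqnn n) z0 hB' (enum_uniq _).
rewrite mul0r oppr0 expR0 mulr1 => h.
set mu := \sum_(x | Q x) ratio n (lev x).
pose Y (m : config n) : R := \sum_(x | Q x) (0 < m x)%N%:R.
have sumY : csum n 0 Y = mu * pcount R n.
  rewrite /Y csum_sum /mu big_distrl /=; apply: eq_bigr => x _.
  transitivity (csum n 0 (fun m : config n => (1 <= m x)%N%:R * (1 : R))).
    by apply: eq_csum => m _; rewrite mulr1.
  rewrite csum_ge // mul1n add0n -[LHS]/(count R n n (lev x)) countE //.
  by rewrite /ratio mulfVK // gt_eqF // pcount_gt0.
have lower : expR (s * mu) * pcount R n <=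
    csum n 0 (fun m : config n => \prod_(x | Q x) (1 + (expR s - 1) * (0 < m x)%N%:R)).
  apply: (@le_trans _ _ (csum n 0 (fun m => expR (s * mu) * ((1 - s * mu) + s * Y m)))).
    rewrite csumZ ler_wpM2l ?expR_ge0 // csumD csumZ sumY.
    have -> : csum n 0 (fun _ : config n => 1 - s * mu) = (1 - s * mu) * pcount R n.
      by rewrite /pcount /count -csumZ; apply: eq_csum => m _; rewrite mulr1.
    by rewrite le_eqVlt; apply/orP; left; apply/eqP; ring.
  apply: le_csum => m _; apply: (@le_trans _ _ (expR (s * mu) * expR (s * Y m - s * mu))).
    rewrite ler_wpM2l ?expR_ge0 //; apply: le_trans (expR_ge1Dx _); lra.
  rewrite -expRD addrC subrK /Y big_distrr /= expR_sum le_eqVlt; apply/orP; left; apply/eqP.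
  apply: eq_bigr => x _; case: (0 < m x)%N; first by rewrite !mulr1; ring.
  by rewrite !mulr0 expR0 addr0.
have hE : csum n 0 (fun m : config n => \prod_(x | Q x) (1 + (expR s - 1) * (0 < m x)%N%:R)) <=
    B * \prod_(x | Q x) (1 + (expR s - 1) * expR (- ((lev x)%:R * t))).
  move: h; rewrite big_enum /=; apply: le_trans; apply: le_csum => m _; by rewrite big_enum.
apply: (le_trans lower); apply: (le_trans hE).
rewrite ler_wpM2l //.
  by have := hB 0%N; rewrite mul0r oppr0 expR0 mulr1; apply: le_trans; exact: pcountz_ge0.
rewrite big_distrr /= expR_sum; apply: ler_prod => x _.
by rewrite addr_ge0 ?mulr_ge0 ?expR_ge0 //= expR_ge1Dx.
Qed.

Lemma expR_le_quad (s : R) : 0 <= s -> s <= 2^-1 -> expR s - 1 <= s + 2 * s ^+ 2.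
Proof.
move=> s0 s1; have := expR_ge1Dx (- s); have := expRxMexpNx_1 s; have := expR_gt0 s.
by nra.
Qed.

Lemma pcountz_upper (c : R) n j : 0 < c -> (0 < n)%N -> forall K, 0 < K ->
  (forall n, pcount R n <= K * expR (3 / 2 * c * u n ^+ 2)) ->
  pcountz R n j <= K * expR (3 / 2 * c * u n ^+ 2) * expR (- (j%:R * (c / u n))).
Proof.
move=> c0 n0 K K0 hK; rewrite /pcountz; case: ifP => jn.
  apply: (le_trans (hK _)); rewrite -[X in _ <= X]mulrA ler_wpM2l ?(ltW K0) //.
  by apply: expR_cbrt_le => //; apply: ltW.
by rewrite !mulr_ge0 ?expR_ge0 ?(ltW K0).
Qed.

Lemma sum_levels_expN n (Q : pred ('I_n * 'I_n)) (s : R) : 0 < s ->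
  (forall x, Q x -> (lev x <= n)%N) ->
  \sum_(x | Q x) expR (- ((lev x)%:R * s)) <= 4 * s ^- 2.
Proof.
move=> s0 Qn.
apply: (@le_trans _ _ (\sum_(x : 'I_n * 'I_n) (lev x <= n)%N%:R * expR (- ((lev x)%:R * s)))).
  rewrite big_mkcond; apply: ler_sum => x _; case: ifP => Qx.
    by rewrite Qn // mul1r.
  by rewrite mulr_ge0 ?expR_ge0.
rewrite (sum_lev (f := fun a => (a <= n)%N%:R * expR (- (a%:R * s)))); last first.
  by move=> a na; rewrite leqNgt na mul0r.
apply: le_trans (_ : _ <= \sum_(1 <= a < n.+1) a%:R ^+ 1 * expR (- (a%:R * s))) _.
  rewrite !big_nat; apply: ler_sum => a /andP[_ an].
  by rewrite -ltnS an mul1r expr1.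
apply: (le_trans (powsum_upper 1 n s0)); rewrite mul1r le_eqVlt; apply/orP; left; apply/eqP.
by congr (_ * _); ring.
Qed.

(** Inserting the weak bounds for [pcount] with rates just above and below kap into [tilted_ratio]
    leaves s (mu - Sg) below three errors: the constant Km Kp, the mismatch of the rates, and the
    quadratic term 2 s^2 Sg, where Sg = O(u^2). With s fixed, each is at most s e u^2 / 3. *)
Lemma ratio_sum_upper (e : R) : 0 < e -> \forall n \near \oo,
  forall Q : pred ('I_n * 'I_n), (forall x, Q x -> (lev x <= n)%N) ->
  \sum_(x | Q x) (ratio n (lev x) - expR (- ((lev x)%:R * (kap / u n)))) <= e * u n ^+ 2.
Proof.
move=> e0; have k0 : 0 < kap := kap_gt0 R.
set C0 : R := 4 / kap ^+ 2; have C00 : 0 < C0 by rewrite divr_gt0 // exprn_gt0.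
set s := Num.min 2^-1 (e / (6 * C0)).
have s0 : 0 < s by rewrite lt_min invr_gt0 ltr0n /= divr_gt0 // mulr_gt0.
have s1 : s <= 2^-1 by rewrite ge_min lexx.
have s2 : 2 * s * C0 <= e / 3.
  have : s <= e / (6 * C0) by rewrite ge_min lexx orbT.
  rewrite ler_pdivlMr; last by rewrite mulr_gt0.
  lra.
set eta := s * e / 3; have eta0 : 0 < eta by rewrite divr_gt0 ?mulr_gt0.
set h := Num.min (eta / 3) (kap / 2).
have h0 : 0 < h by rewrite lt_min; apply/andP; split; lra.
have h1 : h <= eta / 3 by rewrite ge_min lexx.
have h2 : h <= kap / 2 by rewrite ge_min lexx orbT.
have cm0 : 0 < kap - h by lra.
have cp0 : 0 < kap + eta / 3 by lra.
have [Kp Kp0 hKp] : exists2 K, 0 < K & forall n, pcount R n <= K * expR (3 / 2 * (kap + eta / 3) * u n ^+ 2).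
  apply: pcount_upper => //; rewrite -kap_cube ltr_pXn2r ?nnegrE ?(ltW k0) ?(ltW cp0) //; lra.
have [Km Km0 hKm] : exists2 K, 0 < K & forall n, expR (3 / 2 * (kap - h) * u n ^+ 2) <= K * pcount R n.
  apply: pcount_lower => //; rewrite -kap_cube ltr_pXn2r ?nnegrE ?(ltW k0) ?(ltW cm0) //; lra.
near=> n; move=> Q Qn.
have n0 : (0 < n)%N by near: n; exact: nbhs_infty_gt.
have u0 := cbrt_gt0 R n0.
have u1 : 1 <= u n by near: n; exact: cbrt_near.
have u2 : Km * Kp / eta <= u n by near: n; exact: cbrt_near.
have t0 : 0 < (kap + eta / 3) / u n by rewrite divr_gt0.
have tilt := @tilted_ratio n _ _ s Q (ltW s0)
  (fun j => pcountz_upper j cp0 n0 Kp0 hKp).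
set mu := \sum_(x | Q x) ratio n (lev x) in tilt.
set Sg := \sum_(x | Q x) expR (- ((lev x)%:R * ((kap + eta / 3) / u n))) in tilt.
have SgC : Sg <= C0 * u n ^+ 2.
  apply: (le_trans (sum_levels_expN t0 Qn)).
  rewrite /C0 expr_div_n invf_div mulrA mulrAC ler_wpM2r ?sqr_ge0 //.
  rewrite ler_wpM2l // lef_pV2 ?posrE ?exprn_gt0 // ler_pXn2r ?nnegrE ?(ltW k0) ?(ltW cp0) //; lra.
have Sg0 : 0 <= Sg by apply: sumr_ge0 => x _; exact: expR_ge0.
have main : s * mu + 3 / 2 * (kap - h) * u n ^+ 2 <=
    Km * Kp + 3 / 2 * (kap + eta / 3) * u n ^+ 2 + (expR s - 1) * Sg.
  rewrite -ler_expR expRD; apply: (le_trans (ler_wpM2l (expR_ge0 _) (hKm n))).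
  rewrite mulrCA; apply: (le_trans (ler_wpM2l (ltW Km0) tilt)).
  rewrite !expRD !mulrA ler_wpM2r ?expR_ge0 // ler_wpM2r ?expR_ge0 //.
  by apply: le_trans (expR_ge1Dx _); rewrite lerDr.
have zs := expR_le_quad (ltW s0) s1.
have main2 : s * mu <= Km * Kp + eta * u n ^+ 2 + (s + 2 * s ^+ 2) * Sg.
  have := ler_wpM2r Sg0 zs; have := ler_wpM2r (sqr_ge0 (u n)) h1; lra.
have KK : Km * Kp <= eta * u n ^+ 2.
  apply: (@le_trans _ _ (eta * u n)); first by rewrite (mulrC eta) -ler_pdivrMr.
  by rewrite (ler_wpM2l (ltW eta0)) // expr2 ler_peMl // ltW.
have main3 : s * (mu - Sg) <= s * (e * u n ^+ 2).
  have := ler_wpM2l (mulr_ge0 (ler0n R 2) (sqr_ge0 s)) SgC.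
  have : s * (2 * s * C0) * u n ^+ 2 <= s * (e / 3) * u n ^+ 2.
    by rewrite ler_wpM2r ?sqr_ge0 // ler_wpM2l // ltW.
  move: main2 KK; rewrite /eta; lra.
rewrite ler_pM2l // in main3; apply: le_trans main3.
rewrite sumrB lerD2l lerN2; apply: ler_sum => x _.
rewrite ler_expR lerN2 ler_wpM2l // ler_wpM2r ?invr_ge0 ?(ltW u0) //; lra.
Unshelve. all: by end_near. Qed.

Lemma sum_window_ge (g : nat -> R) n m W (c : R) : (2 * W <= m)%N -> (m <= n)%N -> 0 <= c ->
  (forall a, (m - W < a <= m)%N -> c <= g a) ->
  W%:R * c * W%:R <= \sum_(1 <= a < n.+1) a%:R * ((m - W < a <= m)%N%:R * g a).
Proof.
move=> Wm mn c0 cg.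
have c1 : (1 <= (m - W).+1)%N by [].
have c2 : ((m - W).+1 <= n.+1)%N by lia.
have c3 : ((m - W).+1 <= m.+1)%N by lia.
have c4 : (m.+1 <= n.+1)%N by lia.
rewrite (big_cat_nat c1 c2) /= (big_cat_nat c3 c4) /=.
rewrite big_nat_cond [X in _ <= X + _]big1; last first.
  by move=> a ha; rewrite (_ : (m - W < a)%N = false) ?mul0r ?mulr0 //; lia.
rewrite [X in _ <= _ + (_ + X)]big_nat_cond [X in _ <= _ + (_ + X)]big1; last first.
  by move=> a ha; rewrite (_ : (a <= m)%N = false) ?andbF ?mul0r ?mulr0 //; lia.
rewrite add0r addr0.
apply: (@le_trans _ _ (\sum_((m - W).+1 <= a < m.+1) (W%:R * c))).
  rewrite sumr_const_nat (_ : (m.+1 - (m - W).+1 = W)%N); last by lia.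
  by rewrite mulr_natr.
rewrite !big_nat; apply: ler_sum => a ha.
have ha' : (m - W < a <= m)%N by lia.
rewrite ha' mul1r; apply: ler_pM => //; last exact: cg.
by rewrite ler_nat; lia.
Qed.

(** If the bound failed at m, then, the ratios being nonincreasing, it would fail by d/2 on the
    whole window of about d u / (2 kap) levels below m. Such a window contains of order u^2 cells,
    against [ratio_sum_upper]. *)
Lemma ratio_upper (d : R) : 0 < d -> \forall n \near \oo,
  forall m, ratio n m <= expR (- (m%:R * (kap / u n))) + d.
Proof.
move=> d0; have k0 : 0 < kap := kap_gt0 R.
(* With y = d u / (2 kap), the window carries an excess of at least (y/2)^2 (d/2) = 2 e u^2. *)
set e := d ^+ 3 / (64 * kap ^+ 2).
have e0 : 0 < e by rewrite divr_gt0 ?mulr_gt0 ?exprn_gt0.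
near=> n; move=> m; rewrite leNgt; apply/negP => lt.
have n0 : (0 < n)%N by near: n; exact: nbhs_infty_gt.
have u0 := cbrt_gt0 R n0.
have u1 : 4 * kap / d <= u n by near: n; exact: cbrt_near.
have sup : forall Q : pred ('I_n * 'I_n), (forall x, Q x -> (lev x <= n)%N) ->
  \sum_(x | Q x) (ratio n (lev x) - expR (- ((lev x)%:R * (kap / u n)))) <= e * u n ^+ 2.
  by near: n; exact: ratio_sum_upper.
have mn : (m <= n)%N.
  rewrite leqNgt; apply/negP => nm; move: lt; rewrite ratio_out //.
  by have := expR_gt0 (- (m%:R * (kap / u n))); lra.
set t := kap / u n in lt sup *; have t0 : 0 < t by rewrite divr_gt0.
set y := d / (2 * t); have y0 : 0 < y by rewrite divr_gt0 // mulr_gt0.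
have [W [Wy yW]] : exists W : nat, W%:R <= y /\ y - 1 <= W%:R.
  exists (Num.truncn y); split; first by rewrite truncn_le ltW.
  by have := truncnS_gt y; rewrite -natr1; lra.
have yt : 2 * y * t = d by rewrite /y; field; rewrite gt_eqF.
have mW : (2 * W <= m)%N.
  rewrite -(ler_nat R) natrM; have := ratio_le1 R n m.
  have := expR_ge1Dx (- (m%:R * t)) => h1 h2.
  have : d < m%:R * t by lra.
  rewrite -yt ltr_pM2r // => h3; apply: ltW; apply: le_lt_trans h3; lra.
have y2 : 2 <= y.
  have -> : y = d * u n / (2 * kap) by rewrite /y /t; field; rewrite !gt_eqF.
  rewrite ler_pdivlMr; last by rewrite mulr_gt0.
  by move: u1; rewrite ler_pdivrMr //; lra.
have Wy2 : y / 2 <= W%:R by lra.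
pose Q := [pred x : 'I_n * 'I_n | (m - W < lev x <= m)%N].
have := sup Q (fun x Qx => leq_trans (proj2 (andP Qx)) mn).
rewrite leNgt => /negP; apply.
pose f a : R := (m - W < a <= m)%N%:R * (ratio n a - expR (- (a%:R * t))).
have -> : \sum_(x | Q x) (ratio n (lev x) - expR (- ((lev x)%:R * t))) =
    \sum_(x : 'I_n * 'I_n) f (lev x).
  rewrite big_mkcond; apply: eq_bigr => x _; rewrite /f /Q /=.
  by case: ifP; rewrite ?mul1r ?mul0r.
rewrite sum_lev; last first.
  by move=> a na; rewrite /f (leqNgt a) (leq_ltn_trans mn na) andbF mul0r.
have part : W%:R * (d / 2) * W%:R <= \sum_(1 <= a < n.+1) a%:R * f a.
  apply: (sum_window_ge (g := fun a => ratio n a - expR (- (a%:R * t)))) => //.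
    by rewrite divr_ge0 ?(ltW d0).
  move=> a /andP[a1 a2].
  have r1 : ratio n m <= ratio n a by apply: ratio_noninc.
  have ma : m%:R - a%:R <= y.
    by apply: le_trans Wy; rewrite lerBlDr -natrD ler_nat -leq_subLR ltnW.
  have p1 : expR (- (a%:R * t)) * (1 - (m%:R - a%:R) * t) <= expR (- (m%:R * t)).
    have -> : - (m%:R * t) = - (a%:R * t) + - ((m%:R - a%:R) * t) by ring.
    by rewrite expRD ler_wpM2l ?expR_ge0 //; exact: expR_ge1Dx.
  have p2 : expR (- (a%:R * t)) <= 1 by rewrite expR_le1 oppr_le0 mulr_ge0 ?(ltW t0).
  have p3 := expR_ge0 (- (a%:R * t)).
  have ma0 : 0 <= (m%:R - a%:R) * t.
    by rewrite mulr_ge0 ?(ltW t0) // subr_ge0 ler_nat.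
  have mat : (m%:R - a%:R) * t <= d / 2 by rewrite -yt; have := ler_wpM2r (ltW t0) ma; lra.
  have := ler_wpM2r ma0 p2; lra.
apply: lt_le_trans part.
apply: (@lt_le_trans _ _ (y / 2 * (d / 2) * (y / 2))); last first.
  apply: ler_pM => //.
  - by apply: mulr_ge0; lra.
  - by lra.
  - by apply: ler_wpM2r => //; lra.
have -> : y / 2 * (d / 2) * (y / 2) = 2 * (e * u n ^+ 2).
  by rewrite /y /e /t; field; rewrite !gt_eqF.
have E0 : 0 < e * u n ^+ 2 by apply: mulr_gt0 => //; exact: exprn_gt0.
lra.
Unshelve. all: by end_near. Qed.

End RatioBound.

(** * Exponential decay of the ratios *)

Section RatioAsymptotics.
Variable R : realType.
Local Notation kap := (kap R).
Local Notation u n := (cbrt R n).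
Local Notation ratio := (ratio R).

Lemma expRN_le (x : R) : 0 <= x -> expR (- x) * (1 + x) <= 1.
Proof. by move=> x0; have := expR_ge1Dx x; have := expRxMexpNx_1 x; have := expR_gt0 (- x); nra. Qed.

Lemma cbrt_ge1 n : (0 < n)%N -> 1 <= u n.
Proof.
move=> n0; rewrite -(@ler_pXn2r _ 3) ?nnegrE ?cbrt_ge0 // cbrt_cube expr1n.
by rewrite ler1n.
Qed.

Lemma ratio_half : exists N0 (K0 : R), 0 < K0 /\
  forall n m, (N0 <= n)%N -> (0 < n)%N -> K0 * u n <= m%:R -> ratio n m <= 2^-1.
Proof.
have q0 : 0 < 4^-1 :> R by lra.
have [N0 _ hN] := ratio_upper q0; have k0 := kap_gt0 R.
exists N0, (4 / kap); split; first by rewrite divr_gt0.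
move=> n m nN n0 hm; apply: (le_trans (hN n nN m)).
have u0 := cbrt_gt0 R n0.
have x4 : 4 <= m%:R * (kap / u n).
  rewrite mulrA ler_pdivlMr //; move: hm; rewrite mulrAC ler_pdivrMr //.
have := @expRN_le (m%:R * (kap / u n)) ltac:(lra).
by have := expR_gt0 (- (m%:R * (kap / u n))); nra.
Qed.

(** Iterates [ratio_half] along the product formula [ratioD]: every w of order u halves the
    ratio. *)
Lemma ratio_decay : exists C c : R, [/\ 0 < C, 0 < c & forall n m, (0 < n)%N ->
  ratio n m <= C * expR (- (m%:R * (c / u n)))].
Proof.
have [N0 [K0 [K00 half]]] := ratio_half.
exists (2 * expR N0%:R), (2 * (K0 + 1))^-1; split.
- by rewrite mulr_gt0 ?expR_gt0.
- by rewrite invr_gt0 mulr_gt0 //; lra.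
move=> n m n0; have u0 := cbrt_gt0 R n0; have u1 := cbrt_ge1 n0.
have [w [w0 [wK wU]]] : exists w : nat, (0 < w)%N /\ K0 * u n <= w%:R /\ w%:R <= (K0 + 1) * u n.
  have Ku : 0 <= K0 * u n by rewrite mulr_ge0 ?(ltW K00) ?(ltW u0).
  exists (Num.truncn (K0 * u n)).+1; split => //; split; first by rewrite ltW // truncnS_gt.
  rewrite -natr1; have : (Num.truncn (K0 * u n))%:R <= K0 * u n by rewrite truncn_le.
  lra.
have wR : 1 <= w%:R :> R by rewrite ler1n.
have [lam [lam0 lamw]] : exists lam : R, 0 < lam /\ lam * w%:R = 2^-1.
  exists (2 * w%:R)^-1; split; first by rewrite invr_gt0; lra.
  by field; rewrite gt_eqF //; lra.
have lam1 : lam <= 1 by nra.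
(* The same w serves every n' <= n, whose cube root is smaller, so w can be removed repeatedly. Once
   n' is below N0 only m <= N0 matter, which the factor exp(lam N0) covers. *)
have claim n' : (n' <= n)%N -> forall m, ratio n' m <=
    2 * expR (lam * N0%:R) * expR (- (m%:R * lam)).
  elim/ltn_ind: n' => n' IH n'n {}m.
  have E1 : 1 <= expR (lam * N0%:R) by rewrite one_le_expR // mulr_ge0 ?(ltW lam0).
  have E2 := expR_gt0 (- (m%:R * lam)).
  have [nm|mn] := ltnP n' m; first by rewrite ratio_out // !mulr_ge0 ?expR_ge0.
  have [mw|wm] := leqP m w.
    apply: le_trans (ratio_le1 _ _ _) _.
    have mw' : m%:R <= w%:R :> R by rewrite ler_nat.
    have : 2^-1 <= expR (- (m%:R * lam)) by have := expR_ge1Dx (- (m%:R * lam)); nra.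
    by nra.
  have [n'N|Nn'] := ltnP n' N0.
    apply: le_trans (ratio_le1 _ _ _) _; rewrite -mulrA -expRD.
    have : 1 <= expR (lam * N0%:R + - (m%:R * lam)).
      apply: one_le_expR; have : m%:R <= N0%:R :> R by rewrite ler_nat (leq_trans mn) // ltnW.
      by nra.
    by lra.
  have wn' : (w <= n')%N by rewrite (leq_trans (ltnW wm)).
  have n'0 : (0 < n')%N by rewrite (leq_trans w0).
  rewrite -(subnKC (ltnW wm)) ratioD //.
  have h1 : ratio n' w <= 2^-1.
    by apply: half => //; apply: le_trans wK; rewrite ler_wpM2l ?(ltW K00) ?cbrt_le.
  have h2 := IH (n' - w)%N ltac:(by rewrite ltn_subrL w0 n'0) (leq_trans (leq_subr _ _) n'n) (m - w)%N.
  apply: (le_trans (ler_pM (ratio_ge0 _ _ _) (ratio_ge0 _ _ _) h1 h2)).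
  have -> : (w + (m - w))%N%:R * lam = 2^-1 + (m - w)%N%:R * lam.
    by rewrite natrD [LHS]mulrDl (mulrC w%:R) lamw.
  rewrite opprD expRD.
  have : 2^-1 <= expR (- 2^-1) :> R by have := @expR_ge1Dx R (- 2^-1); lra.
  have := mulr_ge0 (expR_ge0 (lam * N0%:R)) (expR_ge0 (- ((m - w)%N%:R * lam))).
  nra.
apply: (le_trans (claim n (leqnn n) m)); apply: ler_pM; rewrite ?mulr_ge0 ?expR_ge0 //.
  by rewrite ler_wpM2l // ler_expR; have : 0 <= N0%:R :> R by []; nra.
rewrite ler_expR lerN2 ler_wpM2l //.
have -> : lam = (2 * w%:R)^-1 by rewrite invfM -lamw mulfK // gt_eqF //; lra.
by rewrite -invfM lef_pV2 ?posrE; lra.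
Qed.

(** The excess over the first exponential is at most e^2 / C by [ratio_upper] and at most C exp(-c m
    / u) by [ratio_decay]; the geometric mean of the two bounds is small and decays. Taking c1 <=
    kap makes the second exponential dominate the first. *)
Lemma ratio_upper_expN : exists2 c1 : R, 0 < c1 <= kap &
  forall e, 0 < e -> \forall n \near \oo, forall m,
    ratio n m <= expR (- (m%:R * (kap / u n))) + e * expR (- (m%:R * (c1 / u n))).
Proof.
have [C [c [C0 c0 hC]]] := ratio_decay; have k0 := kap_gt0 R.
exists (Num.min (c / 2) kap).
  by rewrite lt_min k0 divr_gt0 //= ge_min lexx orbT.
move=> e e0; have d0 : 0 < e ^+ 2 / C by rewrite divr_gt0 ?exprn_gt0.
near=> n; move=> m.
have n0 : (0 < n)%N by near: n; exact: nbhs_infty_gt.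
have u0 := cbrt_gt0 R n0.
have h1 : forall m, ratio n m <= expR (- (m%:R * (kap / u n))) + e ^+ 2 / C.
  by near: n; exact: ratio_upper.
rewrite -lerBlDl; set x := ratio n m - _.
have x1 : x <= e ^+ 2 / C by rewrite lerBlDl; exact: h1.
have x2 : x <= C * expR (- (m%:R * (c / u n))).
  by apply: le_trans (hC n m n0); rewrite /x gerBl expR_ge0.
have cm : Num.min (c / 2) kap <= c / 2 by rewrite ge_min lexx.
apply: (@le_trans _ _ (e * expR (- (m%:R * (c / 2 / u n))))); last first.
  rewrite ler_wpM2l ?(ltW e0) // ler_expR lerN2 ler_wpM2l //.
  by rewrite ler_wpM2r ?invr_ge0 ?(ltW u0).
have [xn|xp] := lerP x 0; first by apply: (le_trans xn); rewrite mulr_ge0 ?expR_ge0 ?(ltW e0).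
rewrite -(@ler_pXn2r _ 2) ?nnegrE ?(ltW xp) ?mulr_ge0 ?expR_ge0 ?(ltW e0) //.
have -> : (e * expR (- (m%:R * (c / 2 / u n)))) ^+ 2 = e ^+ 2 / C * (C * expR (- (m%:R * (c / u n)))).
  rewrite [RHS]mulrA mulfVK ?gt_eqF // exprMn -expRM_natl.
  by congr (_ * expR _); field; rewrite gt_eqF.
by rewrite expr2; apply: ler_pM => //; exact: ltW.
Unshelve. all: by end_near. Qed.

End RatioAsymptotics.

(** * The cubic sum of the ratios *)

Section WeightedRatioSums.
Variable R : realType.
Local Notation kap := (kap R).
Local Notation u n := (cbrt R n).
Local Notation ratio := (ratio R).

Definition cubesum n (f : nat -> R) :=
  \sum_(1 <= a < n.+1) \sum_(1 <= k < n.+1) k%:R * (a%:R ^+ 3 - a%:R) * f (k * a)%N.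

Lemma cube_sub_ge0 (a : nat) : 0 <= a%:R ^+ 3 - a%:R :> R.
Proof. by rewrite cube_bin mulr_ge0. Qed.

Lemma cubesum_expN_upper n (c : R) : 0 < c -> (0 < n)%N ->
  cubesum n (fun m => expR (- (m%:R * (c / u n)))) <= 6 * zeta3 / c ^+ 4 * u n ^+ 4.
Proof.
move=> c0 n0; have u0 := cbrt_gt0 R n0.
apply: (le_trans (double_cubesum_upper n (divr_gt0 c0 u0))).
by rewrite expr_div_n invf_div mulrA mulrAC.
Qed.

(** The constant is 6 zeta(3) / kap^4 = 3 / kap. *)
Lemma cubesum_expN_lower (e : R) : 0 < e -> \forall n \near \oo,
  (3 / kap - e) * u n ^+ 4 <= cubesum n (fun m => expR (- (m%:R * (kap / u n)))).
Proof.
move=> e0; have k0 := kap_gt0 R; have k40 : 0 < kap ^+ 4 by rewrite exprn_gt0.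
have e10 : 0 < kap ^+ 4 * e / 12 by rewrite divr_gt0 ?mulr_gt0.
have [K hK] := zsum_approx e10.
have K2 : zsum R K <= 2 := zsum_ub R K.
have [eta [eta0 etaE]] : exists eta : R, 0 < eta /\ eta = kap ^+ 4 * e / 24.
  by eexists; split; last reflexivity; rewrite divr_gt0 ?mulr_gt0.
near=> n.
have n0 : (0 < n)%N by near: n; exact: nbhs_infty_gt.
have u0 := cbrt_gt0 R n0; have u1 := cbrt_ge1 R n0.
have u2 : 6 * K%:R * kap / eta <= u n by near: n; exact: cbrt_near.
have u3 : 64 / (kap * eta) <= u n by near: n; exact: cbrt_near.
have nK : (K <= n)%N by near: n; exact: nbhs_infty_ge.
have s0 : 0 < kap / u n by rewrite divr_gt0.
have low := double_cubesum_lower n K s0; set s := kap / u n in s0 low *.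
have f0 a k : 0 <= k%:R * (a%:R ^+ 3 - a%:R) * expR (- ((k * a)%N%:R * s)).
  by rewrite !mulr_ge0 ?expR_ge0 ?cube_sub_ge0.
apply: le_trans (double_sum_restrict f0 (leqnn n) (leqW nK)).
apply: le_trans low.
have -> : 6 * s ^- 4 = 6 / kap ^+ 4 * u n ^+ 4.
  by rewrite /s expr_div_n invf_div mulrA mulrAC.
have E1 : 1 - eta / 2 <= expR (- (3 * (K%:R * s))).
  apply: le_trans (expR_ge1Dx _); rewrite lerD2l lerN2.
  by move: u2; rewrite /s !mulrA !ler_pdivrMr //; lra.
have E2 : 16 * expR (- (n%:R * s / 2)) <= eta / 2.
  have x1 : 32 / eta <= n%:R * s / 2.
    rewrite -(cbrt_cube R n) /s.
    have -> : u n ^+ 3 * (kap / u n) / 2 = kap * u n ^+ 2 / 2 by field; rewrite gt_eqF.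
    have h3 : 64 / eta <= kap * u n.
      have -> : 64 / eta = kap * (64 / (kap * eta)) by field; rewrite !gt_eqF.
      by rewrite ler_wpM2l // ltW.
    have : kap * u n <= kap * u n ^+ 2 by rewrite ler_wpM2l ?(ltW k0) // expr2 ler_peMl // ltW.
    have -> : 32 / eta = (64 / eta) / 2 by field; rewrite gt_eqF.
    lra.
  have e320 : 0 < 32 / eta by rewrite divr_gt0.
  have := @expRN_le R (n%:R * s / 2) ltac:(lra).
  have w0 := expR_gt0 (- (n%:R * s / 2)); move=> h4.
  have : expR (- (n%:R * s / 2)) * (32 / eta) <= 1 by nra.
  by rewrite mulrA ler_pdivrMr // mul1r; lra.
have main : zeta3 - kap ^+ 4 * e / 12 - 2 * eta <=
   (expR (- (3 * (K%:R * s))) - 16 * expR (- (n%:R * s / 2))) * zsum R K.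
  have Z0 : 0 <= zsum R K by apply: sumr_ge0 => k _; rewrite invr_ge0 exprn_ge0.
  have : (1 - eta) * zsum R K <= (expR (- (3 * (K%:R * s))) - 16 * expR (- (n%:R * s / 2))) * zsum R K.
    by rewrite ler_wpM2r //; lra.
  have := ler_wpM2l (ltW eta0) K2; lra.
have -> : (3 / kap - e) * u n ^+ 4 = 6 / kap ^+ 4 * u n ^+ 4 * (zeta3 - kap ^+ 4 * e / 12 - 2 * eta).
  have z : zeta3 = kap ^+ 3 / 2 by rewrite kap_cube; field.
  by rewrite etaE z; field; rewrite gt_eqF.
rewrite -[X in _ <= X]mulrA ler_wpM2l //.
by rewrite !mulr_ge0 ?invr_ge0 ?exprn_ge0 ?(ltW k0) ?(ltW u0).
Unshelve. all: by end_near. Qed.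

(** The defect y = p - ratio + ep q is nonnegative, and the exact recursion makes its sum against
    a^2 small compared with u^3. It remains to pass from the weight a^2 to k a^3, which is larger by
    the factor k a of order u. *)
Lemma cubesum_ratio_lower (e : R) : 0 < e -> \forall n \near \oo,
  (3 / kap - e) * u n ^+ 4 <= cubesum n (ratio n).
Proof.
move=> e0; have k0 := kap_gt0 R.
have [c1 /andP[c10 c1k] hr] := ratio_upper_expN R.
have [C2 [C20 C2E]] : exists C2 : R, 0 < C2 /\ C2 = (2`!)%:R * 2 ^+ 3 * zeta3 / c1 ^+ 3.
  eexists; split; last reflexivity.
  by rewrite !mulr_gt0 ?invr_gt0 ?exprn_gt0 ?ltr0n ?fact_gt0 // (lt_le_trans ltr01) // zeta3_ge1.
have [C4 [C40 C4E]] : exists C4 : R, 0 < C4 /\ C4 = (4`!)%:R * 2 ^+ 5 * zeta3 / c1 ^+ 5.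
  eexists; split; last reflexivity.
  by rewrite !mulr_gt0 ?invr_gt0 ?exprn_gt0 ?ltr0n ?fact_gt0 // (lt_le_trans ltr01) // zeta3_ge1.
(* First L is taken large enough for the quartic sum, divided by L u, to cost e/6; then ep small
   enough for L u times the mass to cost e/6. The remaining e/6 is for the lower-order term of the
   mass. *)
have [L [L0 LE]] : exists L : R, 0 < L /\ 2 * C4 = e / 6 * L.
  exists (12 * C4 / e); split; first by rewrite divr_gt0 ?mulr_gt0.
  by field; rewrite gt_eqF.
have [ep [ep0 ep1 epE]] : exists ep : R, [/\ 0 < ep, ep <= 1 & ep * (L * C2) <= e / 6].
  have LC0 : 0 < 6 * (L * C2) by rewrite !mulr_gt0.
  exists (Num.min 1 (e / (6 * (L * C2)))); split.
  - by rewrite lt_min ltr01 divr_gt0.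
  - by rewrite ge_min lexx.
  have : Num.min 1 (e / (6 * (L * C2))) <= e / (6 * (L * C2)) by rewrite ge_min lexx orbT.
  by rewrite ler_pdivlMr //; lra.
have e2 : 0 < e / 2 by lra.
near=> n.
have n0 : (0 < n)%N by near: n; exact: nbhs_infty_gt.
have u0 := cbrt_gt0 R n0; have u1 := cbrt_ge1 R n0.
have u2 : 12 * L / (kap ^+ 2 * e) <= u n by near: n; exact: cbrt_near.
have rub : forall m, ratio n m <= expR (- (m%:R * (kap / u n))) + ep * expR (- (m%:R * (c1 / u n))).
  by near: n; exact: hr.
have low : (3 / kap - e / 2) * u n ^+ 4 <= cubesum n (fun m => expR (- (m%:R * (kap / u n)))).
  by near: n; exact: cubesum_expN_lower.
pose p m : R := expR (- (m%:R * (kap / u n))).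
pose q m : R := expR (- (m%:R * (c1 / u n))).
pose y m : R := p m - ratio n m + ep * q m.
have pq m : p m <= q m.
  by rewrite ler_expR lerN2 ler_wpM2l // ler_wpM2r // invr_ge0 ltW.
have q0 m : 0 <= q m := expR_ge0 _.
have y0 m : 0 <= y m by have := rub m; rewrite -/(p m) -/(q m) /y; lra.
have yq m : y m <= 2 * q m.
  have := ratio_ge0 R n m; have := pq m; have := q0 m; rewrite /y; nra.
have s0 : 0 < kap / u n by rewrite divr_gt0.
have c10' : 0 < c1 / u n by rewrite divr_gt0.
(* The exact recursion n = sum a^2 ratio n (ka) bounds the mass of y. *)
have mass : \sum_(1 <= a < n.+1) \sum_(1 <= k < n.+1) a%:R ^+ 2 * y (k * a)%N <=
    2 / kap ^+ 2 * u n ^+ 2 + ep * C2 * u n ^+ 3.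
  have -> : \sum_(1 <= a < n.+1) \sum_(1 <= k < n.+1) a%:R ^+ 2 * y (k * a)%N =
    \sum_(1 <= a < n.+1) \sum_(1 <= k < n.+1) a%:R ^+ 2 * p (k * a)%N - n%:R +
    ep * \sum_(1 <= a < n.+1) \sum_(1 <= k < n.+1) a%:R ^+ 2 * q (k * a)%N.
    rewrite (ratio_rec R (leqnn n)) big_distrr -sumrB -big_split /=; apply: eq_bigr => a _.
    rewrite big_distrr -sumrB -big_split /=; apply: eq_bigr => k _.
    by rewrite /y; ring.
  apply: lerD.
    have := double_sqsum_upper n s0; rewrite -/p -(cbrt_cube R n) => h.
    rewrite lerBlDr; apply: (le_trans h).
    rewrite le_eqVlt; apply/orP; left; apply/eqP.
    by rewrite -kap_cube; field; rewrite !gt_eqF.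
  rewrite -mulrA ler_wpM2l ?(ltW ep0) //.
  apply: le_trans (_ : _ <= (2`!)%:R * 2 ^+ 3 * zeta3 * (c1 / u n) ^- 3) _.
    apply: le_trans (double_powsum_upper 0 n c10').
    by apply: ler_sum => a _; apply: ler_sum => k _; rewrite expr0 mul1r.
  by rewrite C2E expr_div_n invf_div mulrA mulrAC.
have mass4 : \sum_(1 <= a < n.+1) \sum_(1 <= k < n.+1) k%:R ^+ 2 * a%:R ^+ 4 * y (k * a)%N <=
    2 * C4 * u n ^+ 5.
  apply: (@le_trans _ _ (2 * \sum_(1 <= a < n.+1) \sum_(1 <= k < n.+1)
     k%:R ^+ 2 * a%:R ^+ 4 * q (k * a)%N)).
    rewrite big_distrr; apply: ler_sum => a _ /=; rewrite big_distrr; apply: ler_sum => k _ /=.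
    by rewrite [X in _ <= X]mulrCA ler_wpM2l // mulr_ge0 ?exprn_ge0.
  rewrite -mulrA ler_wpM2l //; apply: (le_trans (double_powsum_upper 2 n c10')).
  by rewrite C4E expr_div_n invf_div mulrA mulrAC.
have diff : cubesum n p - cubesum n (ratio n) <= e / 2 * u n ^+ 4.
  (* Uses k a <= L u + (k a)^2 / (L u): where k a is of order u the defect is charged to its mass,
     and beyond that to the quartic sum. *)
  apply: (@le_trans _ _ (L * u n * (\sum_(1 <= a < n.+1) \sum_(1 <= k < n.+1) a%:R ^+ 2 * y (k * a)%N) +
     (L * u n)^-1 * \sum_(1 <= a < n.+1) \sum_(1 <= k < n.+1) k%:R ^+ 2 * a%:R ^+ 4 * y (k * a)%N)).
    rewrite !big_distrr -sumrB -big_split /=; apply: ler_sum => a _.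
    rewrite !big_distrr -sumrB -big_split /=; apply: ler_sum => k _.
    have a0 : 0 <= a%:R :> R by []. have k0' : 0 <= k%:R :> R by [].
    apply: (@le_trans _ _ (k%:R * a%:R ^+ 3 * y (k * a)%N)).
      rewrite -mulrBr -[X in X <= _]mulrA -[X in _ <= X]mulrA ler_wpM2l //.
      have h1 : p (k * a)%N - ratio n (k * a)%N <= y (k * a)%N.
        by rewrite /y lerDl mulr_ge0 ?(ltW ep0).
      apply: (le_trans (ler_wpM2l (cube_sub_ge0 a) h1)).
      by rewrite ler_wpM2r // gerBl.
    have Lu : 0 < L * u n by rewrite mulr_gt0.
    have -> : L * u n * (a%:R ^+ 2 * y (k * a)%N) + (L * u n)^-1 * (k%:R ^+ 2 * a%:R ^+ 4 * y (k * a)%N) =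
      (L * u n)^-1 * a%:R ^+ 2 * ((L * u n) ^+ 2 + (k%:R * a%:R) ^+ 2) * y (k * a)%N.
      by field; rewrite !gt_eqF.
    rewrite ler_wpM2r //.
    have -> : k%:R * a%:R ^+ 3 = (L * u n)^-1 * a%:R ^+ 2 * ((L * u n) * (k%:R * a%:R)).
      by field; rewrite !gt_eqF.
    rewrite ler_wpM2l ?mulr_ge0 ?invr_ge0 ?exprn_ge0 ?(ltW Lu) //.
    have := sqr_ge0 (L * u n - k%:R * a%:R).
    have := mulr_ge0 (ltW Lu) (mulr_ge0 k0' a0).
    set X := L * u n; set Y := k%:R * a%:R; nra.
  have Lu : 0 < L * u n by rewrite mulr_gt0.
  apply: (le_trans (lerD (ler_wpM2l (ltW Lu) mass) (ler_wpM2l (ltW (_ : 0 < (L * u n)^-1)) mass4))).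
    by rewrite invr_gt0.
  have -> : (L * u n)^-1 * (2 * C4 * u n ^+ 5) = e / 6 * u n ^+ 4.
    by rewrite LE; field; rewrite !gt_eqF.
  have h1 : L * u n * (2 / kap ^+ 2 * u n ^+ 2) <= e / 6 * u n ^+ 4.
    have -> : L * u n * (2 / kap ^+ 2 * u n ^+ 2) = (12 * L / (kap ^+ 2 * e)) * (e / 6 * u n ^+ 3).
      by field; rewrite !gt_eqF.
    have -> : e / 6 * u n ^+ 4 = u n * (e / 6 * u n ^+ 3) by ring.
    by rewrite ler_wpM2r // mulr_ge0 ?exprn_ge0 ?(ltW u0) // divr_ge0 // ltW.
  have h2 : L * u n * (ep * C2 * u n ^+ 3) <= e / 6 * u n ^+ 4.
    have -> : L * u n * (ep * C2 * u n ^+ 3) = ep * (L * C2) * u n ^+ 4 by ring.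
    by rewrite ler_wpM2r // exprn_ge0 ?(ltW u0).
  by rewrite mulrDr; lra.
by move: low diff; rewrite -/p; lra.
Unshelve. all: by end_near. Qed.

End WeightedRatioSums.

(** * Moments of the conditional variance *)

Section Moments.
Variable R : realType.
Local Notation kap := (kap R).
Local Notation u n := (cbrt R n).
Local Notation ratio := (ratio R).

Definition upper_cell N (x : 'I_N * 'I_N) := (x.1 < x.2)%N.
Definition tr_cell N (x : 'I_N * 'I_N) : 'I_N * 'I_N := (x.2, x.1).
Definition width N (x : 'I_N * 'I_N) : R := x.1%:R - x.2%:R.
Definition cell_diff N (x : 'I_N * 'I_N) (m : config N) : R := (m x)%:R - (m (tr_cell x))%:R.

Definition sqvar N (m : config N) : R :=
  \sum_(x : 'I_N * 'I_N | upper_cell x) (width x * cell_diff x m) ^+ 2.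
(** Serves twice: for the diagonal terms of the square of [sqvar], and, interpolated with [sqvar],
    for the third moments of the Lindeberg argument. *)
Definition fourvar N (m : config N) : R :=
  \sum_(x : 'I_N * 'I_N | upper_cell x) (width x * cell_diff x m) ^+ 4.

Definition mean n (F : config n -> R) : R := csum n 0 F / pcount R n.

Lemma meanD n (F G : config n -> R) : mean (fun m => F m + G m) = mean F + mean G.
Proof. by rewrite /mean csumD mulrDl. Qed.

Lemma meanZ n c (F : config n -> R) : mean (fun m => c * F m) = c * mean F.
Proof. by rewrite /mean csumZ mulrA. Qed.

Lemma mean_cst n c : mean (fun _ : config n => c) = c.
Proof.
rewrite /mean (_ : csum n 0 (fun _ => c) = c * pcount R n) ?mulfK ?gt_eqF ?pcount_gt0 //.
by rewrite /pcount /count -csumZ; apply: eq_csum => m _; rewrite mulr1.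
Qed.

Lemma le_mean n (F G : config n -> R) : (forall m, F m <= G m) -> mean F <= mean G.
Proof.
move=> FG; rewrite ler_wpM2r ?invr_ge0 ?(ltW (pcount_gt0 _ _)) //.
by apply: le_csum => m _.
Qed.

Lemma eq_mean n (F G : config n -> R) : F =1 G -> mean F = mean G.
Proof. by move=> FG; congr (_ / _); apply: eq_csum. Qed.

Lemma mean_sum n (I : Type) (s : seq I) (Q : pred I) (F : I -> config n -> R) :
  mean (fun m => \sum_(i <- s | Q i) F i m) = \sum_(i <- s | Q i) mean (F i).
Proof. by rewrite /mean csum_sum big_distrl. Qed.

Lemma sum_lev2 N (g : nat -> nat -> R) (f : nat -> R) : (forall a, (N < a)%N -> f a = 0) ->
  \sum_(x : 'I_N * 'I_N) g x.1 x.2 * f (lev x) =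
  \sum_(1 <= a < N.+1) (\sum_(0 <= i < a) g i (a.-1 - i)%N) * f a.
Proof.
move=> f0.
rewrite -(pair_big xpredT xpredT (fun i j : 'I_N => g i j * f (i + j).+1)) /=.
have col (i : 'I_N) : \sum_(j < N) g i j * f (i + j).+1 =
    \sum_(1 <= a < N.+1) (if (i < a)%N then g i (a.-1 - i)%N * f a else 0).
  have iN := ltn_ord i.
  rewrite (@big_cat_nat _ _ _ i.+1) //=; last by rewrite ltnS ltnW.
  rewrite [X in _ = X + _]big_nat_cond [X in _ = X + _]big1 ?add0r; last first.
    by move=> a ha; rewrite (_ : (_ < _)%N = false) //; lia.
  rewrite -{1}(add0n i.+1) big_addn subSS -(big_mkord xpredT (fun j => g i j * f (i + j).+1)).
  rewrite (@big_cat_nat _ _ _ (N - i)) ?leq_subr //= [X in _ + X = _]big_nat_cond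
    [X in _ + X = _]big1 ?addr0; last by move=> j hj; rewrite f0 ?mulr0 //; lia.
  apply: eq_bigr => j _; rewrite addnS ltnS leq_addl /= addnK.
  by rewrite addnC.
rewrite (eq_bigr _ (fun i _ => col i)) exchange_big /= big_nat_cond [RHS]big_nat_cond.
apply: eq_bigr => a ha.
rewrite -big_mkcond /= -(big_mkord (fun i => (i < a)%N) (fun i => g i (a.-1 - i)%N * f a)).
rewrite (@big_cat_nat _ _ _ a) //=; last by lia.
rewrite [X in _ + X = _]big_nat_cond [X in _ + X = _]big1 ?addr0; last by move=> i hi; lia.
rewrite big_nat_cond big_distrl [RHS]big_nat_cond; apply: eq_bigl => i; lia.
Qed.

Lemma sum_sqwidth a (b : R) :
  \sum_(0 <= i < a) (i%:R - (b - i%:R)) ^+ 2 =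
  4 * ((a%:R - 1) * a%:R * (2 * a%:R - 1) / 6) - 4 * b * (a%:R * (a%:R - 1) / 2) + a%:R * b ^+ 2.
Proof.
elim: a => [|a IH]; first by rewrite big_geq //; field.
by rewrite big_nat_recr //= IH -natr1; field.
Qed.

Lemma sum_upper_sqwidth N (f : nat -> R) : (forall a, (N < a)%N -> f a = 0) ->
  \sum_(x : 'I_N * 'I_N | upper_cell x) width x ^+ 2 * f (lev x) =
  \sum_(1 <= a < N.+1) (a%:R ^+ 3 - a%:R) / 6 * f a.
Proof.
move=> f0.
have full : \sum_(x : 'I_N * 'I_N) width x ^+ 2 * f (lev x) =
    \sum_(1 <= a < N.+1) (a%:R ^+ 3 - a%:R) / 3 * f a.
  rewrite (sum_lev2 (fun i j => (i%:R - j%:R) ^+ 2)) // big_nat_cond [RHS]big_nat_cond.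
  apply: eq_bigr => a /andP[/andP[a0 _] _]; congr (_ * _).
  have e : \sum_(0 <= i < a) ((i%:R - (a.-1 - i)%N%:R) ^+ 2 : R) =
      \sum_(0 <= i < a) (i%:R - (a%:R - 1 - i%:R)) ^+ 2.
    rewrite big_nat_cond [RHS]big_nat_cond; apply: eq_bigr => i /andP[/andP[_ ia] _].
    by rewrite natrB ?predn_int -?subn1 ?natrB //; lia.
  by rewrite e sum_sqwidth; field.
have sym : \sum_(x : 'I_N * 'I_N | ~~ upper_cell x) width x ^+ 2 * f (lev x) =
   \sum_(x : 'I_N * 'I_N | upper_cell x) width x ^+ 2 * f (lev x).
  rewrite (reindex_inj (inv_inj (_ : involutive (@tr_cell N)))) /=; last by case.
  rewrite (bigID (fun x : 'I_N * 'I_N => x.1 == x.2)) /= big1 ?add0r; last first.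
    by move=> x /andP[_ /eqP e]; rewrite /width /= e subrr expr0n mul0r.
  apply: eq_big => [x|x _]; first by rewrite /upper_cell /= -leqNgt -(inj_eq val_inj) /= ltn_neqAle andbC.
  by rewrite /width /lev /= addnC; congr (_ * _); ring.
have := full; rewrite (bigID (@upper_cell N)) /= sym => h.
apply: (@mulfI _ 2) => //; rewrite mulr2n mulrDl !mul1r h big_distrr.
by apply: eq_bigr => a _ /=; field.
Qed.

Lemma lev_tr N (x : 'I_N * 'I_N) : lev (tr_cell x) = lev x.
Proof. by rewrite /lev addnC. Qed.

Lemma upper_tr_neq N (x : 'I_N * 'I_N) : upper_cell x -> x != tr_cell x.
Proof.
case: x => i j; rewrite /upper_cell /tr_cell /= xpair_eqE negb_and => ij.
by rewrite -(inj_eq val_inj) /= ltn_eqF.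
Qed.

Lemma mean_sqdiff n (x : 'I_n * 'I_n) : upper_cell x ->
  mean (fun m => cell_diff x m ^+ 2) = \sum_(1 <= k < n.+1) 2 * k%:R * ratio n (k * lev x)%N.
Proof.
move=> ux; rewrite /mean.
have -> : csum n 0 (fun m => cell_diff x m ^+ 2) =
    csum n 0 (fun m => cell_diff x m ^+ 2 * (1 : R)) by apply: eq_csum => m _; rewrite mulr1.
rewrite (@csum_sqdiff R n x (tr_cell x) (upper_tr_neq ux) (esym (lev_tr x)) (fun => 1)) //.
rewrite big_distrl; apply: eq_bigr => k _ /=.
by rewrite add0n -/(count R n n _) countE // /ratio mulrA.
Qed.

Lemma mean_sqvar n : mean (@sqvar n) = 3^-1 * cubesum n (ratio n).
Proof.
rewrite /sqvar mean_sum.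
pose f a : R := \sum_(1 <= k < n.+1) 2 * k%:R * ratio n (k * a)%N.
rewrite (eq_bigr (fun x => width x ^+ 2 * f (lev x))); last first.
  move=> x ux; rewrite /f -mean_sqdiff // -meanZ; apply: eq_mean => m.
  by rewrite exprMn.
rewrite sum_upper_sqwidth; last first.
  move=> a na; rewrite /f big_nat_cond big1 // => k /andP[/andP[k0 _] _].
  by rewrite ratio_out ?mulr0 // (leq_trans na) // leq_pmull.
rewrite /cubesum big_distrr; apply: eq_bigr => a _ /=; rewrite /f !big_distrr /=.
by apply: eq_bigr => k _; field.
Qed.

(** Two distinct upper cells and their transposes are four distinct cells, so [csum_sqdiff] applies
    to each pair in turn. *)
Lemma mean_sqdiff2 n (x y : 'I_n * 'I_n) : upper_cell x -> upper_cell y -> x != y ->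
  mean (fun m => cell_diff x m ^+ 2 * cell_diff y m ^+ 2) =
  \sum_(1 <= k < n.+1) \sum_(1 <= l < n.+1)
    2 * k%:R * (2 * l%:R) * ratio n (k * lev x + l * lev y)%N.
Proof.
move=> ux uy xy; rewrite /mean.
have yx' : y != tr_cell x.
  apply: contraTneq uy => ->; rewrite /upper_cell /= -leqNgt; exact: ltnW.
have xy' : tr_cell y != x.
  by apply: contra yx' => /eqP <-; case: (y) => a b; rewrite /tr_cell /=.
have txy : tr_cell y != tr_cell x.
  by apply: contra xy => /eqP [e1 e2]; rewrite [x]surjective_pairing [y]surjective_pairing e1 e2.
have yx : y != x by rewrite eq_sym.
rewrite (@csum_sqdiff R n x (tr_cell x) (upper_tr_neq ux) (esym (lev_tr x))
  (fun m => cell_diff y m ^+ 2)) //; first last.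
- by move=> m v; rewrite /cell_diff !upd_other.
- by move=> m v; rewrite /cell_diff !upd_other.
rewrite big_distrl; apply: eq_bigr => k _ /=.
have -> : csum n (0 + k * lev x) (fun m => cell_diff y m ^+ 2) =
    csum n (k * lev x) (fun m => cell_diff y m ^+ 2 * (1 : R)).
  by rewrite add0n; apply: eq_csum => m _; rewrite mulr1.
rewrite (@csum_sqdiff R n y (tr_cell y) (upper_tr_neq uy) (esym (lev_tr y)) (fun => 1)) //.
rewrite big_distrr big_distrl; apply: eq_bigr => l _ /=.
rewrite -/(count R n n _) countE // /ratio; ring.
Qed.

Lemma pow4_sub_le (a b : R) : 0 <= a -> 0 <= b -> (a - b) ^+ 4 <= a ^+ 4 + b ^+ 4.
Proof.
move=> a0 b0; wlog ab : a b a0 b0 / b <= a.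
  move=> H; have [/H|/ltW/H] := leP b a; first by apply.
  by move=> /(_ b0 a0); rewrite addrC; congr (_ <= _); ring.
apply: (@le_trans _ _ (a ^+ 4)); last by rewrite lerDl exprn_ge0.
by rewrite ler_pXn2r ?nnegrE ?subr_ge0 // gerBl.
Qed.

Lemma mean_cell_pow4 n (x : 'I_n * 'I_n) :
  mean (fun m => (m x)%:R ^+ 4) <= \sum_(1 <= k < n.+1) 4 * k%:R ^+ 3 * ratio n (k * lev x)%N.
Proof.
rewrite /mean (@csum_cell R n n 0 x (fun v => v%:R ^+ 4)) //; last by rewrite expr0n.
rewrite big_distrl !big_nat; apply: ler_sum => k /andP[k0 _] /=.
rewrite add0n countE // -mulrA ler_wpM2r ?divr_ge0 ?pcountz_ge0 ?(ltW (pcount_gt0 _ _)) //.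
rewrite -[in k%:R ^+ 4](prednK k0) -[in k%:R ^+ 3](prednK k0) -natr1.
have : 0 <= k.-1%:R :> R by [].
move: (k.-1%:R : R) => z z0; have := exprn_ge0 2 z0; have := exprn_ge0 3 z0.
rewrite -subr_ge0 => h3 h2.
have -> : 4 * (z + 1) ^+ 3 - ((z + 1) ^+ 4 - z ^+ 4) = 6 * z ^+ 2 + 8 * z + 3 by ring.
by rewrite !addr_ge0 ?mulr_ge0.
Qed.

(** Only the order of magnitude matters: |i - j| is replaced by the level, and the fourth power of a
    difference by the sum of the two fourth powers. *)
Lemma mean_fourvar n : mean (@fourvar n) <=
  8 * \sum_(1 <= a < n.+1) \sum_(1 <= k < n.+1) k%:R ^+ 3 * a%:R ^+ 5 * ratio n (k * a)%N.
Proof.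
pose f a : R := a%:R ^+ 4 * \sum_(1 <= k < n.+1) 8 * k%:R ^+ 3 * ratio n (k * a)%N.
apply: (@le_trans _ _ (\sum_(x : 'I_n * 'I_n) f (lev x))).
  rewrite /fourvar mean_sum big_mkcond; apply: ler_sum => x _.
  have s0 : 0 <= \sum_(1 <= k < n.+1) 4 * k%:R ^+ 3 * ratio n (k * lev x)%N.
    apply: sumr_ge0 => k _; apply: mulr_ge0; last exact: ratio_ge0.
    by apply: mulr_ge0 => //; exact: exprn_ge0.
  have fE : f (lev x) = (lev x)%:R ^+ 4 * (2 * \sum_(1 <= k < n.+1) 4 * k%:R ^+ 3 * ratio n (k * lev x)%N).
    rewrite /f; congr (_ * _); rewrite big_distrr /=; apply: eq_bigr => k _; ring.
  case: ifP => _; last by rewrite fE; apply: mulr_ge0; [exact: exprn_ge0|exact: mulr_ge0].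
  rewrite (eq_mean (G := fun m => width x ^+ 4 * cell_diff x m ^+ 4)); last first.
    by move=> m; rewrite exprMn.
  rewrite meanZ fE; apply: ler_pM.
  - by rewrite (_ : width x ^+ 4 = (width x ^+ 2) ^+ 2) ?sqr_ge0 // -exprM.
  - rewrite -[X in X <= _](mean_cst n 0); apply: le_mean => m.
    by rewrite (_ : cell_diff x m ^+ 4 = (cell_diff x m ^+ 2) ^+ 2) ?sqr_ge0 // -exprM.
  - rewrite -(ger0_norm (_ : 0 <= width x ^+ 4)); last first.
      by rewrite (_ : width x ^+ 4 = (width x ^+ 2) ^+ 2) ?sqr_ge0 // -exprM.
    rewrite normrX ler_pXn2r ?nnegrE // /width ler_norml.
    have : 0 <= x.1%:R :> R by []. have : 0 <= x.2%:R :> R by [].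
    rewrite /lev -natr1 natrD => h1 h2; apply/andP; split; lra.
  apply: (@le_trans _ _ (mean (fun m : config n => (m x)%:R ^+ 4 + (m (tr_cell x))%:R ^+ 4))).
    by apply: le_mean => m; exact: pow4_sub_le.
  rewrite meanD; have := mean_cell_pow4 x; have := mean_cell_pow4 (tr_cell x).
  by rewrite lev_tr; lra.
rewrite sum_lev; last first.
  move=> a na; rewrite /f big_nat_cond big1 ?mulr0 // => k /andP[/andP[k0 _] _].
  by rewrite ratio_out ?mulr0 // (leq_trans na) // leq_pmull.
rewrite big_distrr le_eqVlt; apply/orP; left; apply/eqP; apply: eq_bigr => a _ /=.
by rewrite /f !big_distrr /=; apply: eq_bigr => k _; ring.
Qed.

End Moments.

(** * Concentration of the conditional variance *)

Section Concentration.
Variable R : realType.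
Local Notation kap := (kap R).
Local Notation u n := (cbrt R n).
Local Notation ratio := (ratio R).

(** The indicator is there for functions [f] that do not vanish beyond n: it removes the incomplete
    antidiagonals of the box. *)
Definition pair_sum n (f : nat -> R) (x : 'I_n * 'I_n) : R :=
  (lev x <= n)%N%:R * \sum_(1 <= k < n.+1) 2 * k%:R * f (k * lev x)%N.

Lemma sum_pair_sum n (f : nat -> R) :
  \sum_(x : 'I_n * 'I_n | upper_cell x) width R x ^+ 2 * pair_sum f x = 3^-1 * cubesum n f.
Proof.
rewrite (@sum_upper_sqwidth R n (fun a => (a <= n)%N%:R * \sum_(1 <= k < n.+1) 2 * k%:R * f (k * a)%N)).
  rewrite /cubesum [RHS]big_distrr /= big_nat [RHS]big_nat; apply: eq_bigr => a ha.
  have -> : (a <= n)%N by lia.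
  by rewrite mul1r !big_distrr /=; apply: eq_bigr => k _; field.
by move=> a na; rewrite leqNgt na mul0r.
Qed.

(** The terms x != y are exact. The diagonal gives [fourvar], and adding nonnegative terms there
    completes the double sum, so that it can be factored. *)
Lemma mean_sqvar_sqr n : mean (fun m : config n => sqvar R m ^+ 2) <=
  \sum_(x : 'I_n * 'I_n | upper_cell x) \sum_(y : 'I_n * 'I_n | upper_cell y)
    width R x ^+ 2 * width R y ^+ 2 * (\sum_(1 <= k < n.+1) \sum_(1 <= l < n.+1)
      2 * k%:R * (2 * l%:R) * ratio n (k * lev x + l * lev y)%N) + mean (@fourvar R n).
Proof.
pose D (x y : 'I_n * 'I_n) : R := \sum_(1 <= k < n.+1) \sum_(1 <= l < n.+1)
      2 * k%:R * (2 * l%:R) * ratio n (k * lev x + l * lev y)%N.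
have D0 x y : 0 <= width R x ^+ 2 * width R y ^+ 2 * D x y.
  apply: mulr_ge0; first by apply: mulr_ge0; exact: sqr_ge0.
  apply: sumr_ge0 => k _; apply: sumr_ge0 => l _; apply: mulr_ge0; last exact: ratio_ge0.
  by apply: mulr_ge0; apply: mulr_ge0.
have e (m : config n) : sqvar R m ^+ 2 = \sum_(x : 'I_n * 'I_n | upper_cell x)
   \sum_(y : 'I_n * 'I_n | upper_cell y)
     width R x ^+ 2 * width R y ^+ 2 * (cell_diff R x m ^+ 2 * cell_diff R y m ^+ 2).
  rewrite expr2 /sqvar big_distrl; apply: eq_bigr => x _; rewrite big_distrr.
  by apply: eq_bigr => y _ /=; rewrite !exprMn; ring.
rewrite (eq_mean e) mean_sum /fourvar mean_sum -big_split /=; apply: ler_sum => x ux.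
rewrite mean_sum (bigD1 x) //= [X in _ <= X + _](bigD1 x) //=.
have -> : mean (fun m : config n => width R x ^+ 2 * width R x ^+ 2 *
    (cell_diff R x m ^+ 2 * cell_diff R x m ^+ 2)) =
  mean (fun m : config n => (width R x * cell_diff R x m) ^+ 4).
  by apply: eq_mean => m; ring.
have h : \sum_(y : 'I_n * 'I_n | upper_cell y && (y != x))
    mean (fun m : config n => width R x ^+ 2 * width R y ^+ 2 *
      (cell_diff R x m ^+ 2 * cell_diff R y m ^+ 2)) =
  \sum_(y : 'I_n * 'I_n | upper_cell y && (y != x)) width R x ^+ 2 * width R y ^+ 2 * D x y.
  by apply: eq_bigr => y /andP[uy yx]; rewrite meanZ mean_sqdiff2 // eq_sym.
have := D0 x x; rewrite h /D; lra.
Qed.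

(** A bound of the ratio at a + b by products decouples the two cells and turns the double sum into
    squares. *)
Lemma mean_sqvar_sqr_upper n (f g : nat -> R) (e : R) : 0 <= e ->
  (forall a b, 0 <= f a /\ 0 <= g a /\
     ratio n (a + b)%N <= f a * f b + e * (g a * g b)) ->
  mean (fun m : config n => sqvar R m ^+ 2) <=
  (3^-1 * cubesum n f) ^+ 2 + e * (3^-1 * cubesum n g) ^+ 2 + mean (@fourvar R n).
Proof.
move=> e0 fg; apply: (le_trans (mean_sqvar_sqr n)); rewrite lerD2r.
rewrite -!sum_pair_sum !expr2 !big_distrl /= big_distrr -big_split /=.
apply: ler_sum => x ux; rewrite !big_distrr -big_split /=; apply: ler_sum => y uy.
have -> : width R x ^+ 2 * pair_sum f x * (width R y ^+ 2 * pair_sum f y) +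
  e * (width R x ^+ 2 * pair_sum g x * (width R y ^+ 2 * pair_sum g y)) =
  width R x ^+ 2 * width R y ^+ 2 * (pair_sum f x * pair_sum f y + e * (pair_sum g x * pair_sum g y)).
  by ring.
apply: ler_wpM2l; first by apply: mulr_ge0; exact: sqr_ge0.
have f0 a : 0 <= f a by have [] := fg a 0%N.
have g0 a : 0 <= g a by have [_ []] := fg a 0%N.
have out (z : 'I_n * 'I_n) : (lev z <= n)%N = false ->
   forall k, (0 < k)%N -> (n < k * lev z)%N.
  by move=> /negbT; rewrite -ltnNge => nz k k0; rewrite (leq_trans nz) // leq_pmull.
have [lx|/negbTE lx] := boolP (lev x <= n)%N; last first.
  rewrite /pair_sum lx !mul0r mulr0 addr0 big_nat big1 // => k /andP[k0 _].
  rewrite big1 // => l _; rewrite ratio_out ?mulr0 //.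
  by rewrite (leq_trans (out x lx k k0)) // leq_addr.
have [ly|/negbTE ly] := boolP (lev y <= n)%N; last first.
  rewrite /pair_sum ly !mul0r !mulr0 addr0 big1 // => k _.
  rewrite big_nat big1 // => l /andP[l0 _]; rewrite ratio_out ?mulr0 //.
  by rewrite (leq_trans (out y ly l l0)) // leq_addl.
rewrite /pair_sum lx ly !mul1r !big_distrl /= big_distrr -big_split /=.
apply: ler_sum => k _; rewrite !big_distrr -big_split /=; apply: ler_sum => l _.
have [_ [_ h]] := fg (k * lev x)%N (l * lev y)%N.
have -> : 2 * k%:R * f (k * lev x)%N * (2 * l%:R * f (l * lev y)%N) +
  e * (2 * k%:R * g (k * lev x)%N * (2 * l%:R * g (l * lev y)%N)) =
  2 * k%:R * (2 * l%:R) * (f (k * lev x)%N * f (l * lev y)%N + e * (g (k * lev x)%N * g (l * lev y)%N)).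
  by ring.
by apply: ler_wpM2l => //; apply: mulr_ge0; apply: mulr_ge0.
Qed.

(** The true order is u^6, against u^8 for the square of the variance. *)
Lemma fourvar_near (e : R) : 0 < e -> \forall n \near \oo,
  mean (@fourvar R n) <= e * u n ^+ 8.
Proof.
move=> e0; have k0 := kap_gt0 R.
have [c1 /andP[c10 c1k] hr] := ratio_upper_expN R.
have [C5 [C50 C5E]] : exists C : R, 0 < C /\ C = (5`!)%:R * 2 ^+ 6 * zeta3 / c1 ^+ 6.
  eexists; split; last reflexivity.
  by rewrite !mulr_gt0 ?invr_gt0 ?exprn_gt0 ?ltr0n ?fact_gt0 // (lt_le_trans ltr01) // zeta3_ge1.
near=> n.
have n0 : (0 < n)%N by near: n; exact: nbhs_infty_gt.
have u0 := cbrt_gt0 R n0; have u1 := cbrt_ge1 R n0.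
have u2 : 16 * C5 / e <= u n by near: n; exact: cbrt_near.
have rub : forall m, ratio n m <= expR (- (m%:R * (kap / u n))) + 1 * expR (- (m%:R * (c1 / u n))).
  by near: n; apply: hr.
have c10' : 0 < c1 / u n by rewrite divr_gt0.
apply: (le_trans (mean_fourvar R n)).
apply: (@le_trans _ _ (16 * C5 * u n ^+ 6)).
  apply: (@le_trans _ _ (8 * (2 * \sum_(1 <= a < n.+1) \sum_(1 <= k < n.+1)
     k%:R ^+ 3 * a%:R ^+ 5 * expR (- ((k * a)%N%:R * (c1 / u n)))))).
    rewrite ler_wpM2l // big_distrr; apply: ler_sum => a _ /=; rewrite big_distrr.
    apply: ler_sum => k _ /=; rewrite [X in _ <= X]mulrCA; apply: ler_wpM2l.
      by apply: mulr_ge0; exact: exprn_ge0.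
    apply: (le_trans (rub _)); rewrite mul1r.
    have : expR (- ((k * a)%N%:R * (kap / u n))) <= expR (- ((k * a)%N%:R * (c1 / u n))).
      by rewrite ler_expR lerN2 ler_wpM2l // ler_wpM2r // invr_ge0 ltW.
    lra.
  have := double_powsum_upper 3 n c10'.
  have -> : (5`!)%:R * 2 ^+ 6 * zeta3 * (c1 / u n) ^- 6 = C5 * u n ^+ 6 :> R.
    by rewrite C5E expr_div_n invf_div mulrA mulrAC.
  lra.
have -> : e * u n ^+ 8 = (e * u n ^+ 2) * u n ^+ 6 by ring.
rewrite ler_wpM2r ?exprn_ge0 ?(ltW u0) //.
rewrite ler_pdivrMr // (mulrC (u n)) in u2; apply: (le_trans u2).
by rewrite (ler_wpM2l (ltW e0)) // expr2 ler_peMl // ltW.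
Unshelve. all: by end_near. Qed.

(** Expanding the square, only an upper bound for the second moment and a lower bound for the first
    are required. The correction to the product bound, [fourvar] and the error in the first moment
    take e/3 each. *)
Lemma sqvar_concentration (e : R) : 0 < e -> \forall n \near \oo,
  mean (fun m : config n => (sqvar R m / u n ^+ 4 - kap^-1) ^+ 2) <= e.
Proof.
move=> e0; have k0 := kap_gt0 R.
have [c1 /andP[c10 c1k] hr] := ratio_upper_expN R.
have z0 : 0 < zeta3 :> R by rewrite (lt_le_trans ltr01) // zeta3_ge1.
have [Cq [Cq0 CqE]] : exists C : R, 0 < C /\ C = 3^-1 * (3`!%:R * 2 ^+ 4 * zeta3 / c1 ^+ 4).
  eexists; split; last reflexivity.
  by rewrite !mulr_gt0 ?invr_gt0 ?exprn_gt0 ?ltr0n ?fact_gt0.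
have Cq20 : 0 < Cq ^+ 2 by rewrite exprn_gt0.
have ep0 : 0 < e / (3 * Cq ^+ 2) by apply: divr_gt0 => //; apply: mulr_gt0.
have e30 : 0 < e / 3 by lra.
have e20 : 0 < e * kap / 2 by apply: divr_gt0 => //; apply: mulr_gt0.
near=> n.
have n0 : (0 < n)%N by near: n; exact: nbhs_infty_gt.
have u0 := cbrt_gt0 R n0; have u1 := cbrt_ge1 R n0.
have rub : forall m, ratio n m <= expR (- (m%:R * (kap / u n))) +
   e / (3 * Cq ^+ 2) * expR (- (m%:R * (c1 / u n))).
  by near: n; exact: hr.
have four : mean (@fourvar R n) <= e / 3 * u n ^+ 8 by near: n; exact: fourvar_near.
have low : (3 / kap - e * kap / 2) * u n ^+ 4 <= cubesum n (ratio n).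
  by near: n; exact: cubesum_ratio_lower.
pose p m : R := expR (- (m%:R * (kap / u n))).
pose q m : R := expR (- (m%:R * (c1 / u n))).
have split_exp (s : R) a b : expR (- ((a + b)%N%:R * s)) = expR (- (a%:R * s)) * expR (- (b%:R * s)).
  by rewrite -expRD natrD [in LHS]mulrDl opprD.
have up := @mean_sqvar_sqr_upper n p q (e / (3 * Cq ^+ 2)) (ltW ep0) _.
have {}up : mean (fun m : config n => sqvar R m ^+ 2) <= (3^-1 * cubesum n p) ^+ 2 +
    e / (3 * Cq ^+ 2) * (3^-1 * cubesum n q) ^+ 2 + mean (@fourvar R n).
  apply: up => a b; split; first exact: expR_ge0.
  by split; [exact: expR_ge0|rewrite /p /q -!split_exp].
have cub_ge0 f : (forall m, 0 <= f m) -> 0 <= 3^-1 * cubesum n f :> R.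
  move=> f0; apply: mulr_ge0 => //; apply: sumr_ge0 => a _; apply: sumr_ge0 => k _.
  by apply: mulr_ge0 => //; apply: mulr_ge0 => //; exact: cube_sub_ge0.
have hp : (3^-1 * cubesum n p) ^+ 2 <= (u n ^+ 4 / kap) ^+ 2.
  rewrite ler_pXn2r ?nnegrE ?divr_ge0 ?exprn_ge0 ?(ltW u0) ?(ltW k0) //; last first.
    by apply: cub_ge0 => m; exact: expR_ge0.
  have := cubesum_expN_upper k0 n0; rewrite -/p => h.
  have -> : u n ^+ 4 / kap = 3^-1 * (6 * zeta3 / kap ^+ 4 * u n ^+ 4).
    have z : zeta3 = kap ^+ 3 / 2 by rewrite kap_cube; field.
    by rewrite z; field; rewrite gt_eqF.
  by rewrite ler_wpM2l.
have hq : (3^-1 * cubesum n q) ^+ 2 <= (Cq * u n ^+ 4) ^+ 2.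
  rewrite ler_pXn2r ?nnegrE //; last 2 first.
  - by apply: cub_ge0 => m; exact: expR_ge0.
  - by apply: mulr_ge0; [exact: ltW|exact/exprn_ge0/ltW].
  have c10' : 0 < c1 / u n by rewrite divr_gt0.
  rewrite CqE -[X in _ <= X]mulrA ler_wpM2l //.
  apply: (@le_trans _ _ (3`!%:R * 2 ^+ 4 * zeta3 * (c1 / u n) ^- 4)).
    apply: le_trans (double_powsum_upper 1 n c10').
    apply: ler_sum => a _; apply: ler_sum => k _; rewrite ler_wpM2r ?expR_ge0 //.
    by rewrite expr1 ler_wpM2l // gerBl.
  by rewrite expr_div_n invf_div mulrA mulrAC.
have -> : mean (fun m : config n => (sqvar R m / u n ^+ 4 - kap^-1) ^+ 2) =
   u n ^- 8 * mean (fun m : config n => sqvar R m ^+ 2) - 2 / (kap * u n ^+ 4) * mean (@sqvar R n) + kap ^- 2.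
  rewrite -meanZ -mulNr -meanZ -[in X in _ + X](@mean_cst R n (kap ^- 2)) -!meanD.
  by apply: eq_mean => m; field; rewrite !gt_eqF.
rewrite mean_sqvar.
have u8 : 0 <= u n ^- 8 by rewrite invr_ge0 exprn_ge0 // ltW.
have h1 : u n ^- 8 * mean (fun m : config n => sqvar R m ^+ 2) <= kap ^- 2 + e / 3 + e / 3.
  apply: le_trans (ler_wpM2l u8 up) _.
  apply: (@le_trans _ _ (u n ^- 8 * ((u n ^+ 4 / kap) ^+ 2 + e / (3 * Cq ^+ 2) * (Cq * u n ^+ 4) ^+ 2 + e / 3 * u n ^+ 8))).
    apply: ler_wpM2l => //; apply: lerD => //; apply: lerD => //.
    by apply: ler_wpM2l => //; exact: ltW.
  rewrite le_eqVlt; apply/orP; left; apply/eqP.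
  by field; rewrite !gt_eqF.
have h2 : 2 / kap ^+ 2 - e / 3 <= 2 / (kap * u n ^+ 4) * (3^-1 * cubesum n (ratio n)).
  have -> : 2 / kap ^+ 2 - e / 3 = 2 / (kap * u n ^+ 4) * (3^-1 * ((3 / kap - e * kap / 2) * u n ^+ 4)).
    by field; rewrite !gt_eqF.
  apply: ler_wpM2l; last by rewrite ler_wpM2l.
  by apply: divr_ge0 => //; apply: mulr_ge0; [exact: ltW|exact/exprn_ge0/ltW].
lra.
Unshelve. all: by end_near. Qed.

End Concentration.

(** * The normal distribution and the heat equation *)

Section NormalDistribution.
Variable R : realType.

(** The identity as a random variable, through which the monotonicity and the limits of [cdf] become
    available for [normal_prob]. *)
Let idR : measurableTypeR R -> R := idfun.

#[local] HB.instance Definition _ :=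
  @isMeasurableFun.Build _ _ _ _ idR (@measurable_id _ _ setT).

Definition ncdf (s y : R) : R := fine (normal_prob 0 s `]-oo, y]).

Lemma ncdfE s y : (ncdf s y)%:E = cdf (P := normal_prob 0 s) (idR : {RV (normal_prob 0 s) >-> R}) y.
Proof.
rewrite /ncdf fineK; last by apply: fin_num_measure; exact: measurable_itv.
by rewrite /cdf /distribution /pushforward preimage_id.
Qed.

Lemma ncdf_ge0 s y : 0 <= ncdf s y.
Proof. by rewrite fine_ge0. Qed.

Lemma ncdf_le1 s y : ncdf s y <= 1.
Proof. by rewrite -lee_fin ncdfE; exact: cdf_le1. Qed.

Lemma ncdf_homo s : {homo ncdf s : x y / x <= y}.
Proof. by move=> x y xy; rewrite -lee_fin !ncdfE; exact: cdf_nondecreasing. Qed.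

Lemma ncdf_cvgy s : ncdf s y @[y --> +oo] --> (1 : R).
Proof.
apply: fine_cvg; rewrite (_ : (fun y => _) = cdf (P := normal_prob 0 s) (idR : {RV (normal_prob 0 s) >-> R})).
  exact: cvg_cdfy1.
apply/funext => y; rewrite -ncdfE /ncdf fineK //.
by apply: fin_num_measure; exact: measurable_itv.
Qed.

Lemma ncdf_cvgNy s : ncdf s y @[y --> -oo] --> (0 : R).
Proof.
apply: fine_cvg; rewrite (_ : (fun y => _) = cdf (P := normal_prob 0 s) (idR : {RV (normal_prob 0 s) >-> R})).
  exact: cvg_cdfNy0.
apply/funext => y; rewrite -ncdfE /ncdf fineK //.
by apply: fin_num_measure; exact: measurable_itv.
Qed.

Lemma is_derive_ncdf (s y : R) : s != 0 -> is_derive y 1 (ncdf s) (normal_pdf 0 s y).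
Proof.
move=> s0.
have int : lebesgue_measure.-integrable [set` Interval -oo%O (BRight (y + 1))]
    (EFin \o normal_pdf 0 s).
  by apply: (integrableS _ _ (@subsetT _ _)) => //; exact: integrable_normal_pdf.
have yy : y < y + 1 by rewrite ltrDl.
have [d1 d2] := continuous_FTC1 yy int (ltNyr _) (@continuous_normal_pdf R 0 s s0 y).
apply: DeriveDef; first exact: d1.
by rewrite -derive1E; exact: d2.
Qed.

(** In place of a change of variables: both sides have the same derivative and the same limit at
    minus infinity. *)
Lemma ncdf_scale (s y : R) : 0 < s -> ncdf s y = ncdf 1 (y / s).
Proof.
move=> s0; have sn0 : s != 0 by rewrite gt_eqF.
pose G z := ncdf s z - ncdf 1 (z / s).
have dG (z : R) : is_derive z 1 G 0.
  have h1 := is_derive_ncdf z sn0.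
  have h2 : is_derive z 1 (fun z : R => z / s) s^-1.
    by apply: is_derive_eq; rewrite /GRing.scale /= mulr1 mulr0 add0r.
  have h3 := @is_derive1_comp R (ncdf 1) (fun z : R => z / s) z _ _
    (is_derive_ncdf (z / s) (oner_neq0 R)) h2.
  apply: (is_derive_eq (is_deriveB h1 h3)).
  rewrite !normal_pdfE ?oner_neq0 // /normal_peak /normal_fun !subr0.
  have -> : Num.sqrt (s ^+ 2 * pi *+ 2) = s * Num.sqrt (1 ^+ 2 * pi *+ 2).
    rewrite expr1n mul1r -mulrnAr sqrtrM ?sqr_ge0 // sqrtr_sqr gtr0_norm //.
  have -> : - (z / s) ^+ 2 / (1 ^+ 2 *+ 2) = - z ^+ 2 / (s ^+ 2 *+ 2).
    by rewrite expr1n -(mulr_natr (s ^+ 2)); field; rewrite gt_eqF.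
  by rewrite invfM; ring.
have cst z w : G z = G w by apply: is_derive_0_is_cst.
have lim0 : G z @[z --> -oo] --> (0 : R).
  rewrite -[X in _ --> X](subr0 0); apply: cvgB; first exact: ncdf_cvgNy.
  apply: (cvg_comp (fun z => z / s) (ncdf 1)) (ncdf_cvgNy 1).
  by apply: gt0_cvgMlNy; [rewrite invr_gt0|exact: cvg_id].
have limc : G z @[z --> -oo] --> G y.
  by rewrite (_ : G = (fun=> G y)); [exact: cvg_cst|apply/funext => z; exact: cst].
have : G y = 0.
  by apply: (cvg_unique _ limc lim0).
by move/eqP; rewrite subr_eq0 => /eqP.
Qed.

End NormalDistribution.

(** * Taylor estimates for the normal distribution function *)

Section HeatStep.
Variable R : realType.
Local Notation Phi := (@ncdf R 1).

Let p : R := normal_peak 1.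
Let g (z : R) : R := p * expR (- (z ^+ 2 / 2)).

Lemma peak1_gt0 : 0 < p. Proof. by apply: normal_peak_gt0; exact: oner_neq0. Qed.

Lemma is_derive_Phi (z : R) : is_derive z 1 Phi (g z).
Proof.
have := is_derive_ncdf z (oner_neq0 R).
rewrite normal_pdfE ?oner_neq0 // /normal_fun subr0 (_ : - z ^+ 2 / _ = - (z ^+ 2 / 2)) //.
by rewrite expr1n mulNr.
Qed.

Lemma is_derive_gauss (z : R) : is_derive z 1 g (- (z * g z)).
Proof.
have h : is_derive z 1 (fun z : R => - (z ^+ 2 / 2)) (- z).
  by apply: is_derive_eq; rewrite /GRing.scale /=; field.
have h2 := @is_derive1_comp R expR (fun z : R => - (z ^+ 2 / 2)) z _ _ (is_derive_expR _) h.
apply: (is_derive_eq (is_deriveZ p h2)).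
by rewrite /g /GRing.scale /=; ring.
Qed.

Lemma is_derive_zgauss (z : R) : is_derive z 1 (fun z => z * g z) ((1 - z ^+ 2) * g z).
Proof.
apply: (is_derive_eq (is_deriveM (is_derive_id _ _) (is_derive_gauss z))).
by rewrite /GRing.scale /=; ring.
Qed.

Lemma expR_sqr_bound (z : R) : 0 <= z -> z * expR (- (z ^+ 2 / 4)) <= 2 /\
  z ^+ 2 * expR (- (z ^+ 2 / 4)) <= 4.
Proof.
move=> z0; have z2 := sqr_ge0 z.
have h := @expRN_le R (z ^+ 2 / 4) ltac:(lra).
have e0 := expR_gt0 (- (z ^+ 2 / 4)).
have h1 := sqr_ge0 (z - 2).
split; last by nra.
have : z <= 2 * (1 + z ^+ 2 / 4) by lra.
nra.
Qed.

(** The Gaussian factor is split into two equal halves, each absorbing one of the powers bounded in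
    [expR_sqr_bound]. *)
Lemma gauss_bounds (z : R) : [/\ `|z * g z| <= 8 * p, `|(1 - z ^+ 2) * g z| <= 8 * p &
  `|z ^+ 3 * g z| <= 8 * p].
Proof.
have p0 := peak1_gt0.
have ge n : `|z ^+ n * g z| = p * (`|z| ^+ n * expR (- (`|z| ^+ 2 / 4)) * expR (- (`|z| ^+ 2 / 4))).
  rewrite /g normrM normrX (ger0_norm (_ : 0 <= p * _)); last first.
    by rewrite mulr_ge0 ?expR_ge0 ?(ltW p0).
  have -> : expR (- (z ^+ 2 / 2)) = expR (- (`|z| ^+ 2 / 4)) * expR (- (`|z| ^+ 2 / 4)).
    by rewrite -expRD real_normK ?num_real //; congr expR; field.
  by ring.
have w0 : 0 <= `|z| by [].
have [h1 h2] := expR_sqr_bound w0.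
have e0 := expR_gt0 (- (`|z| ^+ 2 / 4)).
have e1 : expR (- (`|z| ^+ 2 / 4)) <= 1.
  by rewrite expR_le1 oppr_le0 divr_ge0 ?exprn_ge0.
move: (ge 0%N) (ge 1%N) (ge 2) (ge 3); rewrite !expr0 !expr1 !mul1r.
set w := `|z| in w0 h1 h2 e0 e1 *; set E := expR (- (w ^+ 2 / 4)) in h1 h2 e0 e1 *.
move=> g0 g1 g2 g3.
have a0 : `|g z| <= p by rewrite g0 ger_pMr //; nra.
have a2 : `|z ^+ 2 * g z| <= 4 * p.
  rewrite g2 mulrC ler_wpM2r ?(ltW p0) //.
  have := mulr_ge0 (sqr_ge0 w) (ltW e0); nra.
split.
- rewrite g1 mulrC ler_wpM2r ?(ltW p0) //; have := mulr_ge0 w0 (ltW e0); nra.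
- rewrite mulrBl mul1r; apply: (le_trans (ler_normB _ _)); lra.
rewrite g3 mulrC ler_wpM2r ?(ltW p0) //.
have -> : w ^+ 3 * E * E = (w * E) * (w ^+ 2 * E) by ring.
have := mulr_ge0 w0 (ltW e0); have := mulr_ge0 (sqr_ge0 w) (ltW e0); nra.
Qed.

Lemma lip_bound (f df : R -> R) (M a b : R) : (forall c : R, is_derive c 1 f (df c)) ->
  (forall c, `|df c| <= M) -> `|f b - f a| <= M * `|b - a|.
Proof.
move=> fdf dM; wlog ab : a b / a <= b.
  move=> H; have [/H//|/ltW/H] := leP a b.
  by rewrite distrC (distrC a).
have [c _ ->] := mean_value ab fdf.
by rewrite normrM ler_wpM2r.
Qed.

Lemma shift_derive (f : R -> R) (df w c e : R) : is_derive (w + e * c) 1 f df ->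
  is_derive c 1 (fun h => f (w + e * h)) (df * e).
Proof.
move=> h.
have h2 : is_derive c 1 (fun h : R => w + e * h) e.
  by apply: is_derive_eq; rewrite /GRing.scale /=; ring.
exact: (@is_derive1_comp R f (fun h : R => w + e * h) c _ _ h h2).
Qed.

(** As a function of h, the left side vanishes at 0 with its first derivative, and its second
    derivative is at most 8 p h because z g(z) is Lipschitz; the bound follows by the mean value
    theorem applied twice. *)
Lemma second_difference (w h : R) : 0 <= h ->
  `|2^-1 * Phi (w + -1 * h) + 2^-1 * Phi (w + 1 * h) - Phi w + h ^+ 2 / 2 * (w * g w)| <=
  8 * p * h ^+ 3.
Proof.
move=> h0.
pose T (x : R) := 2^-1 * Phi (w + -1 * x) + 2^-1 * Phi (w + 1 * x) - Phi w + x ^+ 2 / 2 * (w * g w).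
pose H (x : R) := - 2^-1 * g (w + -1 * x) + 2^-1 * g (w + 1 * x) + x * (w * g w).
pose H' (x : R) := 2^-1 * (- ((w + -1 * x) * g (w + -1 * x)) * -1) * -1 +
   2^-1 * (- ((w + 1 * x) * g (w + 1 * x)) * 1) + w * g w.
have dT (c : R) : is_derive c 1 T (H c).
  have d1 := is_deriveZ 2^-1 (shift_derive (e := -1) (is_derive_Phi (w + -1 * c))).
  have d2 := is_deriveZ 2^-1 (shift_derive (e := 1) (is_derive_Phi (w + 1 * c))).
  have d3 : is_derive c 1 (fun x : R => - Phi w + x ^+ 2 / 2 * (w * g w)) (c * (w * g w)).
    by apply: is_derive_eq; rewrite /GRing.scale /=; field.
  have -> : T = (2^-1 \*: (fun x => Phi (w + -1 * x)) + 2^-1 \*: (fun x => Phi (w + 1 * x))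
     + (fun x : R => - Phi w + x ^+ 2 / 2 * (w * g w)))%R.
    by apply/funext => x; rewrite /T /= !fctE /GRing.scale /= addrA.
  apply: (is_derive_eq (is_deriveD (is_deriveD d1 d2) d3)).
  by rewrite /H /GRing.scale /=; ring.
have dH (c : R) : is_derive c 1 H (H' c).
  have d1 := is_deriveZ (- 2^-1) (shift_derive (e := -1) (is_derive_gauss (w + -1 * c))).
  have d2 := is_deriveZ 2^-1 (shift_derive (e := 1) (is_derive_gauss (w + 1 * c))).
  have d3 : is_derive c 1 (fun x : R => x * (w * g w)) (w * g w).
    by apply: is_derive_eq; rewrite /GRing.scale /=; field.
  have -> : H = ((- 2^-1) \*: (fun x => g (w + -1 * x)) + 2^-1 \*: (fun x => g (w + 1 * x))
     + (fun x : R => x * (w * g w)))%R.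
    by apply/funext => x; rewrite /H /= !fctE /GRing.scale /=.
  apply: (is_derive_eq (is_deriveD (is_deriveD d1 d2) d3)).
  by rewrite /H' /GRing.scale /=; ring.
have p0 := peak1_gt0.
have bH' (c : R) : 0 <= c -> `|H' c| <= 8 * p * c.
  move=> c0.
  have l1 := lip_bound w (w + -1 * c) is_derive_zgauss (fun z => let: And3 _ b _ := gauss_bounds z in b).
  have l2 := lip_bound w (w + 1 * c) is_derive_zgauss (fun z => let: And3 _ b _ := gauss_bounds z in b).
  have -> : H' c = - 2^-1 * ((w + -1 * c) * g (w + -1 * c) - w * g w) +
      - 2^-1 * ((w + 1 * c) * g (w + 1 * c) - w * g w) by rewrite /H'; field.
  apply: (le_trans (ler_normD _ _)); rewrite !normrM normrN (ger0_norm (_ : 0 <= 2^-1)) //.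
  have n1 : `|w + -1 * c - w| = c by rewrite (_ : _ - w = - c) ?normrN ?ger0_norm //; ring.
  have n2 : `|w + 1 * c - w| = c by rewrite (_ : _ - w = c) ?ger0_norm //; ring.
  by rewrite n1 in l1; rewrite n2 in l2; lra.
have H0 : H 0 = 0 by rewrite /H !mulr0 !addr0; ring.
have T0 : T 0 = 0 by rewrite /T !mulr0 !addr0; field.
have bH (b : R) : 0 <= b -> `|H b| <= 8 * p * b * b.
  move=> b0; rewrite -[H b]subr0 -H0; apply: mean_value_bound => // c /andP[c0 cb].
  by apply: (le_trans (bH' c c0)); rewrite ler_wpM2l // mulr_ge0 ?(ltW p0).
have := @mean_value_bound R T H (8 * p * h * h) h h0 dT _.
rewrite T0 subr0 => bT; apply: (le_trans (bT _)); last by rewrite le_eqVlt; apply/orP; left; apply/eqP; ring.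
move=> c /andP[c0 ch]; apply: (le_trans (bH c c0)).
by rewrite -!mulrA !ler_wpM2l ?(ltW p0) //; nra.
Qed.

End HeatStep.

(** * One sign change as a step of the heat equation *)

Section HeatStep2.
Variable R : realType.
Local Notation Phi := (@ncdf R 1).

Let p : R := normal_peak 1.
Let g (z : R) : R := p * expR (- (z ^+ 2 / 2)).
Let p0 : 0 < p := peak1_gt0 R.

(** At z = w (1 - c), the second derivative in the dilation parameter is -w^2 z g(z) = -z^3 g(z) /
    (1 - c)^2. It is thus bounded uniformly in w, and the condition on b costs a factor 2. *)
Lemma dilation_difference (w b : R) : 0 <= b -> 2^-1 <= (1 - b) ^+ 2 -> b <= 1 ->
  `|Phi (w + - w * b) - Phi w + b * (w * g w)| <= 16 * p * b ^+ 2.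
Proof.
move=> b0 hb b1.
pose F (x : R) := Phi (w + - w * x) + (- Phi w + x * (w * g w)).
pose Q (x : R) := g (w + - w * x) * - w + w * g w.
pose Q' (x : R) := - ((w + - w * x) * g (w + - w * x)) * - w * - w.
have dF (c : R) : is_derive c 1 F (Q c).
  have d1 := shift_derive (e := - w) (is_derive_Phi (w + - w * c)).
  have d3 : is_derive c 1 (fun x : R => - Phi w + x * (w * g w)) (w * g w).
    by apply: is_derive_eq; rewrite /GRing.scale /=; field.
  exact: is_deriveD d1 d3.
have dQ (c : R) : is_derive c 1 Q (Q' c).
  have d1 := shift_derive (e := - w) (is_derive_gauss (w + - w * c)).
  have d3 : is_derive c 1 (fun x : R => - w * g (w + - w * x) + w * g w) (- w * (- ((w + - w * c) * g (w + - w * c)) * - w)).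
    have -> : (fun x : R => - w * g (w + - w * x) + w * g w) =
      ((- w) \*: (fun x : R => g (w + - w * x)) + (fun=> w * g w))%R.
      by apply/funext => x; rewrite /= !fctE /GRing.scale /=.
    apply: (is_derive_eq (is_deriveD (is_deriveZ (- w) d1) (is_derive_cst _ _ _))).
    by rewrite addr0.
  have -> : Q = (fun x : R => - w * g (w + - w * x) + w * g w).
    by apply/funext => x; rewrite /Q; ring.
  by apply: (is_derive_eq d3); rewrite /Q'; ring.
have bQ' c : 0 <= c <= b -> `|Q' c| <= 16 * p.
  move=> /andP[c0 cb]; set z := w + - w * c.
  have [_ _ h3] := gauss_bounds z; rewrite -/p -/(g z) in h3.
  have c1 : 2^-1 <= (1 - c) ^+ 2 by nra.
  have e : z ^+ 3 * g z = (1 - c) ^+ 2 * - Q' c by rewrite /Q' -/z /z; ring.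
  rewrite e normrM normrN (ger0_norm (sqr_ge0 _)) in h3.
  by have := normr_ge0 (Q' c); nra.
have Q0 : Q 0 = 0 by rewrite /Q mulr0 addr0; ring.
have F0 : F 0 = 0 by rewrite /F mulr0 addr0 mul0r addr0 subrr.
have bQ c : 0 <= c <= b -> `|Q c| <= 16 * p * b.
  move=> /andP[c0 cb]; rewrite -[Q c]subr0 -Q0.
  apply: (le_trans (@mean_value_bound R Q Q' (16 * p) c c0 dQ _)).
    by move=> d /andP[d0 dc]; apply: bQ'; rewrite d0 (le_trans dc).
  by rewrite ler_wpM2l // mulr_ge0 // ltW.
have := @mean_value_bound R F Q (16 * p * b) b b0 dF bQ.
rewrite F0 subr0 /F addrA => h; apply: (le_trans h).
by rewrite expr2 [X in _ <= X]mulrA.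
Qed.

(** The dilation 1/s is 1 - b with b = h^2/2 + O(h^4), so the first-order terms of the two
    expansions cancel. For h >= 1 the left side is at most 1, which accounts for the summand 1 in
    the constant. *)
Lemma heat_step_unit (w h : R) : 0 <= h ->
  `|2^-1 * Phi (w - h) + 2^-1 * Phi (w + h) - Phi (w / Num.sqrt (1 + h ^+ 2))| <=
  (32 * p + 1) * h ^+ 3.
Proof.
move=> h0.
have [h1|h1] := leP 1 h.
  have h3 : 1 <= h ^+ 3 by rewrite exprn_ege1.
  apply: (@le_trans _ _ 1).
    have := @ncdf_ge0 R 1; have := @ncdf_le1 R 1 => l1 l0.
    have := l1 (w - h); have := l1 (w + h); have := l1 (w / Num.sqrt (1 + h ^+ 2)).
    have := l0 (w - h); have := l0 (w + h); have := l0 (w / Num.sqrt (1 + h ^+ 2)).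
    by rewrite ler_norml => *; apply/andP; split; lra.
  by apply: (le_trans h3); rewrite ler_peMl ?(le_trans ler01 h3) // lerDr mulr_ge0 // ltW.
set s := Num.sqrt _.
have hh : h ^+ 2 <= 1 by nra.
have s2 : s ^+ 2 = 1 + h ^+ 2 by rewrite sqr_sqrtr // addr_ge0 // sqr_ge0.
have s0 : 0 <= s by exact: sqrtr_ge0.
have s1 : 1 <= s by rewrite -(@ler_pXn2r _ 2) ?nnegrE // s2 expr1n lerDl sqr_ge0.
have sp : 0 < s by lra.
set b := 1 - s^-1.
have bs : b * s = s - 1 by rewrite /b mulrBl mul1r mulVf ?gt_eqF.
have b0 : 0 <= b by rewrite /b subr_ge0 invf_le1.
have b1 : b <= 1 by rewrite /b gerBl invr_ge0.
have bh : b <= h ^+ 2 by nra.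
have bh2 : `|h ^+ 2 / 2 - b| <= h ^+ 4.
  have -> : h ^+ 4 = (s ^+ 2 - 1) ^+ 2 by rewrite s2; ring.
  have -> : h ^+ 2 / 2 - b = (s - 1) ^+ 2 * (s + 2) / (2 * s).
    have -> : h ^+ 2 = s ^+ 2 - 1 by rewrite s2; ring.
    by rewrite /b; field; rewrite gt_eqF.
  rewrite ger0_norm; last by apply: divr_ge0; [apply: mulr_ge0; [exact: sqr_ge0|lra]|lra].
  rewrite ler_pdivrMr; last by lra.
  have -> : (s ^+ 2 - 1) ^+ 2 * (2 * s) = (s - 1) ^+ 2 * ((s + 1) ^+ 2 * (2 * s)) by ring.
  by rewrite ler_wpM2l ?sqr_ge0 //; nra.
have hb : 2^-1 <= (1 - b) ^+ 2.
  have e : (1 - b) ^+ 2 * s ^+ 2 = 1 by rewrite /b; field; rewrite gt_eqF.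
  by rewrite s2 in e; have := sqr_ge0 (1 - b); nra.
have D := @dilation_difference w b b0 hb b1.
have e1 : w + - w * b = w / s by rewrite /b; field; rewrite gt_eqF.
rewrite e1 in D.
have S := second_difference w h0; rewrite -/p -/(g w) mulN1r mul1r in S.
have [G _ _] := gauss_bounds w; rewrite -/p -/(g w) in G.
have E : `|(h ^+ 2 / 2 - b) * (w * g w)| <= h ^+ 4 * (8 * p).
  by rewrite normrM; apply: ler_pM.
have -> : 2^-1 * Phi (w - h) + 2^-1 * Phi (w + h) - Phi (w / s) =
  (2^-1 * Phi (w - h) + 2^-1 * Phi (w + h) - Phi w + h ^+ 2 / 2 * (w * g w)) -
  (Phi (w / s) - Phi w + b * (w * g w)) - (h ^+ 2 / 2 - b) * (w * g w) by ring.
apply: (le_trans (ler_normB _ _)); apply: (le_trans (lerD (ler_normB _ _) E)).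
have h3 : 0 <= h ^+ 3 by exact: exprn_ge0.
have h43 : h ^+ 4 <= h ^+ 3 by rewrite exprSr ler_piMr // ltW.
have b2 : b ^+ 2 <= h ^+ 4.
  by rewrite (_ : h ^+ 4 = (h ^+ 2) ^+ 2) ?ler_pXn2r ?nnegrE ?sqr_ge0 // -exprM.
have p1 := ltW p0.
have m1 := ler_wpM2l p1 h43; have m2 := ler_wpM2l p1 b2.
lra.
Qed.

(* [Phi (w / sqrt v)] solves the heat equation, so a centred sign change of size h costs
   as much as adding h^2 to the variance, up to third order. *)
Lemma heat_step (v w h : R) : 0 < v ->
  `|2^-1 * Phi ((w - h) / Num.sqrt v) + 2^-1 * Phi ((w + h) / Num.sqrt v) -
    Phi (w / Num.sqrt (v + h ^+ 2))| <= (32 * p + 1) * (`|h| / Num.sqrt v) ^+ 3.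
Proof.
move=> v0; have s0 : 0 < Num.sqrt v by rewrite sqrtr_gt0.
wlog h0 : h / 0 <= h.
  move=> H; have [/H//|/ltW] := leP 0 h; rewrite -oppr_ge0 => /H.
  by rewrite sqrrN normrN opprK (addrC (2^-1 * _)).
have := heat_step_unit (w / Num.sqrt v) (divr_ge0 h0 (ltW s0)).
rewrite -mulrBl -mulrDl (ger0_norm h0).
suff -> : w / Num.sqrt v / Num.sqrt (1 + (h / Num.sqrt v) ^+ 2) = w / Num.sqrt (v + h ^+ 2) by [].
rewrite -mulrA -invfM -sqrtrM ?(ltW v0) //; congr (_ / Num.sqrt _).
by rewrite expr_div_n sqr_sqrtr ?(ltW v0) //; field; rewrite gt_eqF.
Qed.

Lemma Phi_lipschitz (a b : R) : `|Phi b - Phi a| <= p * `|b - a|.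
Proof.
apply: (lip_bound a b (is_derive_Phi (R := R))) => c.
rewrite ger0_norm; last by rewrite mulr_ge0 ?expR_ge0 ?(ltW p0).
by rewrite ger_pMr // expR_le1 oppr_le0 divr_ge0 // sqr_ge0.
Qed.

Lemma Phi_variance_lipschitz (s y a b : R) : 0 < s -> 0 <= a -> 0 <= b ->
  `|Phi (y / Num.sqrt (s ^+ 2 + a)) - Phi (y / Num.sqrt (s ^+ 2 + b))| <=
  p * `|y| / s ^+ 3 * `|a - b|.
Proof.
move=> s0 a0 b0; apply: (le_trans (Phi_lipschitz _ _)).
have s2 : 0 < s ^+ 2 by rewrite exprn_gt0.
set x := Num.sqrt (s ^+ 2 + a); set z := Num.sqrt (s ^+ 2 + b).
have x2 : x ^+ 2 = s ^+ 2 + a by rewrite sqr_sqrtr //; lra.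
have z2 : z ^+ 2 = s ^+ 2 + b by rewrite sqr_sqrtr //; lra.
have xs : s <= x by rewrite -(@ler_pXn2r _ 2) ?nnegrE ?sqrtr_ge0 ?(ltW s0) // x2; lra.
have zs : s <= z by rewrite -(@ler_pXn2r _ 2) ?nnegrE ?sqrtr_ge0 ?(ltW s0) // z2; lra.
have x0 : 0 < x by lra. have z0 : 0 < z by lra.
rewrite -!mulrA ler_wpM2l ?(ltW p0) //.
have -> : y / x - y / z = y * ((b - a) / (x * z * (x + z))).
  have -> : b - a = (z - x) * (z + x) by rewrite -subr_sqr z2 x2; ring.
  by field; rewrite !gt_eqF //= ?addr_gt0.
rewrite normrM ler_wpM2l // normrM distrC mulrC ler_wpM2r //.
rewrite normfV lef_pV2 ?posrE ?normr_gt0 ?exprn_gt0 ?gt_eqF ?mulr_gt0 ?addr_gt0 //.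
rewrite ger0_norm; last by rewrite !mulr_ge0 ?addr_ge0 ?ltW.
have ss : 0 <= s * s by rewrite mulr_ge0 ?(ltW s0).
have xz : s * s <= x * z by apply: ler_pM => //; exact: ltW.
by rewrite exprSr expr2; apply: ler_pM => //; lra.
Qed.

End HeatStep2.

(** * Convergence in law *)

Section Lindeberg.
Variable R : realType.
Local Notation Phi := (@ncdf R 1).
Local Notation kap := (kap R).
Local Notation u n := (cbrt R n).
Local Notation p := (@normal_peak R 1).
Implicit Type n : nat.

Definition swap_tr n (x : 'I_n * 'I_n) (m : config n) : config n := swap x (tr_cell x) m.

Definition incr n (x : 'I_n * 'I_n) (m : config n) : R := width R x * cell_diff R x m / u n ^+ 2.

Lemma mean_swap n (x : 'I_n * 'I_n) (F : config n -> R) : upper_cell x ->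
  mean F = mean (F \o swap_tr x).
Proof.
move=> ux; congr (_ / _).
exact: (@csum_swap R n x (tr_cell x) (upper_tr_neq ux) (esym (lev_tr x)) n 0 F).
Qed.

Lemma incr_swap_same n (x : 'I_n * 'I_n) (m : config n) : upper_cell x ->
  incr x (swap_tr x m) = - incr x m.
Proof.
move=> ux; rewrite /incr /cell_diff /swap_tr swapx ?upper_tr_neq // swapy.
by rewrite -opprB mulrN mulNr.
Qed.

Lemma incr_swap_other n (x y : 'I_n * 'I_n) (m : config n) : upper_cell x -> upper_cell y ->
  y != x -> incr y (swap_tr x m) = incr y m.
Proof.
move=> ux uy yx.
have yx' : y != tr_cell x.
  apply: contraTneq uy => ->; rewrite /upper_cell /= -leqNgt; exact: ltnW.
have ty : tr_cell y != x.
  by apply: contra yx' => /eqP <-; case: (y) => a b; rewrite /tr_cell /=.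
have tt : tr_cell y != tr_cell x.
  by apply: contra yx => /eqP [e1 e2]; rewrite [x]surjective_pairing [y]surjective_pairing e1 e2.
by rewrite /incr /cell_diff /swap_tr !swap_other.
Qed.

Lemma mean_abs_le n (F G H : config n -> R) : (forall m, `|F m - G m| <= H m) ->
  `|mean F - mean G| <= mean H.
Proof.
move=> h; rewrite ler_norml; apply/andP; split.
  rewrite lerNl opprB lerBlDr -meanD; apply: le_mean => m.
  by have := h m; rewrite distrC => h'; have := le_trans (ler_norm _) h'; lra.
rewrite lerBlDr -meanD; apply: le_mean => m.
by have := le_trans (ler_norm _) (h m); lra.
Qed.

(** Pair by pair, an increment is traded for its square in the variance. The exchange at x preserves
    the mean, flips [incr x] and fixes [y], [v] and the other increments; averaging over both signs
    prepares for [heat_step]. Functions [y] and [v] are general because the induction moves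
    increments into them. *)
Lemma lindeberg n (s : R) (S : seq ('I_n * 'I_n)) (v y : config n -> R) : 0 < s ->
  uniq S -> (forall x, x \in S -> upper_cell x) -> (forall m, s ^+ 2 <= v m) ->
  (forall x m, x \in S -> v (swap_tr x m) = v m) ->
  (forall x m, x \in S -> y (swap_tr x m) = y m) ->
  `|mean (fun m => Phi ((y m - \sum_(x <- S) incr x m) / Num.sqrt (v m))) -
    mean (fun m => Phi (y m / Num.sqrt (v m + \sum_(x <- S) incr x m ^+ 2)))| <=
  mean (fun m => \sum_(x <- S) (32 * p + 1) * (`|incr x m| / s) ^+ 3).
Proof.
move=> s0; elim: S v y => [|x S IH] v y.
  move=> _ _ _ _ _.
  rewrite (@eq_mean R n _ (fun m => Phi (y m / Num.sqrt (v m + \sum_(x <- [::]) incr x m ^+ 2)))); last first.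
    by move=> m; rewrite !big_nil subr0 addr0.
  rewrite subrr normr0 -[X in X <= _](@mean_cst R n 0); apply: le_mean => m.
  by rewrite big_nil.
move=> /= /andP[xS uS] upS vs vinv yinv.
have ux : upper_cell x by apply: upS; rewrite mem_head.
have inS z : z \in S -> z \in x :: S by move=> zS; rewrite in_cons zS orbT.
have neq z : z \in S -> x != z by move=> zS; apply: contraNneq xS => ->.
pose y1 m : R := y m - incr x m.
pose v1 m : R := v m + \sum_(z <- S) incr z m ^+ 2.
have y1inv z m : z \in S -> y1 (swap_tr z m) = y1 m.
  by move=> zS; rewrite /y1 yinv ?inS // incr_swap_other ?neq // upS ?inS.
have h1 := IH v y1 uS (fun z zS => upS z (inS z zS)) vs (fun z m zS => vinv z m (inS z zS)) y1inv.
have v1s m : s ^+ 2 <= v1 m.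
  by apply: (le_trans (vs m)); rewrite lerDl; apply: sumr_ge0 => z _; exact: sqr_ge0.
have s20 : 0 < s ^+ 2 by rewrite exprn_gt0.
have h2 : `|mean (fun m => Phi (y1 m / Num.sqrt (v1 m))) -
    mean (fun m => Phi (y m / Num.sqrt (v1 m + incr x m ^+ 2)))| <=
    mean (fun m => (32 * p + 1) * (`|incr x m| / s) ^+ 3).
  have -> : mean (fun m => Phi (y1 m / Num.sqrt (v1 m))) =
     mean (fun m => 2^-1 * Phi ((y m - incr x m) / Num.sqrt (v1 m)) +
        2^-1 * Phi ((y m + incr x m) / Num.sqrt (v1 m))).
    have e : mean (fun m => Phi (y1 m / Num.sqrt (v1 m))) =
        mean (fun m => Phi ((y m + incr x m) / Num.sqrt (v1 m))).
      rewrite (mean_swap _ ux); apply: eq_mean => m /=.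
      have yx := yinv x m (mem_head x S); have vx := vinv x m (mem_head x S).
      rewrite /y1 /v1 yx vx (incr_swap_same m ux) opprK.
      congr (Phi (_ / Num.sqrt (_ + _))); rewrite big_seq [RHS]big_seq; apply: eq_bigr => z zS.
      by rewrite incr_swap_other //; [exact: upS (inS z zS)|rewrite eq_sym neq].
    by rewrite meanD !meanZ -e; field.
  apply: mean_abs_le => m; have v10 : 0 < v1 m by apply: lt_le_trans (v1s m).
  apply: (le_trans (heat_step _ _ v10)).
  have p0 := peak1_gt0 R.
  rewrite ler_wpM2l //; first by lra.
  rewrite ler_pXn2r ?nnegrE ?divr_ge0 ?sqrtr_ge0 ?(ltW s0) //.
  rewrite ler_wpM2l // lef_pV2 ?posrE ?sqrtr_gt0 //.
  by rewrite -(@ler_pXn2r _ 2) ?nnegrE ?sqrtr_ge0 ?(ltW s0) // sqr_sqrtr // ltW.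
have -> : mean (fun m => Phi ((y m - \sum_(z <- x :: S) incr z m) / Num.sqrt (v m))) =
   mean (fun m => Phi ((y1 m - \sum_(z <- S) incr z m) / Num.sqrt (v m))).
  by apply: eq_mean => m; rewrite big_cons /y1 opprD addrA.
have -> : mean (fun m => Phi (y m / Num.sqrt (v m + \sum_(z <- x :: S) incr z m ^+ 2))) =
   mean (fun m => Phi (y m / Num.sqrt (v1 m + incr x m ^+ 2))).
  by apply: eq_mean => m; rewrite big_cons /v1 (addrC (incr x m ^+ 2)) addrA.
have -> : mean (fun m => \sum_(z <- x :: S) (32 * p + 1) * (`|incr z m| / s) ^+ 3) =
   mean (fun m => (32 * p + 1) * (`|incr x m| / s) ^+ 3) +
   mean (fun m => \sum_(z <- S) (32 * p + 1) * (`|incr z m| / s) ^+ 3).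
  by rewrite -meanD; apply: eq_mean => m; rewrite big_cons.
apply: (le_trans (ler_distD (mean (fun m => Phi (y1 m / Num.sqrt (v1 m)))) _ _)).
by rewrite addrC; apply: lerD.
Qed.

Definition shift_stat n (m : config n) : R := \sum_(x : 'I_n * 'I_n) (x.1%:R - x.2%:R) * (m x)%:R.

Lemma sum_incr n (m : config n) :
  \sum_(x <- enum (@upper_cell n)) incr x m = shift_stat m / u n ^+ 2.
Proof.
rewrite /shift_stat [in RHS](bigID (@upper_cell n)) /=.
have -> : \sum_(x : 'I_n * 'I_n | ~~ upper_cell x) (x.1%:R - x.2%:R) * (m x)%:R =
   - \sum_(x : 'I_n * 'I_n | upper_cell x) (x.1%:R - x.2%:R) * (m (tr_cell x))%:R :> R.
  rewrite (reindex_inj (inv_inj (_ : involutive (@tr_cell n)))) /=; last by case.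
  rewrite (bigID (fun x : 'I_n * 'I_n => x.1 == x.2)) /= big1 ?add0r; last first.
    by move=> x /andP[_ /eqP e]; rewrite /= e subrr mul0r.
  rewrite -sumrN; apply: eq_big => [x|x _]; last by rewrite /=; ring.
  by rewrite /upper_cell /= -leqNgt -(inj_eq val_inj) /= ltn_neqAle andbC.
rewrite -sumrB big_distrl /= big_enum /=; apply: eq_bigr => x _.
by rewrite /incr /width /cell_diff; ring.
Qed.

Lemma abs_le_quad (t e : R) : 0 < e -> `|t| <= e + t ^+ 2 / e.
Proof.
move=> e0; rewrite -subr_ge0.
have -> : e + t ^+ 2 / e - `|t| = ((e - `|t| / 2) ^+ 2 + 3 / 4 * `|t| ^+ 2) / e.
  by rewrite -(real_normK (num_real t)); field; rewrite gt_eqF.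
by rewrite divr_ge0 ?(ltW e0) // addr_ge0 ?sqr_ge0 // mulr_ge0 // exprn_ge0.
Qed.

Lemma cube_le_sqr_quartic (t e : R) : 0 < e ->
  `|t| ^+ 3 <= e * t ^+ 2 + e^-1 * t ^+ 4.
Proof.
move=> e0; have -> : t ^+ 2 = `|t| ^+ 2 by rewrite real_normK ?num_real.
have -> : t ^+ 4 = `|t| ^+ 4.
  by rewrite -normrX ger0_norm // (exprM t 2 2) sqr_ge0.
have := ler_wpM2l (sqr_ge0 `|t|) (abs_le_quad `|t| e0); rewrite normr_id.
have -> : `|t| ^+ 2 * `|t| = `|t| ^+ 3 by ring.
by have -> : `|t| ^+ 2 * (e + `|t| ^+ 2 / e) = e * `|t| ^+ 2 + e^-1 * `|t| ^+ 4 by ring.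
Qed.

(** The smoothing scale s is fixed while n grows. The Lindeberg error tends to 0 since third moments
    are controlled by eta times the second plus 1/eta times the fourth; then V is replaced by its
    limit. *)
Lemma smoothed_limit (s y e : R) : 0 < s -> 0 < e -> \forall n \near \oo,
  `|mean (fun m : config n => Phi ((y - shift_stat m / u n ^+ 2) / s)) -
    Phi (y / Num.sqrt (s ^+ 2 + kap^-1))| <= e.
Proof.
move=> s0 e0; have k0 := kap_gt0 R; have p0 := peak1_gt0 R.
have kV : 0 < kap^-1 by rewrite invr_gt0.
pose C := (32 * p + 1) / s ^+ 3.
pose L := p * `|y| / s ^+ 3.
have s30 : 0 < s ^+ 3 by rewrite exprn_gt0.
have C0 : 0 < C by apply: divr_gt0 => //; lra.
have L0 : 0 <= L by apply: divr_ge0; [apply: mulr_ge0 => //; exact: ltW|exact: ltW].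
(* eta C (kap^-1 + 3) is the Lindeberg error, and 2 eta L the cost of replacing V by kap^-1. *)
pose K0 := C * (kap^-1 + 3) + 2 * L.
have K00 : 0 < K0.
  by apply: ltr_wpDr; [apply: mulr_ge0|apply: mulr_gt0 => //; lra].
have [eta [eta0 eta1 etaK]] : exists eta : R, [/\ 0 < eta, eta <= 1 & eta * K0 <= e].
  exists (Num.min 1 (e / K0)); split.
  - by rewrite lt_min ltr01 divr_gt0.
  - by rewrite ge_min lexx.
  have : Num.min 1 (e / K0) <= e / K0 by rewrite ge_min lexx orbT.
  by rewrite ler_pdivlMr.
have eta20 : 0 < eta ^+ 2 by rewrite exprn_gt0.
near=> n.
have n0 : (0 < n)%N by near: n; exact: nbhs_infty_gt.
have u0 := cbrt_gt0 R n0.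
have conc : mean (fun m : config n => (sqvar R m / u n ^+ 4 - kap^-1) ^+ 2) <= eta ^+ 2.
  by near: n; exact: sqvar_concentration.
have four : mean (@fourvar R n) <= eta ^+ 2 * u n ^+ 8 by near: n; exact: fourvar_near.
pose V (m : config n) : R := sqvar R m / u n ^+ 4.
have V0 m : 0 <= V m.
  by apply: divr_ge0; [apply: sumr_ge0 => x _; exact: sqr_ge0|exact/exprn_ge0/ltW].
have meanabs : mean (fun m => `|V m - kap^-1|) <= 2 * eta.
  apply: (@le_trans _ _ (mean (fun m : config n => eta + eta^-1 * (V m - kap^-1) ^+ 2))).
    by apply: le_mean => m; rewrite (mulrC eta^-1); exact: abs_le_quad.
  rewrite meanD mean_cst meanZ mulr2n mulrDl mul1r lerD2l.
  by rewrite -(@ler_pM2l _ eta) // mulrA mulfV ?gt_eqF // mul1r -expr2.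
have meanV : mean V <= kap^-1 + 2.
  apply: (@le_trans _ _ (mean (fun m => kap^-1 + `|V m - kap^-1|))).
    by apply: le_mean => m; have := ler_norm (V m - kap^-1); lra.
  by rewrite meanD mean_cst; lra.
have sumV m : \sum_(x <- enum (@upper_cell n)) incr x m ^+ 2 = V m.
  rewrite /V /sqvar big_enum big_distrl /=; apply: eq_bigr => x _.
  by rewrite /incr expr_div_n -exprM.
have lin := @lindeberg n s (enum (@upper_cell n)) (fun=> s ^+ 2) (fun=> y) s0 (enum_uniq _)
  (fun x => ltac:(by rewrite mem_enum)) (fun=> lexx _) (fun _ _ _ => erefl) (fun _ _ _ => erefl).
have e1 : mean (fun m : config n => Phi ((y - \sum_(x <- enum (@upper_cell n)) incr x m) / Num.sqrt (s ^+ 2))) =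
   mean (fun m : config n => Phi ((y - shift_stat m / u n ^+ 2) / s)).
  by apply: eq_mean => m; rewrite sum_incr sqrtr_sqr gtr0_norm.
have e2 : mean (fun m : config n => Phi (y / Num.sqrt (s ^+ 2 + \sum_(x <- enum (@upper_cell n)) incr x m ^+ 2))) =
   mean (fun m : config n => Phi (y / Num.sqrt (s ^+ 2 + V m))).
  by apply: eq_mean => m; rewrite sumV.
rewrite e1 e2 in lin.
have third : mean (fun m : config n => \sum_(x <- enum (@upper_cell n)) (32 * p + 1) * (`|incr x m| / s) ^+ 3)
   <= C * (eta * (kap^-1 + 3)).
  apply: (@le_trans _ _ (mean (fun m : config n => C * (eta * V m + eta^-1 * (u n ^- 8 * fourvar R m))))).
    apply: le_mean => m.
    have -> : C * (eta * V m + eta^-1 * (u n ^- 8 * fourvar R m)) =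
      \sum_(x <- enum (@upper_cell n)) C * (eta * incr x m ^+ 2 + eta^-1 * incr x m ^+ 4).
      rewrite -sumV -big_distrr /=; congr (_ * _); rewrite big_split /= -!big_distrr /=.
      congr (_ + _ * _); rewrite /fourvar big_enum big_distrr /=; apply: eq_bigr => x _.
      by rewrite /incr expr_div_n -exprM mulrC.
    apply: ler_sum => x _.
    have -> : (32 * p + 1) * (`|incr x m| / s) ^+ 3 = C * `|incr x m| ^+ 3.
      by rewrite /C; field; rewrite gt_eqF.
    rewrite ler_wpM2l ?(ltW C0) //.
    exact: cube_le_sqr_quartic.
  rewrite meanZ ler_wpM2l ?(ltW C0) // meanD !meanZ.
  have h1 := ler_wpM2l (ltW eta0) meanV.
  have h2 : eta^-1 * (u n ^- 8 * mean (@fourvar R n)) <= eta.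
    by rewrite (ler_pdivrMl _ _ eta0) -expr2 (ler_pdivrMl _ _ (exprn_gt0 8 u0)) mulrC.
  apply: (le_trans (lerD h1 h2)); rewrite -[X in _ + X](mulr1 eta) -mulrDr -addrA.
  by rewrite natr1.
have var : `|mean (fun m : config n => Phi (y / Num.sqrt (s ^+ 2 + V m))) -
    Phi (y / Num.sqrt (s ^+ 2 + kap^-1))| <= L * (2 * eta).
  rewrite -[X in `|_ - X|](@mean_cst R n).
  apply: (@le_trans _ _ (mean (fun m => L * `|V m - kap^-1|))).
    by apply: mean_abs_le => m; apply: Phi_variance_lipschitz => //; exact: ltW.
  by rewrite meanZ ler_wpM2l.
apply: (le_trans (ler_distD (mean (fun m : config n => Phi (y / Num.sqrt (s ^+ 2 + V m)))) _ _)).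
apply: le_trans (lerD (le_trans lin third) var) _.
by apply: le_trans etaK; rewrite /K0; lra.
Unshelve. all: by end_near. Qed.

End Lindeberg.

(** * From smoothed to sharp distribution functions *)

Section Assembly.
Variable R : realType.
Local Notation Phi := (@ncdf R 1).
Local Notation kap := (kap R).
Local Notation u n := (cbrt R n).
Local Notation p := (@normal_peak R 1).

Lemma powR_two_thirds n : n%:R `^ (2 / 3) = u n ^+ 2.
Proof. by rewrite -powR_mulrn ?cbrt_ge0 // /cbrt -powRrM mulrC. Qed.

Lemma cdf_Xdiff_mean n (x : R) :
  cdf_Xdiff n x = mean (fun m : config n => ((shift_stat R m / u n ^+ 2) <= x)%R%:R).
Proof.
have cardE (P : pred (config n)) : csum n 0 (fun m => (P m)%:R) = #|[set m in configs n n | P m]|%:R :> R.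
  rewrite /csum -sum1_card natr_sum big_mkcond [RHS]big_mkcond /=; apply: eq_bigr => m _.
  by rewrite !inE addn0; case: (weight m == n); case: (P m).
pose Q (a b : nat) : bool := ((a%:R - b%:R) / n%:R `^ (2 / 3) <= x :> R).
rewrite /cdf_Xdiff /mean.
rewrite (_ : [set f in PP n | Xdiff f <= x] = [set f in PP n | Q (w_plus (ext f)) (w_minus (ext f))]) //.
rewrite card_PP_configs -cardE.
have -> : #|PP n|%:R = pcount R n.
  have := @card_PP_configs n (fun _ _ => true).
  rewrite (_ : [set f in PP n | true] = PP n); last by apply/setP => f; rewrite finset.in_set andbT.
  move=> ->; rewrite -(cardE (fun=> true)); apply: eq_csum => m _; by [].
congr (_ / _); apply: eq_csum => m _; congr (nat_of_bool _)%:R.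
rewrite /Q powR_two_thirds /shift_stat !natr_sum -sumrB; congr (_ / _ <= _).
by apply: eq_bigr => y _; rewrite !natrM -mulrBl.
Qed.

Lemma Phi_tails (e : R) : 0 < e -> exists2 d0, 0 < d0 &
  forall d, 0 < d -> d <= d0 -> 1 - Phi d^-1 <= e /\ Phi (- d^-1) <= e.
Proof.
move=> e0.
have /cvgrPdist_le/(_ e e0)[A [_ hA]] := @ncdf_cvgy R 1.
have /cvgrPdist_le/(_ e e0)[B [_ hB]] := @ncdf_cvgNy R 1.
have M0 : 0 < `|A| + `|B| + 1.
  by have := normr_ge0 A; have := normr_ge0 B; lra.
exists (`|A| + `|B| + 1)^-1; first by rewrite invr_gt0.
move=> d d0 dM; have dM' : `|A| + `|B| + 1 <= d^-1.
  by rewrite -[X in X <= _]invrK lef_pV2 ?posrE ?invr_gt0.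
have nA := ler_norm A; have nB := ler_norm (- B); rewrite normrN in nB.
have A0 := normr_ge0 A; have B0 := normr_ge0 B.
split.
  by have := hA d^-1 ltac:(lra); move/(le_trans (ler_norm _)).
by have := hB (- d^-1) ltac:(lra); rewrite sub0r normrN; move/(le_trans (ler_norm _)).
Qed.

(** Removes the two traces of the smoothing from the limit: the extra variance d^4 and the shift of
    the argument by d. *)
Lemma Phi_shift_near (x e : R) : 0 < e -> exists2 d0, 0 < d0 & forall d, 0 < d -> d <= d0 ->
  forall y, `|y - x| <= d ->
  `|Phi (y / Num.sqrt ((d ^+ 2) ^+ 2 + kap^-1)) - Phi (x / Num.sqrt kap^-1)| <= e.
Proof.
move=> e0; have k0 := kap_gt0 R; have p0 := peak1_gt0 R.
have kV : 0 < kap^-1 by rewrite invr_gt0.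
pose s : R := Num.sqrt kap^-1; have s0 : 0 < s by rewrite sqrtr_gt0.
have s2 : s ^+ 2 = kap^-1 by rewrite sqr_sqrtr // ltW.
pose K : R := p * (`|x| + 1) / s ^+ 3 + p / s.
have x0 := normr_ge0 x.
have K0 : 0 < K.
  rewrite /K addr_gt0 //; last by rewrite divr_gt0.
  by apply: divr_gt0; [apply: mulr_gt0 => //; lra|exact: exprn_gt0].
exists (Num.min 1 (e / K)); first by rewrite lt_min ltr01 divr_gt0.
move=> d d0; rewrite le_min => /andP[d1 dK] y yx.
rewrite ler_pdivlMr // in dK.
have ylim : `|y| <= `|x| + 1.
  have := ler_normD x (y - x); rewrite addrCA subrr addr0 => h; lra.
have a0 : 0 <= (d ^+ 2) ^+ 2 by exact: sqr_ge0.
have l1 := @Phi_variance_lipschitz R s y ((d ^+ 2) ^+ 2) 0 s0 a0 (lexx 0).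
rewrite s2 addr0 subr0 (ger0_norm a0) (addrC kap^-1) in l1.
have l2 := Phi_lipschitz (x / s) (y / s).
rewrite -mulrBl normrM (gtr0_norm (_ : 0 < s^-1)) ?invr_gt0 // in l2.
have d4 : (d ^+ 2) ^+ 2 <= d.
  have : d ^+ 2 <= d by rewrite expr2 ler_piMr // ltW.
  have := sqr_ge0 d; nra.
have q1 : p * `|y| / s ^+ 3 * (d ^+ 2) ^+ 2 <= p * (`|x| + 1) / s ^+ 3 * d.
  apply: ler_pM => //.
    by apply: divr_ge0; [apply: mulr_ge0 => //; exact: ltW|exact/exprn_ge0/ltW].
  by rewrite ler_wpM2r ?invr_ge0 ?exprn_ge0 ?(ltW s0) // ler_wpM2l // ltW.
have q2 : p * (`|y - x| / s) <= p / s * d.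
  rewrite -[X in _ <= X]mulrA ler_wpM2l ?(ltW p0) // mulrC ler_wpM2l // invr_ge0 ltW //.
apply: (le_trans (ler_distD (Phi (y / s)) _ _)).
apply: (le_trans (lerD (le_trans l1 q1) (le_trans l2 q2))).
by apply: le_trans dK; rewrite /K; lra.
Qed.

(** The smoothing scale d^2 is small compared with the shift d, so on the wrong side of x the kernel
    is off by at most the normal tails at 1/d. *)
Lemma indicator_sandwich (x X d : R) : 0 < d ->
  Phi ((x - d - X) / d ^+ 2) - Phi (- d^-1) <= (X <= x)%R%:R /\
  (X <= x)%R%:R <= Phi ((x + d - X) / d ^+ 2) + (1 - Phi d^-1).
Proof.
move=> d0; have d20 : 0 < d ^+ 2 by rewrite exprn_gt0.
have dV : d^-1 = d / d ^+ 2 by field; rewrite gt_eqF.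
have ge0 := @ncdf_ge0 R 1; have le1 := @ncdf_le1 R 1.
case: (leP X x) => Xx; rewrite ?mulr1n ?mulr0n; split.
- by have := le1 ((x - d - X) / d ^+ 2); have := ge0 (- d^-1); lra.
- have : Phi d^-1 <= Phi ((x + d - X) / d ^+ 2).
    by apply: ncdf_homo; rewrite dV ler_wpM2r ?invr_ge0 ?(ltW d20) //; lra.
  by lra.
- have : Phi ((x - d - X) / d ^+ 2) <= Phi (- d^-1).
    by apply: ncdf_homo; rewrite dV -mulNr ler_wpM2r ?invr_ge0 ?(ltW d20) //; lra.
  by lra.
by have := ge0 ((x + d - X) / d ^+ 2); have := le1 d^-1; lra.
Qed.

End Assembly.

Unset Implicit Arguments.

(* c = 1/(2 zeta(3))^{1/3}; N(0,c) has variance c, i.e. standard deviation sqrt c.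
   normal_prob m s is the normal law with mean m and standard deviation s. *)
Theorem theorem3 (R : realType) :
  cvg_in_law (@cdf_Xdiff R)
    (normal_prob 0 (Num.sqrt (1 / ((2 * zeta3) `^ (1 / 3 : R))))).
Proof.
move=> x _; have k0 := kap_gt0 R.
have sE : Num.sqrt (1 / ((2 * zeta3) `^ (1 / 3 : R))) = Num.sqrt (kap R)^-1.
  by rewrite !div1r.
have s0 : 0 < Num.sqrt (kap R)^-1 by rewrite sqrtr_gt0 invr_gt0.
rewrite sE -/(ncdf _ x) ncdf_scale //.
(* Thirds of e: the tails of the smoothing kernel, the smoothed limit, and the removal of the
   smoothing from the limit. *)
apply/cvgrPdist_le => e e0; have e30 : 0 < e / 3 by lra.
have [d1 d10 tails] := Phi_tails e30.
have [d2 d20 shift] := Phi_shift_near x e30.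
pose d := Num.min d1 d2; have d0 : 0 < d by rewrite lt_min d10.
have [t1 t2] := tails d d0 (ltac:(by rewrite ge_min lexx)).
have sh y := shift d d0 (ltac:(by rewrite ge_min lexx orbT)) y.
have up := sh (x + d) ltac:(by rewrite addrAC subrr add0r gtr0_norm).
have dn := sh (x - d) ltac:(by rewrite addrAC subrr add0r normrN gtr0_norm).
near=> n.
have lup : `|mean (fun m : config n => ncdf 1 ((x + d - shift_stat R m / cbrt R n ^+ 2) / d ^+ 2)) -
    ncdf 1 ((x + d) / Num.sqrt ((d ^+ 2) ^+ 2 + (kap R)^-1))| <= e / 3.
  by near: n; apply: smoothed_limit => //; exact: exprn_gt0.
have ldn : `|mean (fun m : config n => ncdf 1 ((x - d - shift_stat R m / cbrt R n ^+ 2) / d ^+ 2)) -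
    ncdf 1 ((x - d) / Num.sqrt ((d ^+ 2) ^+ 2 + (kap R)^-1))| <= e / 3.
  by near: n; apply: smoothed_limit => //; exact: exprn_gt0.
rewrite cdf_Xdiff_mean; set F := mean _.
have F1 : F <= mean (fun m : config n => ncdf 1 ((x + d - shift_stat R m / cbrt R n ^+ 2) / d ^+ 2)) +
    (1 - ncdf 1 d^-1).
  rewrite -[X in _ + X](@mean_cst R n) -meanD; apply: le_mean => m.
  by have [] := indicator_sandwich x (shift_stat R m / cbrt R n ^+ 2) d0.
have F2 : mean (fun m : config n => ncdf 1 ((x - d - shift_stat R m / cbrt R n ^+ 2) / d ^+ 2)) -
    ncdf 1 (- d^-1) <= F.
  rewrite -[X in _ + X](@mean_cst R n) -meanD; apply: le_mean => m.
  by have [] := indicator_sandwich x (shift_stat R m / cbrt R n ^+ 2) d0.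
move: up dn lup ldn; rewrite !ler_norml => /andP[a1 a2] /andP[b1 b2] /andP[c1 c2] /andP[f1 f2].
by apply/andP; split; lra.
Unshelve. all: by end_near. Qed.
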